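(* Let $n\geq 1$ be an integer, and let $f_{\rm Kr}(t)$ be a function defining a complex Krichever genus (non-degenerate or degenerate). Suppose that there is a constant $C\in\mathbb{C}$ such that $f=f_{\rm Kr}$ satisfies the Hirzebruch functional equation $$\sum_{k=0}^n\ \prod_{0\le i\le n,\ i\ne k} \frac{1}{f(u_i-u_k)} = C$$ identically in $u_0,\ldots,u_n$. Then one of the following cases holds: (i) $f_{\rm Kr}(t)=f_{\rm Td}(t)=\dfrac{e^{\alpha t}-e^{\beta t}}{\alpha e^{\beta t}-\beta e^{\alpha t}}$ for some values $\alpha,\beta\in\mathbb{C}$; (ii) $f_{\rm Kr}(t)$ is an elliptic function of level $d$ (possibly degenerate) for some integer $d>1$ such that $d$ divides $n+1$.
   Context: Krichever functions. Let $\Lambda\subset\mathbb{C}$ be a lattice of rank 2 with Weierstrass functions $\sigma,\zeta$. For $s\in\mathbb{C}\setminus\Lambda$ the Baker--Akhiezer function is $\Phi_s(t)=\frac{\sigma(s-t)}{\sigma(s)\sigma(t)}e^{\zeta(s)t}$. A non-degenerate Krichever function is $f_{\rm Kr}(t)=e^{\alpha t}/\Phi_s(t)$ with $\alpha\in\mathbb{C}$; it satisfies $f_{\rm Kr}(0)=0$, $f_{\rm Kr}'(0)=1$. When the elliptic curve degenerates, $f_{\rm Kr}$ becomes a degenerate Krichever function $f_{\rm sing}(t)=\frac{e^{\lambda t}}{q+\eta\coth(\eta t)}$ with $\lambda,q,\eta\in\mathbb{C}$, where for $\eta=0$ the expression is understood as the limit $\frac{te^{\lambda t}}{1+qt}$.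 The Todd function. $f_{\rm Td}(t)=\frac{e^{\alpha t}-e^{\beta t}}{\alpha e^{\beta t}-\beta e^{\alpha t}}$; for $\alpha=\beta$ it is understood as the limit $\frac{t}{1-\beta t}$. Elliptic functions of level $d$. Let $d>1$ be an integer, $\Lambda\subset\mathbb{C}$ a lattice and $P\in\mathbb{C}\setminus\Lambda$ with $dP\in\Lambda$. There is a unique $\Lambda$-periodic meromorphic function $g(t)=t^d+\ldots$ with a zero of order $d$ at $0$, a pole of order $d$ at $P$, and no other zeros or poles modulo $\Lambda$. The function $f_d(t)=\sqrt[d]{g(t)}$, where the root is chosen so that $f_d(t)=t+\ldots$, is called an elliptic function of level $d$. Degenerate elliptic functions of level $d$ are the limits (coefficientwise, as power series in $t$) of such functions $f_d$ as the elliptic curve $\mathbb{C}/\Lambda$ degenerates (its discriminant tends to $0$). *)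

(* Defs.v *)
From HB Require Import structures.
From mathcomp Require Import all_boot all_order all_algebra.
From mathcomp Require Import all_classical all_reals all_analysis.
From mathcomp Require Import complex.

Set Implicit Arguments.
Unset Strict Implicit.
Unset Printing Implicit Defensive.

Import Order.TTheory GRing.Theory Num.Theory.
Import numFieldNormedType.Exports.

Local Open Scope classical_set_scope.
Local Open Scope ring_scope.
Local Open Scope complex_scope.

(* A meromorphic function is represented by a total function Cplx R -> Cplx R
   whose value at each of its poles is 0; since x / 0 = 0, most of the closed
   formulas below satisfy this convention as they stand. In particular f is
   regular and nonzero at t exactly when f t != 0. *)

(* Typing the field as a bare numFieldType gives it the generic topology and
   norm of numFieldNormedType, which R[i] itself is not equipped with. *)
Definition Cplx (R : realType) : numFieldType := R[i].

Section Functions.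
Variable R : realType.
Local Notation C := (Cplx R).

Definition cexp (z : C) : C :=
  (expR (complex.Re z))%:C *
  (cos (complex.Im z) +i* sin (complex.Im z)).
Definition csinh (z : C) : C := (cexp z - cexp (- z)) / 2%:R.
Definition ccosh (z : C) : C := (cexp z + cexp (- z)) / 2%:R.
Definition ccoth (z : C) : C := ccosh z / csinh z.

Record lattice := Lattice {
  per1 : C;
  per2 : C;
  per_free : forall a b : R,
    (a%:C : C) * per1 + (b%:C : C) * per2 = 0 -> a = 0 /\ b = 0
}.

Definition lattice_pt (L : lattice) (m n : int) : C :=
  per1 L *~ m + per2 L *~ n.

Definition lattice_set (L : lattice) : set C :=
  [set w | exists m n : int, w = lattice_pt L m n].

(* The points m per1 + n per2 with |m|, |n| <= N. The lattice sums and products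
   below converge absolutely, so their values do not depend on the choice of
   this exhaustion, nor on the chosen basis. *)
Definition lattice_box (L : lattice) (N : nat) : seq C :=
  [seq lattice_pt L (i%:Z - N%:Z) (j%:Z - N%:Z)
     | i <- iota 0 N.*2.+1, j <- iota 0 N.*2.+1].

Definition lattice_sum (L : lattice) (F : C -> C) : C :=
  lim ((fun N => \sum_(w <- lattice_box L N | w != 0) F w) @ \oo).

Definition lattice_prod (L : lattice) (F : C -> C) : C :=
  lim ((fun N => \prod_(w <- lattice_box L N | w != 0) F w) @ \oo).

Definition sigma (L : lattice) (z : C) : C :=
  z * lattice_prod L
        (fun w => (1 - z / w) * cexp (z / w + (z / w) ^+ 2 / 2%:R)).

Definition zeta (L : lattice) (z : C) : C :=
  z^-1 + lattice_sum L (fun w => (z - w)^-1 + w^-1 + z / w ^+ 2).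

Definition g2 (L : lattice) : C := 60%:R * lattice_sum L (fun w => w ^- 4).
Definition g3 (L : lattice) : C := 140%:R * lattice_sum L (fun w => w ^- 6).
Definition discriminant (L : lattice) : C :=
  g2 L ^+ 3 - 27%:R * g3 L ^+ 2.

Definition baker_akhiezer (L : lattice) (s t : C) : C :=
  sigma L (s - t) / (sigma L s * sigma L t) * cexp (zeta L s * t).

Definition krichever_fun (L : lattice) (s alpha t : C) : C :=
  cexp (alpha * t) / baker_akhiezer L s t.

(* The test on csinh gives the value 0 at the poles of coth (eta t). *)
Definition sing_fun (lambda q eta t : C) : C :=
  if eta == 0 then t * cexp (lambda * t) / (1 + q * t)
  else if csinh (eta * t) == 0 then 0
  else cexp (lambda * t) / (q + eta * ccoth (eta * t)).

Definition is_krichever (f : C -> C) : Prop :=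
  (exists (L : lattice) (s alpha : C),
     ~ lattice_set L s /\ forall t, f t = krichever_fun L s alpha t) \/
  (exists lambda q eta : C, forall t, f t = sing_fun lambda q eta t).

Definition todd_fun (alpha beta t : C) : C :=
  if alpha == beta then t / (1 - beta * t)
  else (cexp (alpha * t) - cexp (beta * t)) /
       (alpha * cexp (beta * t) - beta * cexp (alpha * t)).

(* g(z) = (z - p)^m (c + O(z - p)) with a holomorphic second factor. As the
   equation is also required at z = p, where 0 ^ m = 0 for m < 0, it includes
   the convention on the value at poles. *)
Definition leading_term (g : C -> C) (p : C) (m : int) (c : C) : Prop :=
  exists h : C -> C,
    [/\ \forall z \near p, derivable h z 1,
        h p = c &
        \forall z \near p, g z = (z - p) ^ m * h z].

Definition has_order (g : C -> C) (p : C) (m : int) : Prop :=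
  exists2 c : C, c != 0 & leading_term g p m c.

(* Meromorphic on the whole plane and not identically zero. *)
Definition meromorphic (g : C -> C) : Prop :=
  forall p : C, exists m : int, has_order g p m.

Definition is_level_power (L : lattice) (P : C) (d : nat) (g : C -> C) : Prop :=
  [/\ meromorphic g,
      forall w z, lattice_set L w -> g (z + w) = g z,
      leading_term g 0 d%:Z 1,
      has_order g P (- d%:Z) &
      forall z, ~ lattice_set L z -> ~ lattice_set L (z - P) ->
        has_order g z 0].

Definition is_elliptic_level_on (L : lattice) (d : nat) (f : C -> C) : Prop :=
  exists (P : C) (g : C -> C),
    [/\ ~ lattice_set L P, lattice_set L (P *+ d), is_level_power L P d g,
        forall z, f z ^+ d = g z &
        meromorphic f /\ leading_term f 0 1 1].

Definition is_elliptic_level (d : nat) (f : C -> C) : Prop :=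
  exists L : lattice, is_elliptic_level_on L d f.

Definition has_taylor (f : C -> C) (a : nat -> C) : Prop :=
  \forall t \near (0 : C), [series a k * t ^+ k]_k @ \oo --> f t.

Definition is_degenerate_elliptic_level (d : nat) (f : C -> C) : Prop :=
  exists (L : nat -> lattice) (F : nat -> C -> C)
         (A : nat -> nat -> C) (a : nat -> C),
    [/\ forall j, is_elliptic_level_on (L j) d (F j) /\ has_taylor (F j) (A j),
        (fun j => discriminant (L j)) @ \oo --> (0 : C),
        has_taylor f a &
        forall k, (fun j => A j k) @ \oo --> a k].

(* By the convention on poles, the condition on u says that every
   f (u i - u k) is defined and invertible. *)
Definition hirzebruch_eq (n : nat) (f : C -> C) (c : C) : Prop :=
  forall u : 'I_n.+1 -> C,
    (forall i k, i != k -> f (u i - u k) != 0) ->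
    \sum_(k < n.+1) \prod_(i < n.+1 | i != k) (f (u i - u k))^-1 = c.

End Functions.

(* Main.v *)
Require Import Defs.
From mathcomp Require Import all_boot all_order all_algebra.
From mathcomp Require Import all_classical all_reals all_analysis.
From mathcomp Require Import complex.
From mathcomp Require Import ring lra zify.

(** Write N = n + 1. A Krichever function satisfies f(t + w) = chi f(t) for its
    periods w, with constant multipliers chi. Two consequences of the Hirzebruch
    equation suffice.

    - Shifting one variable by w multiplies one summand by chi^n and all others
      by chi^-1. Since that summand is unbounded near the diagonal, chi^N = 1
      ([hirzebruch_period]).
    - One variable cannot be sent to infinity in a direction T in which f(v - T)
      and 1/f(T - v) tend to 0: a single summand would become infinite while the
      others vanish ([hirzebruch_escape]).

    Non-degenerate case. The sigma function of a lattice is exp(A z^2 + B z) times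
    the theta function [thetaS] ([sigma_thetaS]), so that
    f(t) = e^(b t) S(t) S(s) / S(s - t) with S = thetaS and some b. Its divisor is
    (0) - (s), and its multipliers are explicit. That they are N-th roots of unity
    means that f^N is elliptic and that N s is a lattice point, whence f is an
    elliptic function of level N ([nondegenerate_level]). The passage from sigma to
    theta is a computation with the product over lattice boxes: a pair of opposite
    rows gives the factors 1 - q^m X and 1 - q^m / X of the triple product, by the
    sine product ([csin_prod]), and dominated convergence over the rows
    ([tannery_prod]) rests on comparing the sums of 1/a^2 along the rows with
    telescoping sums ([inv_row_cvg]).

    Degenerate case. For lambda = 0 the function is a Todd function ([sing_todd]),
    and for eta = 0 <> lambda it is excluded by escape to infinity
    ([sing_escape_0]). Otherwise the period 2 pi i / (2 eta) yields
    lambda = 2 eta k / N with an integer k, which may be taken positive as eta can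
    be replaced by - eta; escape to infinity then leaves q = eta and k <= N
    ([sing_escape_ne], [sing_escape_eq]). With X = e^(2 eta t) the function is
    X^(k/N - 1) (X - 1) / (2 eta). For k = N this is a Todd function. For k < N it
    is the limit of elliptic functions of level N whose lattices have the periods
    om = 2 pi i / (2 eta) and i (j+1) om and whose pole is k/N of the second period
    ([degenerate_level]): by the theta product the quotient by the limit tends to 1
    in the Banach algebra of power series ([deg_factor_to_one]), and the
    discriminants tend to 0 because (120 zeta(4))^3 = 27 (280 zeta(6))^2
    ([deg_discriminant]). *)

Set Implicit Arguments.
Unset Strict Implicit.
Unset Printing Implicit Defensive.
Import Order.TTheory GRing.Theory Num.Theory.
Import numFieldNormedType.Exports.
Local Open Scope classical_set_scope.
Local Open Scope ring_scope.
Local Open Scope complex_scope.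

(** * The complex modulus and limits *)

Section ComplexModulus.
Variable R : realType.
Local Notation C := (Cplx R).

(** The norm of [Cplx R] takes its values in [Cplx R], whose order is partial;
    estimates are easier for a modulus with values in R. *)
Definition cmod (z : C) : R := Num.sqrt (complex.Re z ^+ 2 + complex.Im z ^+ 2).

Lemma normE (z : C) : `|z| = (cmod z)%:C :> C.
Proof. exact: normc_def. Qed.

Lemma cmod_ge0 z : 0 <= cmod z. Proof. exact: sqrtr_ge0. Qed.

Lemma cmodM (a b : C) : cmod (a * b) = cmod a * cmod b.
Proof. by apply: complexI; rewrite rmorphM /= -!normE normrM. Qed.

Lemma cmodV (a : C) : cmod a^-1 = (cmod a)^-1.
Proof. by apply: complexI; rewrite fmorphV /= -!normE normfV. Qed.

Lemma cmodN (a : C) : cmod (- a) = cmod a.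
Proof. by apply: complexI; rewrite -!normE normrN. Qed.

Lemma cmodD (a b : C) : cmod (a + b) <= cmod a + cmod b.
Proof. by rewrite -lecR rmorphD /= -!normE; exact: (@ler_normD _ (Cplx R)). Qed.

Lemma cmodB (a b : C) : cmod (a - b) <= cmod a + cmod b.
Proof. by rewrite (le_trans (cmodD _ _))// cmodN. Qed.

Lemma cmodBC (a b : C) : cmod (a - b) = cmod (b - a).
Proof. by rewrite -cmodN opprB. Qed.

Lemma cmodX (a : C) n : cmod (a ^+ n) = cmod a ^+ n.
Proof. by apply: complexI; rewrite rmorphXn /= -!normE normrX. Qed.

Lemma cmod_real (r : R) : cmod r%:C = `|r|.
Proof. by rewrite /cmod /= expr0n /= addr0 sqrtr_sqr. Qed.

Lemma cmod0 : cmod 0 = 0. Proof. by rewrite (cmod_real 0) normr0. Qed.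

Lemma cmod1 : cmod 1 = 1. Proof. by rewrite (cmod_real 1) normr1. Qed.

Lemma real_complex_nat n : (n%:R : R)%:C = n%:R :> C.
Proof. by rewrite rmorph_nat. Qed.

Lemma cmod_nat n : cmod n%:R = n%:R.
Proof. by rewrite -real_complex_nat cmod_real ger0_norm. Qed.

Lemma cmod_eq0 (z : C) : (cmod z == 0) = (z == 0).
Proof.
apply/eqP/eqP => [h|->]; last exact: cmod0.
by apply/eqP; rewrite -normr_eq0 normE h.
Qed.

Lemma cmod_gt0 (z : C) : (0 < cmod z) = (z != 0).
Proof. by rewrite lt_def cmod_ge0 andbT cmod_eq0. Qed.

Lemma cmod_sum I (s : seq I) (P : pred I) (F : I -> C) :
  cmod (\sum_(i <- s | P i) F i) <= \sum_(i <- s | P i) cmod (F i).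
Proof.
apply: (big_ind2 (fun x y => cmod x <= y)) => //; first by rewrite cmod0.
by move=> x1 x2 y1 y2 h1 h2; rewrite (le_trans (cmodD _ _))// lerD.
Qed.

Lemma cmod_prod I (s : seq I) (P : pred I) (F : I -> C) :
  cmod (\prod_(i <- s | P i) F i) = \prod_(i <- s | P i) cmod (F i).
Proof. by apply: (big_morph cmod cmodM cmod1). Qed.

Lemma cmod_lerB (a b : C) : cmod a - cmod b <= cmod (a - b).
Proof. by rewrite lerBlDr -{1}[a](subrK b) cmodD. Qed.

Lemma cmod_lerD (a b : C) : cmod a - cmod b <= cmod (a + b).
Proof. by rewrite lerBlDr -{1}[a](addrK b) cmodB. Qed.

Lemma cmod_Re (z : C) : `|complex.Re z| <= cmod z.
Proof. by rewrite -sqrtr_sqr ler_wsqrtr// lerDl sqr_ge0. Qed.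

Lemma cmod_Im (z : C) : `|complex.Im z| <= cmod z.
Proof. by rewrite -sqrtr_sqr ler_wsqrtr// lerDr sqr_ge0. Qed.

Lemma cmod_ReIm (z : C) : cmod z <= `|complex.Re z| + `|complex.Im z|.
Proof.
case: z => a b; have h : a +i* b = a%:C + 'i * b%:C :> C.
  by simpc.
rewrite [X in cmod X]h (le_trans (cmodD _ _))// cmodM !cmod_real /=.
have -> : cmod 'i = 1 by rewrite /cmod /= expr0n /= add0r expr1n sqrtr1.
by rewrite mul1r.
Qed.

(** ** Neighbourhoods and limits through the real-valued modulus *)

Lemma posE (e : C) : 0 < e -> exists2 r : R, 0 < r & e = r%:C.
Proof.
by case: e => a b; rewrite ltcE /= => /andP[/eqP -> ha]; exists a.
Qed.

Lemma nearC (p : C) (P : C -> Prop) :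
  (\forall z \near p, P z) <->
  exists2 r : R, 0 < r & forall z, cmod (z - p) < r -> P z.
Proof.
split.
  move=> /nbhs_ballP[e /= /posE[r r0 ->] h]; exists r => // z hz.
  by apply: h; rewrite /ball /= distrC normE ltcR; exact: hz.
move=> [r r0 h]; apply/nbhs_ballP; exists (r%:C : C) => /=; first by rewrite ltcR.
by move=> z; rewrite /ball /= distrC normE ltcR; exact: h.
Qed.

Lemma cvgCP (u : nat -> C) (l : C) :
  u @ \oo --> l <->
  forall e : R, 0 < e -> \forall n \near \oo, cmod (u n - l) < e.
Proof.
split=> [/cvgrPdist_lt h e e0|h].
  have := h (e%:C : C); rewrite ltcR => /(_ e0).
  by apply: filterS => n; rewrite distrC normE ltcR.
apply/cvgrPdist_lt => e /posE[r r0 ->]; apply: filterS (h r r0) => n.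
by rewrite distrC normE ltcR.
Qed.

Lemma squeezeC (u : nat -> C) (l : C) (v : nat -> R) :
  (\forall n \near \oo, cmod (u n - l) <= v n) -> v @ \oo --> (0 : R) ->
  u @ \oo --> l.
Proof.
move=> h /cvgr0Pnorm_lt hv; apply/cvgCP => e e0.
near=> n; apply: le_lt_trans (_ : v n < e); first by near: n.
by rewrite (le_lt_trans (ler_norm _))//; near: n; exact: hv.
Unshelve. all: by end_near. Qed.

Lemma cvgC_cmod (u : nat -> C) (l : C) :
  u @ \oo --> l -> (fun n => cmod (u n)) @ \oo --> cmod l.
Proof.
move=> /cvgCP h; apply/cvgrPdist_lt => e e0.
apply: filterS (h e e0) => n; apply: le_lt_trans.
rewrite ler_norml; apply/andP; split.
  by rewrite lerNl opprB cmod_lerB.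
by rewrite cmodBC cmod_lerB.
Qed.

Lemma cvgC_cmod0 (u : nat -> C) (l : C) :
  u @ \oo --> l -> (fun n => cmod (u n - l)) @ \oo --> (0 : R).
Proof.
move=> h; rewrite -cmod0 -(subrr l); apply: cvgC_cmod.
exact: (cvgB h (cvg_cst _)).
Qed.

Lemma cvgC_real (u : nat -> R) (l : R) :
  u @ \oo --> l -> (fun n => (u n)%:C : C) @ \oo --> (l%:C : C).
Proof.
move=> /cvgrPdist_lt h; apply/cvgCP => e e0; apply: filterS (h e e0) => n.
by rewrite -rmorphB /= cmod_real distrC.
Qed.

Lemma cvgC_unique (u : nat -> C) (l l' : C) :
  u @ \oo --> l -> u @ \oo --> l' -> l = l'.
Proof. by apply: cvg_unique; exact: norm_hausdorff. Qed.

Lemma limC (u : nat -> C) (l : C) : u @ \oo --> l -> lim (u @ \oo) = l.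
Proof. by apply: cvg_lim; exact: norm_hausdorff. Qed.

Lemma cvgC_le (u : nat -> C) (l : C) (B : R) :
  u @ \oo --> l -> (\forall n \near \oo, cmod (u n) <= B) -> cmod l <= B.
Proof.
move=> /cvgC_cmod h hB; rewrite -(cvg_lim (@Rhausdorff R) h).
by apply: limr_le => //; apply/cvg_ex; exists (cmod l).
Qed.

(** Completeness of C is inherited from R through the real and imaginary parts;
    the modulus of convergence e also bounds the distance to the limit. *)
Lemma cauchyR_cvg (u : nat -> R) (e : nat -> R) :
  (forall n m, (n <= m)%N -> `|u m - u n| <= e n) -> e @ \oo --> (0 : R) ->
  exists l : R, u @ \oo --> l.
Proof.
move=> h he; apply/cvg_ex; apply: cauchy_cvg; apply: cauchy_exP => d d0.
have /cvgr0Pnorm_lt/(_ d d0)[N _ hN] := he.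
exists (u N), N => // m /= hm; rewrite /ball /= distrC.
by rewrite (le_lt_trans (h _ _ hm))// (le_lt_trans (ler_norm _))// hN /=.
Qed.

Lemma cauchyC_cvg (u : nat -> C) (e : nat -> R) :
  (forall n m, (n <= m)%N -> cmod (u m - u n) <= e n) -> e @ \oo --> (0 : R) ->
  exists l : C, u @ \oo --> l /\ forall n, cmod (l - u n) <= e n.
Proof.
move=> h he.
have [a ha] : exists l : R, (fun n => complex.Re (u n)) @ \oo --> l.
  apply: (cauchyR_cvg _ he) => n m nm; apply: le_trans (h n m nm).
  by apply: le_trans (cmod_Re _); rewrite raddfB.
have [b hb] : exists l : R, (fun n => complex.Im (u n)) @ \oo --> l.
  apply: (cauchyR_cvg _ he) => n m nm; apply: le_trans (h n m nm).
  by apply: le_trans (cmod_Im _); rewrite raddfB.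
have hu : u @ \oo --> (a +i* b : C).
  apply: (@squeezeC _ _ (fun n => `|complex.Re (u n) - a| + `|complex.Im (u n) - b|)).
    apply: nearW => n; apply: le_trans (cmod_ReIm _) _.
    by rewrite [complex.Re _]raddfB [complex.Im _]raddfB.
  rewrite -[X in _ --> X]addr0; apply: cvgD.
    rewrite -(normr0 R) -(subrr a); apply: cvg_norm; apply: cvgB => //.
    exact: cvg_cst.
  rewrite -(normr0 R) -(subrr b); apply: cvg_norm; apply: cvgB => //.
  exact: cvg_cst.
move: (a +i* b : C) hu => l hu; exists l; split=> // n.
apply: (@cvgC_le (fun m => u m - u n)).
  exact: (cvgB hu (cvg_cst _)).
by exists n => // m /= nm; exact: h.
Qed.

(** All derivatives below are obtained from a quadratic estimate of the remainder. *)
Lemma derivable_quadratic (f : C -> C) (z D : C) (K r : R) : 0 < r ->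
  (forall h, cmod h < r -> cmod (f (z + h) - f z - h * D) <= K * cmod h ^+ 2) ->
  derivable f z 1.
Proof.
move=> r0 H; apply/cvg_ex; exists D; apply/cvgrPdist_lt => e /posE[d d0 ->].
have [K0 K00 hK0] : exists2 K0, 0 < K0 & K <= K0.
  by exists (`|K| + 1); rewrite ?ltr_wpDl// (le_trans (ler_norm K))// lerDl.
rewrite /dnbhs near_withinE; apply/nearC; exists (Num.min r (d / K0)).
  by rewrite lt_min r0 divr_gt0.
move=> h; rewrite subr0 lt_min => /andP[hr hd] h0.
rewrite normE ltcR /=.
have -> : D - h^-1 *: (f (h *: 1 + z) - f z) = - (h^-1 * (f (z + h) - f z - h * D)).
  rewrite [h *: 1]mulr1 [h + z]addrC -[_ *: _]/(_ * _); field. exact: h0.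
have ch0 : 0 < cmod h by rewrite cmod_gt0.
rewrite cmodN cmodM cmodV mulrC ltr_pdivrMr//.
apply: le_lt_trans (H h hr) _.
rewrite expr2 mulrA ltr_pM2r// (le_lt_trans (ler_wpM2r _ hK0)) ?cmod_ge0//.
by rewrite mulrC -ltr_pdivlMr.
Qed.
End ComplexModulus.

(** * Absolutely convergent series *)

Section AbsoluteConvergence.
Variable R : realType.
Local Notation C := (Cplx R).

Lemma cvg0_lt (e : nat -> R) (d : R) : e @ \oo --> (0 : R) -> 0 < d ->
  exists N, forall n, (N <= n)%N -> e n < d.
Proof.
move=> /cvgr0Pnorm_lt h /h[N _ hN]; exists N => n Nn.
by rewrite (le_lt_trans (ler_norm _))// hN.
Qed.

(** The remainders T - (partial sum) serve as moduli of convergence. *)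
Lemma bounded_series (v : nat -> R) (B : R) :
  (forall k, 0 <= v k) -> (forall n, \sum_(0 <= k < n) v k <= B) ->
  exists T : R, [/\ T <= B, forall n, \sum_(0 <= k < n) v k <= T &
    (fun n => T - \sum_(0 <= k < n) v k) @ \oo --> (0 : R)].
Proof.
move=> v0 hB.
have nd : nondecreasing_seq (fun n => \sum_(0 <= k < n) v k).
  by apply/nondecreasing_seqP => n; rewrite big_nat_recr //= lerDl.
have cv : cvgn (fun n => \sum_(0 <= k < n) v k).
  apply: nondecreasing_is_cvgn => //.
  by exists B => _ [n _ <-]; exact: hB.
have [T hT] : exists T : R, (fun n => \sum_(0 <= k < n) v k) @ \oo --> T.
  by apply/cvg_ex; exact: cv.
exists T; split.
- by rewrite -(cvg_lim (@Rhausdorff R) hT); apply: (limr_le cv); exact: nearW.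
- move=> n; rewrite -(cvg_lim (@Rhausdorff R) hT).
  exact: nondecreasing_cvgn_le.
by rewrite -[X in _ --> X](subrr T); apply: cvgB; [exact: cvg_cst|exact: hT].
Qed.

Lemma sum_tail (V : zmodType) (u : nat -> V) n m : (n <= m)%N ->
  \sum_(0 <= k < m) u k - \sum_(0 <= k < n) u k = \sum_(n <= k < m) u k.
Proof. by move=> nm; rewrite (big_cat_nat _ nm)//= addrAC subrr add0r. Qed.

Lemma abs_cvg (u : nat -> C) (v : nat -> R) (B : R) :
  (forall k, cmod (u k) <= v k) -> (forall n, \sum_(0 <= k < n) v k <= B) ->
  exists l : C, series u @ \oo --> l.
Proof.
move=> huv hB.
have v0 k : 0 <= v k by exact: le_trans (cmod_ge0 _) (huv k).
have [T [_ hT cvT]] := bounded_series v0 hB.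
have [l [hl _]] : exists l : C, series u @ \oo --> l /\
    forall n, cmod (l - series u n) <= T - \sum_(0 <= k < n) v k.
  apply: cauchyC_cvg cvT => n m nm; rewrite /series /= sum_tail//.
  rewrite (le_trans (cmod_sum _ _ _))//.
  apply: (@le_trans _ _ (\sum_(n <= k < m) v k)).
    by apply: ler_sum => i _; exact: huv.
  by rewrite -(sum_tail v nm) lerD2r hT.
by exists l.
Qed.

Lemma geo_sum (x : R) n : 0 <= x -> x < 1 ->
  \sum_(0 <= k < n) x ^+ k <= (1 - x)^-1.
Proof.
move=> x0 x1; have d0 : 0 < 1 - x by rewrite subr_gt0.
have e : \sum_(0 <= k < n) x ^+ k = (1 - x ^+ n) / (1 - x).
  elim: n => [|n IH]; first by rewrite big_nil expr0 subrr mul0r.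
  rewrite big_nat_recr //= IH exprS; field; exact: lt0r_neq0.
by rewrite e ler_pdivrMr// mulVf ?lt0r_neq0// gerBl exprn_ge0.
Qed.

Lemma ratio_bounded (v : nat -> R) (x : R) N :
  (forall k, 0 <= v k) -> 0 <= x -> x < 1 ->
  (forall k, (N <= k)%N -> v k.+1 <= x * v k) ->
  exists B, forall n, \sum_(0 <= k < n) v k <= B.
Proof.
move=> v0 x0 x1 hv.
exists (\sum_(0 <= k < N) v k + v N * (1 - x)^-1) => n.
have vg k : v (N + k)%N <= v N * x ^+ k.
  elim: k => [|k IH]; first by rewrite addn0 mulr1.
  rewrite addnS (le_trans (hv _ _)) ?leq_addr//.
  by rewrite exprS mulrCA ler_wpM2l.
have hN : \sum_(N <= k < N + n) v k <= v N * (1 - x)^-1.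
  rewrite -{1}[N]add0n big_addn addKn.
  apply: (@le_trans _ _ (\sum_(0 <= k < n) v N * x ^+ k)).
    by apply: ler_sum => k _; rewrite addnC.
  by rewrite -mulr_sumr ler_wpM2l// geo_sum.
apply: (@le_trans _ _ (\sum_(0 <= k < N + n) v k)).
  rewrite [leRHS](@big_cat_nat _ _ _ n)//= ?leq_addl//.
  by rewrite lerDl sumr_ge0.
by rewrite [leLHS](@big_cat_nat _ _ _ N)//= ?leq_addr// lerD2l.
Qed.

End AbsoluteConvergence.

(** * Power series on a closed disc *)

Section PowerSeries.
Variable R : realType.
Local Notation C := (Cplx R).

(** The norm of a is at most B in the Banach algebra of power series that converge
    absolutely on the closed disc of radius r, with norm sum |a_k| r^k. *)
Definition wbound (r : R) (a : nat -> C) (B : R) :=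
  forall n, \sum_(0 <= k < n) cmod (a k) * r ^+ k <= B.

(** On that disc, f is the sum of an element of this Banach algebra of norm at
    most B. The bound is carried along, since it controls limits of such functions. *)
Definition expands (r : R) (f : C -> C) (a : nat -> C) (B : R) :=
  wbound r a B /\
  forall z, cmod z <= r -> series (fun k => a k * z ^+ k) @ \oo --> f z.

Definition psval (a : nat -> C) (z : C) : C :=
  lim (series (fun k => a k * z ^+ k) @ \oo).

Lemma cmod_term_le (r : R) (c : C) z k : cmod z <= r ->
  cmod (c * z ^+ k) <= cmod c * r ^+ k.
Proof.
move=> zr; rewrite cmodM cmodX ler_wpM2l ?cmod_ge0//.
by rewrite lerXn2r ?nnegrE ?cmod_ge0// (le_trans (cmod_ge0 z)).
Qed.

Lemma expands_psval r a B : wbound r a B -> expands r (psval a) a B.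
Proof.
move=> ha; split=> // z zr.
have [l hl] := abs_cvg (fun k => cmod_term_le (a k) k zr) ha.
by rewrite /psval (limC hl).
Qed.

Lemma expands_bound r f a B z : expands r f a B -> cmod z <= r ->
  cmod (f z) <= B.
Proof.
move=> [ha hf] zr; apply: (cvgC_le (hf z zr)); apply: nearW => n.
rewrite (le_trans (cmod_sum _ _ _))// (le_trans _ (ha n))//.
by apply: ler_sum => k _; exact: cmod_term_le.
Qed.

Lemma expands_ext r f g a B : (forall z, cmod z <= r -> f z = g z) ->
  expands r f a B -> expands r g a B.
Proof.
move=> fg [h1 h2]; split=> [|z zr]; first exact: h1.
rewrite -(fg z zr); exact: h2.
Qed.

Lemma expands_cst r (c : C) :
  expands r (fun=> c) (fun k => if k is 0 then c else 0) (cmod c).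
Proof.
have sumE (V : nmodType) (u : nat -> V) n :
    (forall k, u k.+1 = 0) -> \sum_(0 <= k < n.+1) u k = u 0.
  by move=> u0; rewrite big_nat_recl //= big1 ?addr0.
split=> [[|n]|z zr].
- by rewrite big_nil cmod_ge0.
- by rewrite sumE ?expr0 ?mulr1// => k; rewrite cmod0 mul0r.
apply: (@squeezeC _ _ _ (fun=> 0)); last exact: cvg_cst.
exists 1%N => // -[|n] //= _; rewrite /series /= sumE ?expr0 ?mulr1 ?subrr ?cmod0//.
by move=> k; rewrite mul0r.
Qed.

Lemma expands_add r f g a b A B : 0 <= r -> expands r f a A -> expands r g b B ->
  expands r (fun z => f z + g z) (fun k => a k + b k) (A + B).
Proof.
move=> r0 [ha hf] [hb hg]; split=> [n|z zr].
  apply: le_trans (lerD (ha n) (hb n)); rewrite -big_split /=.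
  by apply: ler_sum => k _; rewrite -mulrDl ler_wpM2r ?exprn_ge0 ?cmodD.
have -> : series (fun k => (a k + b k) * z ^+ k) =
    (fun n => series (fun k => a k * z ^+ k) n + series (fun k => b k * z ^+ k) n).
  apply/funext => n; rewrite /series /= -big_split /=.
  by apply: eq_bigr => k _; rewrite mulrDl.
exact: cvgD (hf z zr) (hg z zr).
Qed.

Lemma expands_scale r f a A (c : C) : expands r f a A ->
  expands r (fun z => c * f z) (fun k => c * a k) (cmod c * A).
Proof.
move=> [ha hf]; split=> [n|z zr].
  apply: le_trans (ler_wpM2l (cmod_ge0 c) (ha n)); rewrite mulr_sumr.
  by apply: ler_sum => k _; rewrite cmodM mulrA.
have -> : series (fun k => (c * a k) * z ^+ k) =
    (fun n => c * series (fun k => a k * z ^+ k) n).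
  apply/funext => n; rewrite /series /= mulr_sumr.
  by apply: eq_bigr => k _; rewrite mulrA.
by apply: cvgM; [exact: cvg_cst|exact: hf].
Qed.

Definition conv (V : pzRingType) (a b : nat -> V) (k : nat) : V :=
  \sum_(0 <= i < k.+1) a i * b (k - i)%N.

Lemma conv_sum (V : pzRingType) (u v : nat -> V) n :
  \sum_(0 <= k < n) conv u v k =
  \sum_(0 <= i < n) u i * \sum_(0 <= j < n - i) v j.
Proof.
elim: n => [|n IH]; first by rewrite !big_nil.
rewrite big_nat_recr //= IH /conv [RHS]big_nat_recr //= subSnn big_nat1.
rewrite [in LHS]big_nat_recr //= subnn addrA; congr (_ + _).
rewrite -big_split /=; apply: eq_big_nat => i /andP[_ ltin].
by rewrite subSn ?(ltnW ltin)// [in RHS]big_nat_recr //= mulrDr.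
Qed.

Lemma conv_termE (a b : nat -> C) z k :
  conv a b k * z ^+ k = conv (fun i => a i * z ^+ i) (fun i => b i * z ^+ i) k.
Proof.
rewrite /conv mulr_suml; apply: eq_big_nat => i /andP[_ lei].
by rewrite -[in z ^+ k](@subnKC i k)// exprD mulrACA.
Qed.

(** Both differences run over the pairs (i, j) with i, j < n and i + j >= n. The
    right-hand side tends to 0, since a bounded increasing sequence is Cauchy. *)
Lemma prod_sub_conv_le (u v : nat -> C) n :
  cmod ((\sum_(0 <= k < n) u k) * (\sum_(0 <= k < n) v k) -
    \sum_(0 <= k < n) conv u v k) <=
  (\sum_(0 <= k < n) cmod (u k)) * (\sum_(0 <= k < n) cmod (v k)) -
    \sum_(0 <= k < n) conv (fun k => cmod (u k)) (fun k => cmod (v k)) k.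
Proof.
rewrite !conv_sum !mulr_suml -!sumrB (le_trans (cmod_sum _ _ _))//.
apply: ler_sum => i _; rewrite -!mulrBr cmodM ler_wpM2l ?cmod_ge0//.
by rewrite !sum_tail ?leq_subr// cmod_sum.
Qed.

(** The Cauchy product, with the submultiplicativity of the weighted norm. *)
Lemma expands_mul r f g a b A B : 0 <= r -> expands r f a A -> expands r g b B ->
  expands r (fun z => f z * g z) (conv a b) (A * B).
Proof.
move=> r0 [ha hf] [hb hg].
pose u k := cmod (a k) * r ^+ k; pose v k := cmod (b k) * r ^+ k.
have u0 k : 0 <= u k by rewrite mulr_ge0 ?cmod_ge0 ?exprn_ge0.
have v0 k : 0 <= v k by rewrite mulr_ge0 ?cmod_ge0 ?exprn_ge0.
have cv0 k : 0 <= conv u v k by apply: sumr_ge0 => i _; rewrite mulr_ge0.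
have B0 : 0 <= B by apply: le_trans (hb 0%N); rewrite big_nil.
have hW n : \sum_(0 <= k < n) conv u v k <= A * B.
  rewrite conv_sum; apply: le_trans (ler_wpM2r B0 (ha n)).
  rewrite mulr_suml; apply: ler_sum => i _.
  by apply: ler_wpM2l; [exact: u0|exact: hb].
split=> [n|z zr].
  apply: le_trans (hW n); apply: ler_sum => k _.
  rewrite /conv (le_trans (ler_wpM2r _ (cmod_sum _ _ _))) ?exprn_ge0//.
  rewrite mulr_suml big_nat [leRHS]big_nat; apply: ler_sum => i /andP[_ lei].
  by rewrite cmodM /u /v -[in r ^+ k](@subnKC i k)// exprD mulrACA.
have [T [TB hT cvT]] := bounded_series cv0 hW.
pose Sa := series (fun k => a k * z ^+ k); pose Sb := series (fun k => b k * z ^+ k).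
have cvP : (fun n => Sa n * Sb n) @ \oo --> f z * g z.
  by apply: cvgM; [exact: hf|exact: hg].
have -> : series (fun k => conv a b k * z ^+ k) = (fun n => Sa n * Sb n -
    (Sa n * Sb n - series (fun k => conv a b k * z ^+ k) n)).
  by apply/funext => n; rewrite subKr.
rewrite -[X in _ --> X]subr0; apply: (cvgB cvP).
apply: squeezeC cvT; apply: nearW => n; rewrite subr0 /Sa /Sb /series /=.
under [X in _ - X]eq_bigr do rewrite conv_termE.
apply: le_trans (prod_sub_conv_le _ _ _) _.
rewrite conv_sum mulr_suml -sumrB.
apply: (@le_trans _ _ (\sum_(0 <= i < n) u i * \sum_(n - i <= j < n) v j)).
  apply: ler_sum => i _; rewrite -mulrBr sum_tail ?leq_subr//.
  apply: ler_pM; [exact: cmod_ge0|by apply: sumr_ge0 => *; exact: cmod_ge0|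
    exact: cmod_term_le|].
  by apply: ler_sum => j _; exact: cmod_term_le.
have -> : \sum_(0 <= i < n) u i * \sum_(n - i <= j < n) v j =
    \sum_(0 <= i < n) (u i * \sum_(0 <= j < n) v j) -
    \sum_(0 <= i < n) u i * \sum_(0 <= j < n - i) v j.
  rewrite -sumrB; apply: eq_bigr => i _.
  by rewrite -mulrBr (sum_tail v (leq_subr _ _)).
rewrite -conv_sum lerD2r; apply: le_trans (hT (n + n)%N).
rewrite conv_sum [leRHS](@big_cat_nat _ _ _ n)//= ?leq_addr//.
apply: (@le_trans _ _ (\sum_(0 <= i < n) u i * \sum_(0 <= j < n + n - i) v j)).
  rewrite big_nat [leRHS]big_nat; apply: ler_sum => i /andP[_ lti].
  rewrite ler_wpM2l// [leRHS](@big_cat_nat _ _ _ n)//=; last by lia.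
  by rewrite lerDl sumr_ge0.
by rewrite lerDl sumr_ge0// => i _; rewrite mulr_ge0// sumr_ge0.
Qed.

Lemma term_le_wbound r a B k : 0 <= r -> wbound r a B -> cmod (a k) * r ^+ k <= B.
Proof.
move=> r0 /(_ k.+1); apply: le_trans; rewrite big_nat_recr //= lerDr sumr_ge0//.
by move=> i _; rewrite mulr_ge0 ?cmod_ge0 ?exprn_ge0.
Qed.

(** Weierstrass M-test for power series: a series of power series whose
    weighted norms are summable may be summed coefficientwise. *)
Lemma expands_sum r (f : nat -> C -> C) (a : nat -> nat -> C) (b : nat -> R) E :
  0 < r -> (forall i, expands r (f i) (a i) (b i)) ->
  (forall n, \sum_(0 <= i < n) b i <= E) ->
  exists F A, expands r F A E /\
    forall z, cmod z <= r -> series (fun i => f i z) @ \oo --> F z.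
Proof.
move=> r0 hf hb.
have b0 i : 0 <= b i by have [/(_ 0%N)] := hf i; rewrite big_nil.
have [T [TE hT cvT]] := bounded_series b0 hb.
pose e n := T - \sum_(0 <= k < n) b k.
have coefS k n m : (n <= m)%N -> cmod (\sum_(n <= i < m) a i k) * r ^+ k <= e n.
  move=> nm; apply: (@le_trans _ _ (\sum_(n <= i < m) b i)); last first.
    by rewrite -(sum_tail b nm) lerD2r.
  rewrite (le_trans (ler_wpM2r _ (cmod_sum _ _ _))) ?exprn_ge0 ?(ltW r0)//.
  rewrite mulr_suml; apply: ler_sum => i _.
  by apply: term_le_wbound; [exact: ltW|case: (hf i)].
have [A hA] : exists A : nat -> C, forall k, series (fun i => a i k) @ \oo --> A k.
  suff h k : exists l : C, series (fun i => a i k) @ \oo --> l.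
    by exists (fun k => projT1 (cid (h k))) => k; case: cid.
  have rk0 : 0 < r ^+ k by rewrite exprn_gt0.
  have [||l [hl _]] := @cauchyC_cvg _ (series (fun i => a i k)) (fun n => e n / r ^+ k).
  - by move=> n m nm; rewrite /series /= sum_tail// ler_pdivlMr// coefS.
  - by rewrite -(mul0r (r ^+ k)^-1); apply: cvgM cvT _; exact: cvg_cst.
  by exists l.
have [F hF] : exists F : C -> C, forall z, cmod z <= r ->
    series (fun i => f i z) @ \oo --> F z.
  exists (fun z => lim (series (fun i => f i z) @ \oo)) => z zr.
  have [l hl] := abs_cvg (fun i => expands_bound (hf i) zr) hb.
  by rewrite (limC hl).
have diffW n N : \sum_(0 <= k < n) cmod (A k - \sum_(0 <= i < N) a i k) * r ^+ k <= e N.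
  pose G M := \sum_(0 <= k < n) cmod (\sum_(0 <= i < M) a i k - \sum_(0 <= i < N) a i k) * r ^+ k.
  have cvG : G @ \oo --> \sum_(0 <= k < n) cmod (A k - \sum_(0 <= i < N) a i k) * r ^+ k.
    rewrite /G; elim: (n) => [|m IH].
      by under eq_fun do rewrite big_nil; rewrite big_nil; exact: cvg_cst.
    under eq_fun do rewrite big_nat_recr //=; rewrite big_nat_recr //=.
    apply: cvgD => //; apply: cvgM; last exact: cvg_cst.
    by apply: cvgC_cmod; exact: (cvgB (hA m) (cvg_cst _)).
  rewrite -(cvg_lim (@Rhausdorff R) cvG); apply: limr_le.
    by apply/cvg_ex; eexists; exact: cvG.
  exists N => // M /= NM; rewrite /G.
  under eq_bigr do rewrite sum_tail//.
  apply: (@le_trans _ _ (\sum_(N <= i < M) b i)); last first.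
    by rewrite -(sum_tail b NM) lerD2r.
  apply: (@le_trans _ _ (\sum_(0 <= k < n) \sum_(N <= i < M) cmod (a i k) * r ^+ k)).
    apply: ler_sum => k _; rewrite -mulr_suml ler_wpM2r ?exprn_ge0 ?(ltW r0)//.
    exact: cmod_sum.
  rewrite exchange_big /=; apply: ler_sum => i _.
  by case: (hf i) => + _; exact.
exists F, A; split; last exact: hF.
split=> [n|z zr].
  have := diffW n 0%N; under eq_bigr do rewrite big_nil subr0.
  by move=> /le_trans; apply; rewrite /e big_nil subr0.
have cvN N : series (fun k => (\sum_(0 <= i < N) a i k) * z ^+ k) @ \oo -->
    \sum_(0 <= i < N) f i z.
  elim: N => [|N IH].
    rewrite big_nil; apply: squeezeC (cvg_cst _); apply: nearW => n.
    rewrite /series /= subr0 big1 ?cmod0// => k _.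
    by rewrite big_nil mul0r.
  rewrite big_nat_recr; last exact: leq0n.
  have -> : series (fun k => (\sum_(0 <= i < N.+1) a i k) * z ^+ k) =
     (fun n => series (fun k => (\sum_(0 <= i < N) a i k) * z ^+ k) n +
       series (fun k => a N k * z ^+ k) n).
    apply/funext => n; rewrite /series /= -big_split /=; apply: eq_bigr => k _.
    by rewrite big_nat_recr //= mulrDl.
  exact: (cvgD IH ((hf N).2 z zr)).
have FN N : cmod (F z - \sum_(0 <= i < N) f i z) <= e N.
  apply: (@cvgC_le _ (fun M => series (fun i => f i z) M - \sum_(0 <= i < N) f i z)).
    exact: (cvgB (hF z zr) (cvg_cst _)).
  exists N => // M /= NM; rewrite /series /= sum_tail//.
  rewrite (le_trans (cmod_sum _ _ _))//.
  apply: (@le_trans _ _ (\sum_(N <= i < M) b i)); last first.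
    by rewrite -(sum_tail b NM) lerD2r.
  by apply: ler_sum => i _; exact: (expands_bound (hf i) zr).
apply/cvgCP => d d0.
have d30 : 0 < d / 3%:R by rewrite divr_gt0.
have [N /(_ N (leqnn N)) hN] : exists N, forall n, (N <= n)%N -> e n < d / 3%:R.
  exact: cvg0_lt cvT d30.
apply: filterS (proj1 (cvgCP _ _) (cvN N) _ d30) => n hn.
rewrite /series /= in hn *; set X := \sum_(0 <= k < n) A k * z ^+ k.
have -> : X - F z = (X - \sum_(0 <= k < n) (\sum_(0 <= i < N) a i k) * z ^+ k) +
   (\sum_(0 <= k < n) (\sum_(0 <= i < N) a i k) * z ^+ k - \sum_(0 <= i < N) f i z) -
   (F z - \sum_(0 <= i < N) f i z) by ring.
apply: le_lt_trans (cmodB _ _) _.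
apply: le_lt_trans (_ : e N + d / 3%:R + e N < d); last by lra.
apply: lerD; last exact: FN.
apply: le_trans (cmodD _ _) _; apply: lerD; last exact: ltW hn.
rewrite /X -sumrB; apply: le_trans (diffW n N).
under eq_bigr do rewrite -mulrBl.
rewrite (le_trans (cmod_sum _ _ _))//; apply: ler_sum => k _.
exact: cmod_term_le.
Qed.

Lemma expands_exp r f a B n : 0 <= r -> expands r f a B ->
  exists b, expands r (fun z => f z ^+ n) b (B ^+ n).
Proof.
move=> r0 hf; elim: n => [|n [b hb]].
  exists (fun k => if k is 0 then 1 else 0).
  have := expands_cst r 1; rewrite cmod1; apply: expands_ext => z _.
  by rewrite expr0.
exists (conv a b); rewrite exprS.
by apply: expands_ext (expands_mul r0 hf hb) => z _; rewrite exprS.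
Qed.

(** Composition of power series. The constant term of the outer series is
    split off, so that E measures the distance to the constant [c 0]. *)
Lemma expands_comp r f a B c E : 0 < r -> expands r f a B ->
  (forall n, \sum_(0 <= k < n) cmod (c k.+1) * B ^+ k.+1 <= E) ->
  exists b, expands r (fun z => psval c (f z) - c 0%N) b E.
Proof.
move=> r0 hf hc.
have [b hb] : exists b, forall i, expands r (fun z => c i.+1 * f z ^+ i.+1)
    (b i) (cmod (c i.+1) * B ^+ i.+1).
  suff h i : exists b, expands r (fun z => c i.+1 * f z ^+ i.+1) b
      (cmod (c i.+1) * B ^+ i.+1).
    by exists (fun k => projT1 (cid (h k))) => k; case: cid.
  have [b hb] := expands_exp i.+1 (ltW r0) hf.
  by exists (fun k => c i.+1 * b k); exact: expands_scale.
have [F [A [hA hF]]] := expands_sum r0 hb hc.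
exists A; apply: expands_ext hA => z zr.
apply: (@canRL _ _ (fun x => x + c 0%N) (fun x => x - c 0%N)); first by move=> x; rewrite addrK.
symmetry; apply: limC.
rewrite -(cvg_shiftS _).
have -> : [sequence series (fun k => c k * f z ^+ k) n.+1]_n =
    (fun n => series (fun i => c i.+1 * f z ^+ i.+1) n + c 0%N).
  apply/funext => n; rewrite /series /= big_nat_recl //= expr0 mulr1 addrC.
  by [].
exact: (cvgD (hF z zr) (cvg_cst _)).
Qed.

Lemma expands_shift r f a B : 0 < r -> expands r f a B -> a 0%N = 0 ->
  expands r (psval (fun k => a k.+1)) (fun k => a k.+1) (B / r) /\
  forall z, cmod z <= r -> f z = z * psval (fun k => a k.+1) z.
Proof.
move=> r0 [ha hf] a0.
have hs : wbound r (fun k => a k.+1) (B / r).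
  move=> n; rewrite ler_pdivlMr// mulr_suml; apply: le_trans (ha n.+1).
  rewrite big_nat_recl //= a0 cmod0 mul0r add0r.
  by apply: ler_sum => k _; rewrite exprSr mulrA.
have he := expands_psval hs; split=> [|z zr]; first exact: he.
apply: (cvgC_unique (hf z zr)).
rewrite -(cvg_shiftS _).
have -> : [sequence series (fun k => a k * z ^+ k) n.+1]_n =
    (fun n => z * series (fun k => a k.+1 * z ^+ k) n).
  apply/funext => n; rewrite /series /= big_nat_recl //= a0 mul0r add0r mulr_sumr.
  by apply: eq_bigr => k _; rewrite exprS mulrCA.
exact: (cvgM (cvg_cst _) (he.2 z zr)).
Qed.

(** By the binomial theorem the left-hand side only contains the terms of degree
    at least 2 in h, and |h|^j <= (|h| / d)^2 d^j for j >= 2. *)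
Lemma expr_taylor1 (z h : C) (d : R) k : 0 < d -> cmod h <= d ->
  cmod ((z + h) ^+ k - z ^+ k - h * (k%:R * z ^+ k.-1)) <=
  (cmod h / d) ^+ 2 * ((cmod z + d) ^+ k - cmod z ^+ k - d * (k%:R * cmod z ^+ k.-1)).
Proof.
move=> d0 hd; elim: k => [|k IH].
  by rewrite !expr0 !mul0r !mulr0 !subr0 !subrr cmod0 mulr0.
have E (A : comPzRingType) (x y : A) : (x + y) ^+ k.+1 - x ^+ k.+1 - y * (k.+1%:R * x ^+ k) =
    (x + y) * ((x + y) ^+ k - x ^+ k - y * (k%:R * x ^+ k.-1)) + y ^+ 2 * (k%:R * x ^+ k.-1).
  case: k {IH} => [|k]; first by rewrite !expr1 expr0 /=; ring.
  by rewrite /= !exprS -[k.+2%:R]natr1; ring.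
rewrite !E (le_trans (cmodD _ _))// [leRHS]mulrDr; apply: lerD.
  rewrite cmodM [leRHS]mulrCA; apply: ler_pM; rewrite ?cmod_ge0//.
  by rewrite (le_trans (cmodD _ _))// lerD2l.
rewrite cmodM cmodX (cmodM k%:R) cmodX cmod_nat.
suff -> : (cmod h / d) ^+ 2 * (d ^+ 2 * (k%:R * cmod z ^+ k.-1)) =
  cmod h ^+ 2 * (k%:R * cmod z ^+ k.-1) by [].
by field; exact: lt0r_neq0.
Qed.

(** Termwise differentiation, by the second-order estimate above, which is
    majorized by the series itself on the larger radius. *)
Lemma expands_derivable r f a B z : expands r f a B -> cmod z < r ->
  derivable f z 1.
Proof.
move=> [ha hf] zr; have r0 : 0 < r by exact: le_lt_trans (cmod_ge0 z) zr.
pose d := r - cmod z; have d0 : 0 < d by rewrite subr_gt0.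
have zd : cmod z + d = r by rewrite /d addrCA subrr addr0.
clearbody d.
(* With d = r - |z|, each term of the differentiated series is at most 1/d times
   the corresponding term of the series at radius r. *)
have hk k : d * (k%:R * cmod z ^+ k.-1) <= r ^+ k.
  rewrite -zd; elim: k => [|k IH]; first by rewrite mul0r mulr0.
  rewrite [leRHS]exprS mulrDl.
  apply: (@le_trans _ _ (cmod z * (d * (k%:R * cmod z ^+ k.-1)) + d * cmod z ^+ k)).
    case: k {IH} => [|k] /=; first by rewrite !mul0r !mulr0 add0r mul1r.
    by rewrite -natr1 exprS le_eqVlt; apply/orP; left; apply/eqP; ring.
  apply: lerD; apply: ler_wpM2l => //; [exact: cmod_ge0|exact: ltW|].
  by rewrite lerXn2r ?nnegrE ?cmod_ge0 ?lerDl ?(ltW d0)// addr_ge0 ?cmod_ge0 ?(ltW d0).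
have [D hD] : exists D : C, series (fun k => a k * (k%:R * z ^+ k.-1)) @ \oo --> D.
  apply: (@abs_cvg _ _ (fun k => cmod (a k) * r ^+ k / d) (B / d)) => [k|n].
    rewrite cmodM -mulrA ler_wpM2l ?cmod_ge0// ler_pdivlMr// mulrC.
    by rewrite cmodM cmodX cmod_nat.
  by rewrite -mulr_suml ler_wpM2r ?invr_ge0 ?(ltW d0).
apply: (@derivable_quadratic _ f z D (B / d ^+ 2) d d0) => h hd.
have zh : cmod (z + h) <= r.
  by rewrite -zd (le_trans (cmodD _ _))// lerD2l ltW.
have cv : (fun n => series (fun k => a k * (z + h) ^+ k) n -
    series (fun k => a k * z ^+ k) n - h * series (fun k => a k * (k%:R * z ^+ k.-1)) n)
    @ \oo --> f (z + h) - f z - h * D.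
  apply: cvgB; first by apply: cvgB; [exact: hf|apply: hf; exact: ltW].
  by apply: cvgM; [exact: cvg_cst|exact: hD].
apply: (cvgC_le cv); apply: nearW => n; rewrite /series /=.
rewrite mulr_sumr -!sumrB (le_trans (cmod_sum _ _ _))//.
apply: (@le_trans _ _ ((cmod h / d) ^+ 2 * \sum_(0 <= k < n) cmod (a k) * r ^+ k)); last first.
  have -> : B / d ^+ 2 * cmod h ^+ 2 = (cmod h / d) ^+ 2 * B.
    by field; exact: lt0r_neq0.
  by rewrite ler_wpM2l ?sqr_ge0.
rewrite mulr_sumr; apply: ler_sum => k _.
rewrite [h * _]mulrCA -!mulrBr cmodM [leRHS]mulrCA ler_wpM2l ?cmod_ge0//.
rewrite (le_trans (expr_taylor1 _ _ d0 (ltW hd)))// ler_wpM2l ?sqr_ge0//.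
rewrite zd -addrA gerDl -opprD oppr_le0 addr_ge0 ?exprn_ge0 ?cmod_ge0//.
by rewrite mulr_ge0 ?(ltW d0)// mulr_ge0 ?exprn_ge0 ?cmod_ge0.
Qed.

End PowerSeries.
(* Unification is slow when it unfolds these functions. *)
#[global] Opaque psval.

(** * The complex exponential *)

Section Exponential.
Variable R : realType.
Local Notation C := (Cplx R).

Lemma cexpD (a b : C) : cexp (a + b) = cexp a * cexp b.
Proof.
case: a => a1 a2; case: b => b1 b2; rewrite /cexp /= expRD cosD sinD.
by simpc; apply/eqP; rewrite eq_complex /=; apply/andP; split; apply/eqP; ring.
Qed.

Lemma cexp_real (r : R) : cexp (r%:C : C) = (expR r)%:C.
Proof. by rewrite /cexp /= cos0 sin0; simpc. Qed.

Lemma cexp0 : cexp 0 = 1 :> C.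
Proof. by rewrite -[0]/((0 : R)%:C) cexp_real expR0. Qed.

Lemma cexp_imag (b : R) : cexp ('i * b%:C : C) = cos b +i* sin b.
Proof. by rewrite /cexp; simpc; rewrite /= expR0; simpc. Qed.

Lemma cexpN_mul (a : C) : cexp (- a) * cexp a = 1.
Proof. by rewrite -cexpD addNr cexp0. Qed.

Lemma cexp_neq0 (a : C) : cexp a != 0.
Proof.
apply/eqP => h; have := cexpN_mul a; rewrite h mulr0 => /eqP.
by rewrite eq_sym oner_eq0.
Qed.

Lemma cexpN (a : C) : cexp (- a) = (cexp a)^-1.
Proof. by apply: (mulIf (cexp_neq0 a)); rewrite cexpN_mul mulVf ?cexp_neq0. Qed.

Lemma cexpB (a b : C) : cexp (a - b) = cexp a / cexp b.
Proof. by rewrite cexpD cexpN. Qed.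

Lemma cexpMn (a : C) n : cexp (a *+ n) = cexp a ^+ n.
Proof. by elim: n => [|n IH]; rewrite ?cexp0// mulrS cexpD IH exprS. Qed.

Lemma cexpMz (a : C) (n : int) : cexp (a *~ n) = cexp a ^ n.
Proof.
case: n => n; first exact: cexpMn.
by rewrite NegzE mulrNz cexpN -pmulrn cexpMn exprnN.
Qed.

Lemma cmod_cexp (a : C) : cmod (cexp a) = expR (complex.Re a).
Proof.
rewrite /cexp cmodM cmod_real gtr0_norm ?expR_gt0// /cmod /= cos2Dsin2 sqrtr1.
by rewrite mulr1.
Qed.

Definition expc (c : C) (k : nat) : C := c ^+ k / k`!%:R.

Lemma expc_bound (x : R) n : 0 <= x -> \sum_(0 <= k < n) x ^+ k / k`!%:R <= expR x.
Proof.
move=> x0; apply: (@nondecreasing_cvgn_le _ (series (exp_coeff x))); last first.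
  exact: is_cvg_series_exp_coeff.
apply/nondecreasing_seqP => k; rewrite /series /= big_nat_recr //=.
by rewrite lerDl mulr_ge0 ?exprn_ge0 ?invr_ge0.
Qed.

Lemma expc_wbound (c : C) r : 0 <= r -> wbound r (expc c) (expR (cmod c * r)).
Proof.
move=> r0 n; apply: le_trans (expc_bound n _); last by rewrite mulr_ge0 ?cmod_ge0.
apply: ler_sum => k _; rewrite /expc cmodM cmodV cmodX cmod_nat exprMn.
by rewrite mulrAC.
Qed.

Lemma expc_conv (a b : C) k : conv (expc a) (expc b) k = expc (a + b) k.
Proof.
rewrite /conv /expc addrC exprDn mulr_suml big_mkord; apply: eq_bigr => i _.
have hi : (i <= k)%N by rewrite -ltnS.
have fk : (k`!%:R : C) = 'C(k, i)%:R * (i`!%:R * (k - i)`!%:R).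
  by rewrite -!natrM bin_fact.
have n0 m : (0 < m)%N -> (m%:R : C) != 0 by rewrite pnatr_eq0 lt0n.
rewrite fk -[_ *+ 'C(k, i)]mulr_natr; field.
by rewrite !n0 ?fact_gt0 ?bin_gt0.
Qed.

Lemma expc_real (a : R) : series (expc (a%:C : C)) @ \oo --> cexp (a%:C : C).
Proof.
have -> : series (expc (a%:C : C)) = (fun n => (series (exp_coeff a) n)%:C).
  apply/funext => n; rewrite /series /= rmorph_sum /=; apply: eq_bigr => k _.
  by rewrite /expc rmorphM rmorphXn /= fmorphV rmorph_nat.
by rewrite cexp_real; apply: cvgC_real; exact: is_cvg_series_exp_coeff.
Qed.

Lemma expc_imag (b : R) :
  series (expc ('i * b%:C : C)) @ \oo --> cexp ('i * b%:C : C).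
Proof.
have ii : ('i : C) * 'i = -1 by rewrite -expr2 sqr_i.
have i2 m : ('i : C) ^+ m.*2 = (-1) ^+ m.
  by rewrite -mul2n exprM sqr_i.
have e k : expc ('i * b%:C : C) k = (cos_coeff b k)%:C + 'i * (sin_coeff b k)%:C.
  rewrite /expc exprMn /cos_coeff /sin_coeff /=.
  rewrite !rmorphM !rmorphXn /= !fmorphV !rmorph_nat rmorphN1.
  rewrite -{1}[k]odd_double_half exprD i2.
  case ok: (odd k) => /=.
    have -> : (k.-1)./2 = k./2 by rewrite -{1}[k]odd_double_half ok /= doubleK.
    by rewrite !mul0r add0r mul1r expr1 !mulrA.
  by rewrite !mul0r mulr0 addr0 ?expr0 !mul1r.
have -> : series (expc ('i * b%:C : C)) =
  (fun n => (series (cos_coeff b) n)%:C + 'i * (series (sin_coeff b) n)%:C).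
  apply/funext => n; rewrite /series /= !rmorph_sum /= mulr_sumr -big_split /=.
  by apply: eq_bigr => k _; rewrite e.
have -> : cexp ('i * b%:C : C) = (cos b)%:C + 'i * (sin b)%:C.
  by rewrite cexp_imag; simpc.
apply: cvgD; first by apply: cvgC_real; rewrite cos.unlock; exact: is_cvg_series_cos_coeff.
apply: cvgM; first exact: cvg_cst.
by apply: cvgC_real; rewrite sin.unlock; exact: is_cvg_series_sin_coeff.
Qed.

(** The function cexp is built from exp, cos and sin of real numbers. The
    series is multiplicative in z, so the real and the imaginary axis suffice. *)
Lemma cexp_series (z : C) : series (expc z) @ \oo --> cexp z.
Proof.
have zE : z = (complex.Re z)%:C + 'i * (complex.Im z)%:C by exact: complexE.
have sE (c : C) : series (fun k => expc c k * 1 ^+ k) = series (expc c).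
  by congr (series _); apply/funext => k; rewrite expr1n mulr1.
have e c := expands_psval (@expc_wbound c 1 ler01).
have v (c : C) : series (expc c) @ \oo --> cexp c -> psval (expc c) 1 = cexp c.
  by move=> h; apply: limC; rewrite sE.
have h1 : cmod (1 : C) <= 1 by rewrite cmod1.
move: (v _ (@expc_real (complex.Re z))) (v _ (@expc_imag (complex.Im z))) zE.
move: (_%:C) ('i * _) => a b va vb ->.
have h : series (fun k => conv (expc a) (expc b) k * 1 ^+ k) @ \oo -->
    psval (expc a) 1 * psval (expc b) 1.
  exact: (expands_mul ler01 (e a) (e b)).2 1 h1.
move: h; rewrite va vb -cexpD (funext (expc_conv a b)) sE.
exact: id.
Qed.

Lemma expands_cexp (c : C) (r : R) : 0 <= r ->
  expands r (fun t => cexp (c * t)) (expc c) (expR (cmod c * r)).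
Proof.
move=> r0; split=> [|z zr]; first exact: expc_wbound.
have -> : (fun k => expc c k * z ^+ k) = expc (c * z).
  by apply/funext => k; rewrite /expc exprMn mulrAC.
exact: cexp_series.
Qed.

Lemma derivable_cexp (c z : C) : derivable (fun t : C => cexp (c * t)) z 1.
Proof.
have r0 : 0 <= cmod z + 1 by rewrite addr_ge0 ?cmod_ge0.
by apply: (expands_derivable (expands_cexp c r0)); rewrite ltrDl.
Qed.

(** The function (e^(c t) - 1) / t without its removable singularity. *)
Lemma cexp_sub1 (c : C) : exists h : C -> C,
  [/\ forall t, cexp (c * t) - 1 = t * h t, h 0 = c & forall z, derivable h z 1].
Proof.
pose a k := expc c k - (if k is 0 then 1 else 0).
have ea r : 0 <= r -> exists B, expands r (fun t => cexp (c * t) - 1) a B.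
  move=> r0; eexists.
  have := expands_add r0 (expands_cexp c r0) (expands_scale (-1) (expands_cst r 1)).
  have -> : (fun k => expc c k + -1 * (if k is 0 then 1 else 0)) = a.
    by apply/funext => k; rewrite mulN1r.
  by apply: expands_ext => z _; rewrite mulr1.
have a0 : a 0%N = 0 by rewrite /a /expc expr0 fact0 divr1 subrr.
exists (psval (fun k => a k.+1)).
have key z : exists r B : R, (0 < r /\ cmod z < r) /\
  (expands r (psval (fun k => a k.+1)) (fun k => a k.+1) B /\
  forall t, cmod t <= r -> cexp (c * t) - 1 = t * psval (fun k => a k.+1) t).
  have r0 : 0 < cmod z + 1 by rewrite ltr_wpDl ?cmod_ge0.
  have [B hB] := ea _ (ltW r0); exists (cmod z + 1), (B / (cmod z + 1)).
  by split; [rewrite ltrDl|exact: expands_shift].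
split=> [t||z].
- by have [r [B [[_ /ltW tr] [_ h]]]] := key t; exact: h.
- have [r [B [[r0 _] [[_ h] _]]]] := key 0.
  have h0 : series (fun k => a k.+1 * 0 ^+ k) @ \oo --> psval (fun k => a k.+1) 0.
    by apply: h; rewrite cmod0 ltW.
  apply: cvgC_unique h0 _; apply: squeezeC (cvg_cst _).
  exists 1%N => // -[|n] //= _; rewrite /series /= big_nat_recl //= big1 => [|i _].
    by rewrite expr0 mulr1 addr0 /a /expc expr1 divr1 subr0 subrr cmod0.
  by rewrite expr0n /= mulr0.
- by have [r [B [[_ zr] [h _]]]] := key z; exact: expands_derivable h zr.
Qed.

End Exponential.
#[global] Opaque cexp.

Section ExpKernel.
Variable R : realType.
Local Notation C := (Cplx R).

Definition twopii : C := 'i * ((pi : R) *+ 2)%:C.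

Lemma cexp_twopii : cexp twopii = 1.
Proof. by rewrite /twopii cexp_imag cos2pi sin2pi. Qed.

Lemma twopii_neq0 : twopii != 0.
Proof.
rewrite mulf_neq0 //; first by apply/eqP => -[] /eqP; rewrite oner_eq0.
by apply/eqP => -[] /eqP; rewrite mulrn_eq0 /= gt_eqF ?pi_gt0.
Qed.

Lemma cexp_kernelE (k : int) : cexp (twopii *~ k) = 1.
Proof. by rewrite cexpMz cexp_twopii exp1rz. Qed.

Lemma cexp_kernel (z : C) : cexp z = 1 -> exists k : int, z = twopii *~ k.
Proof.
move=> hz.
(* The modulus gives a purely imaginary z; the cosine is injective on [0, pi]. *)
have Re0 : complex.Re z = 0.
  by apply: expR_inj; rewrite expR0 -cmod_cexp hz cmod1.
pose p2 : R := pi *+ 2; have p20 : 0 < p2 by rewrite mulrn_wgt0 ?pi_gt0.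
pose k := Num.floor (complex.Im z / p2).
pose b := complex.Im z - p2 * k%:~R.
exists k.
have hzb : z - twopii *~ k = 'i * b%:C.
  rewrite {1}(complexE z) Re0 add0r /twopii -mulrzr -mulrA -mulrBr /b.
  by rewrite rmorphB rmorphM /= rmorph_int.
have cb : cos b = 1.
  have := cexp_imag b; rewrite -hzb cexpB hz cexp_kernelE divr1.
  by move=> [].
have b0 : 0 <= b.
  by rewrite /b subr_ge0 mulrC -ler_pdivlMr// Num.Theory.floor_le.
have b2 : b < p2.
  rewrite /b ltrBlDr -[X in X + _]mulr1 -mulrDr mulrC -ltr_pdivrMr//.
  by rewrite addrC -[1]/(1%:~R) -intrD Num.Theory.floorD1_gt.
suff b00 : b = 0 by apply/eqP; rewrite -subr_eq0 hzb b00 mulr0.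
have in0 : 0 \in `[0 : R, pi] by rewrite in_itv /= lexx pi_ge0.
have [bp|pb] := leP b pi.
  by apply: cos_inj; rewrite ?in_itv /= ?b0 ?bp ?lexx ?pi_ge0 ?cos0.
suff : p2 - b = 0 by move=> /eqP; rewrite subr_eq0 => /eqP e; move: b2; rewrite e ltxx.
apply: cos_inj; rewrite ?in_itv /= ?lexx ?pi_ge0 //.
  by rewrite subr_ge0 (ltW b2) /= lerBlDr /p2 mulr2n lerD2l ltW.
by rewrite cos0 -cosN opprB -(cosD2pi (b - p2)) subrK.
Qed.

End ExpKernel.

(** * Euler's product and the theta function *)

Section EulerProduct.
Variable R : realType.
Local Notation C := (Cplx R).
Variable q : C.
Hypothesis q0 : q != 0.
Hypothesis q1 : cmod q < 1.

(** Euler's expansion of the product of all 1 - q^m u with m >= 1: these are the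
    coefficients for which E(u) = (1 - q u) E(q u) and E(0) = 1. *)
Fixpoint ecoef (n : nat) : C :=
  if n is m.+1 then ecoef m * (- q ^+ m.+1 / (1 - q ^+ m.+1)) else 1.

(** Defined by its power series, E is visibly entire; the product expansion, and
    with it the zeros, follow from the functional equation. *)
Definition eulerE (u : C) : C := psval ecoef u.

Lemma eulerEE u : eulerE u = psval ecoef u. Proof. by []. Qed.

Lemma cmod_qX_lt1 m : cmod (q ^+ m.+1) < 1.
Proof. by rewrite cmodX exprn_ilt1 ?cmod_ge0. Qed.

Lemma cmod_1BqX m : 1 - cmod q <= cmod (1 - q ^+ m.+1).
Proof.
apply: le_trans (cmod_lerB _ _); rewrite cmod1 lerD2l lerN2 cmodX exprS.
by rewrite ler_piMr ?cmod_ge0// exprn_ile1 ?cmod_ge0 ?(ltW q1).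
Qed.

Lemma one_sub_qX_neq0 m : 1 - q ^+ m.+1 != 0.
Proof. by rewrite -cmod_gt0 (lt_le_trans _ (cmod_1BqX m))// subr_gt0. Qed.

Lemma ecoef_step m :
  cmod (ecoef m.+1) <= cmod q ^+ m.+1 / (1 - cmod q) * cmod (ecoef m).
Proof.
rewrite /= cmodM mulrC ler_wpM2r ?cmod_ge0// cmodM cmodN cmodV cmodX.
rewrite ler_wpM2l ?exprn_ge0 ?cmod_ge0// lef_pV2 ?posrE ?cmod_1BqX//.
  by rewrite (lt_le_trans _ (cmod_1BqX m))// subr_gt0.
by rewrite subr_gt0.
Qed.

Lemma ecoef_wbound r : 0 <= r -> exists B, wbound r ecoef B.
Proof.
move=> r0; have d0 : 0 < 1 - cmod q by rewrite subr_gt0.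
have cv : (fun n => r / (1 - cmod q) * cmod q ^+ n) @ \oo --> (0 : R).
  rewrite -(mulr0 (r / (1 - cmod q))); apply: cvgM; first exact: cvg_cst.
  by apply: cvg_expr; rewrite ger0_norm ?cmod_ge0.
have h2 : (0 : R) < 2^-1 by rewrite invr_gt0.
have [N hN] := cvg0_lt cv h2.
apply: (@ratio_bounded _ (fun k => cmod (ecoef k) * r ^+ k) 2^-1 N) => [k|||k Nk].
- by rewrite mulr_ge0 ?cmod_ge0 ?exprn_ge0.
- exact: ltW.
- by lra.
apply: (@le_trans _ _ (r / (1 - cmod q) * cmod q ^+ k.+1 * (cmod (ecoef k) * r ^+ k))).
  apply: le_trans (ler_wpM2r _ (ecoef_step k)) _; first by rewrite exprn_ge0.
  by rewrite [r ^+ k.+1]exprS le_eqVlt; apply/orP; left; apply/eqP; ring.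
rewrite ler_wpM2r ?mulr_ge0 ?cmod_ge0 ?exprn_ge0//.
by apply/ltW/hN; exact: leq_trans Nk _.
Qed.

Lemma eulerE_series u : series (fun k => ecoef k * u ^+ k) @ \oo --> eulerE u.
Proof.
by have [B hB] := ecoef_wbound (cmod_ge0 u); exact: (expands_psval hB).2.
Qed.

Lemma derivable_eulerE u : derivable eulerE u 1.
Proof.
have r0 : 0 <= cmod u + 1 by rewrite addr_ge0 ?cmod_ge0.
have [B hB] := ecoef_wbound r0.
by apply: (expands_derivable (expands_psval hB)); rewrite ltrDl.
Qed.

Lemma eulerE_step u : eulerE u = (1 - q * u) * eulerE (q * u).
Proof.
pose s v := series (fun k => ecoef k * v ^+ k).
have sS v n : s v n.+1 = s v n + ecoef n * v ^+ n.
  by rewrite /s /series /= big_nat_recr.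
have s0 v : s v 0%N = 0 by rewrite /s /series /= big_nil.
have id n : s u n.+1 = s (q * u) n.+1 - q * u * s (q * u) n.
  elim: n => [|n IH]; first by rewrite !sS !s0 mulr0 subr0 !expr0.
  rewrite sS IH (sS _ n.+1) (sS _ n) /=.
  have := one_sub_qX_neq0 n; rewrite !exprMn !exprS => h.
  by field.
clear sS s0.
apply: (cvgC_unique (u := fun n => s u n.+1)).
  by rewrite (cvg_shiftS (s u)); exact: eulerE_series.
rewrite (funext id) mulrBl mul1r; apply: cvgB.
  by rewrite (cvg_shiftS (s (q * u))); exact: eulerE_series.
by apply: cvgM; [exact: cvg_cst|exact: eulerE_series].
Qed.

Lemma eulerE_prod u n :
  eulerE u = (\prod_(0 <= m < n) (1 - q ^+ m.+1 * u)) * eulerE (q ^+ n * u).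
Proof.
elim: n => [|n IH]; first by rewrite big_nil !mul1r.
rewrite big_nat_recr; last exact: leq0n.
rewrite {1}IH (eulerE_step (q ^+ n * u)) [q * _]mulrA -exprS mulrA.
by congr (_ * _ * _).
Qed.

Lemma eulerE0 : eulerE 0 = 1.
Proof.
apply: cvgC_unique (@eulerE_series 0) _; apply: squeezeC (cvg_cst _).
exists 1%N => // -[|n] //= _; rewrite /series /= big_nat_recl //= big1 => [|i _].
  by rewrite expr0 mulr1 addr0 subrr cmod0.
by rewrite expr0n /= mulr0.
Qed.

Lemma eulerE_near1 u : (fun n => eulerE (q ^+ n * u)) @ \oo --> (1 : C).
Proof.
have cont : {for (0 : C), continuous eulerE}.
  by apply: differentiable_continuous; apply/derivable1_diffP; exact: derivable_eulerE.
have h : (fun n => q ^+ n * u) @ \oo --> (0 : C).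
  apply: (@squeezeC _ _ _ (fun n => cmod q ^+ n * cmod u)).
    by apply: nearW => n; rewrite subr0 cmodM cmodX.
  rewrite -(mul0r (cmod u)); apply: cvgM; last exact: cvg_cst.
  by apply: cvg_expr; rewrite ger0_norm ?cmod_ge0.
rewrite -eulerE0; exact: (@cvg_comp _ _ _ _ eulerE _ _ _ h cont).
Qed.

(** As q^n u tends to 0, E(q^n u) is nonzero for large n, so that a zero of E
    is a zero of one of finitely many linear factors. *)
Lemma eulerE_neq0 u : (forall m, q ^+ m.+1 * u != 1) -> eulerE u != 0.
Proof.
move=> hu; have [N _ hN] := (cvgCP _ _).1 (eulerE_near1 u) 1 ltr01.
rewrite (eulerE_prod u N) mulf_neq0//.
  by rewrite prodf_seq_neq0; apply/allP => m _; rewrite /= subr_eq0 eq_sym.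
apply/eqP => e0; have := hN N (leqnn N); rewrite /= e0 sub0r cmodN cmod1.
by rewrite ltxx.
Qed.

Lemma eulerE_cvg u :
  (fun n => \prod_(0 <= m < n) (1 - q ^+ m.+1 * u)) @ \oo --> eulerE u.
Proof.
have cv : (fun n => eulerE u / eulerE (q ^+ n * u)) @ \oo --> eulerE u.
  rewrite -[X in _ --> X]divr1; apply: cvgM; first exact: cvg_cst.
  by apply: cvgV; [exact: oner_neq0|exact: eulerE_near1].
apply: cvg_trans cv; apply: near_eq_cvg.
have [N _ hN] := (cvgCP _ _).1 (eulerE_near1 u) 1 ltr01.
exists N => // n /= Nn; rewrite {1}(eulerE_prod u n) mulfK//.
apply/eqP => e0; have := hN n Nn; rewrite /= e0 sub0r cmodN cmod1.
by rewrite ltxx.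
Qed.

Lemma eulerE1_neq0 : eulerE 1 != 0.
Proof.
apply: eulerE_neq0 => m; rewrite mulr1; apply/eqP => h.
by have := cmod_qX_lt1 m; rewrite h cmod1 ltxx.
Qed.

(** Jacobi's theta function in multiplicative form, by the triple product. *)
Definition theta (u : C) : C := (1 - u) * eulerE u * eulerE u^-1.

Lemma theta_q u : u != 0 -> theta (q * u) = - u^-1 * theta u.
Proof.
move=> u0; rewrite /theta (eulerE_step u) (eulerE_step (q * u)^-1).
have -> : q * (q * u)^-1 = u^-1 by rewrite invfM mulrA divff ?mul1r.
move: (eulerE (q * u)) (eulerE u^-1) => a b; by field.
Qed.

Lemma theta_eq0 u : u != 0 -> theta u = 0 -> exists k : int, u = q ^ k.
Proof.
move=> u0 /eqP; rewrite !mulf_eq0 -orbA => /or3P[].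
- by rewrite subr_eq0 => /eqP <-; exists 0.
- move=> h; have [m hm] : exists m, q ^+ m.+1 * u = 1.
    apply: contrapT => H; move: h; apply/negP/eulerE_neq0 => m.
    by apply/eqP => e; apply: H; exists m.
  exists (- m.+1%:Z); rewrite -exprnN; apply: (mulfI (expf_neq0 m.+1 q0)).
  by rewrite hm divff ?expf_neq0.
- move=> h; have [m hm] : exists m, q ^+ m.+1 * u^-1 = 1.
    apply: contrapT => H; move: h; apply/negP/eulerE_neq0 => m.
    by apply/eqP => e; apply: H; exists m.
  by exists m.+1%:Z; apply: (mulIf (invr_neq0 u0)); rewrite divff// -exprnP hm.
Qed.

End EulerProduct.
#[global] Opaque eulerE.

(** * The theta function of a lattice *)

Section LatticeBasis.
Variable R : realType.
Local Notation C := (Cplx R).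
Variable L : lattice R.

Lemma per1_neq0 : per1 L != 0.
Proof.
apply/eqP => h; have [] := @per_free _ L 1 0.
  by rewrite h mulr0 mul0r addr0.
by move=> /eqP; rewrite oner_eq0.
Qed.

(** The second period, with the sign for which the basis is positively oriented. *)
Definition per_up : C :=
  if 0 < complex.Im (per2 L / per1 L) then per2 L else - per2 L.

Lemma per_up_Im : 0 < complex.Im (per_up / per1 L).
Proof.
rewrite /per_up; case: ifPn => //; rewrite -leNgt mulNr => h.
rewrite [complex.Im _]raddfN oppr_gt0 lt_neqAle h andbT; apply/eqP => h0.
have [] := @per_free _ L (- complex.Re (per2 L / per1 L)) 1; last first.
  by move=> _ /eqP; rewrite oner_eq0.
have -> : ((- complex.Re (per2 L / per1 L))%:C : C) = - (per2 L / per1 L).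
  rewrite [in RHS](complexE (per2 L / per1 L)) h0 mulr0 addr0.
  exact: rmorphN.
by rewrite mul1r mulNr divfK ?per1_neq0// addNr.
Qed.

Lemma lattice_setP (w : C) : lattice_set L w <->
  exists m n : int, w = per1 L *~ m + per_up *~ n.
Proof.
rewrite /lattice_set /lattice_pt /per_up /=; case: ifP => _ //.
split=> -[m [n ->]]; exists m, (- n); first by rewrite mulrNz mulNrz opprK.
by rewrite mulNrz mulrNz.
Qed.

Lemma lattice_set0 : lattice_set L 0.
Proof. by exists 0, 0; rewrite /lattice_pt !mulr0z addr0. Qed.

Lemma lattice_setN (w : C) : lattice_set L w -> lattice_set L (- w).
Proof.
move=> [m [n ->]]; exists (- m), (- n).
by rewrite /lattice_pt !mulrNz opprD.
Qed.

Lemma lattice_setD (w v : C) :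
  lattice_set L w -> lattice_set L v -> lattice_set L (w + v).
Proof.
move=> [m [n ->]] [m' [n' ->]]; exists (m + m'), (n + n').
by rewrite /lattice_pt !mulrzDr addrACA.
Qed.

Lemma lattice_setNE (w : C) : lattice_set L (- w) <-> lattice_set L w.
Proof. by split=> /lattice_setN; rewrite ?opprK. Qed.

(** The properties of the Weierstrass sigma function that are not affected by a
    factor exp(A t^2 + B t): a simple zero at 0 with derivative 1,
    quasi-periodicity, and no zeros off the lattice. *)
Definition sigma_like (S : C -> C) : Prop :=
  [/\ exists h : C -> C,
        [/\ forall t, S t = t * h t, h 0 = 1 & forall z, derivable h z 1],
      forall p, lattice_set L p -> exists A B : C, A != 0 /\
        forall t, S (t + p) = A * cexp (B * t) * S t
    & forall t, S t = 0 -> lattice_set L t].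

Definition cperiod : C := twopii R / per1 L.
Definition nome : C := cexp (cperiod * per_up).

Lemma cmod_nome : cmod nome < 1.
Proof.
rewrite /nome cmod_cexp expR_lt1 /cperiod mulrAC -mulrA /twopii -mulrA.
have := per_up_Im; move: (per_up / per1 L) => [a b] /= b0.
by simpc; rewrite /= oppr_lt0 mulr_gt0// mulrn_wgt0 ?pi_gt0.
Qed.

Lemma nome_neq0 : nome != 0. Proof. exact: cexp_neq0. Qed.

(** The theta function in the additive variable, with derivative 1 at 0. It is the
    sigma function of L up to a factor exp(A t^2 + B t), but its zeros and its
    behaviour under the periods are explicit. *)
Definition thetaS (t : C) : C :=
  theta nome (cexp (cperiod * t)) / (- cperiod * eulerE nome 1 ^+ 2).

Lemma thetaSE t :
  thetaS t = theta nome (cexp (cperiod * t)) / (- cperiod * eulerE nome 1 ^+ 2).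
Proof. by []. Qed.

Lemma cperiod_neq0 : cperiod != 0.
Proof. by rewrite mulf_neq0 ?invr_eq0 ?per1_neq0 ?twopii_neq0. Qed.

Lemma thetaS_per1 t : thetaS (t + per1 L) = thetaS t.
Proof.
have e : cexp (cperiod * (t + per1 L)) = cexp (cperiod * t).
  rewrite mulrDr cexpD {2}/cperiod. rewrite divfK; last exact: per1_neq0. rewrite cexp_twopii. by rewrite mulr1.
by rewrite /thetaS e.
Qed.

Lemma thetaS_per_up t :
  thetaS (t + per_up) = - cexp (- cperiod * t) * thetaS t.
Proof.
have e : cexp (cperiod * (t + per_up)) = nome * cexp (cperiod * t).
  by rewrite mulrDr cexpD mulrC.
rewrite /thetaS e (theta_q nome_neq0 cmod_nome (cexp_neq0 _)) [- cperiod * t]mulNr cexpN.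
exact/esym/mulrA.
Qed.

Lemma thetaS_factor : exists h : C -> C,
  [/\ forall t, thetaS t = t * h t, h 0 = 1 & forall z, derivable h z 1].
Proof.
have [h [hE h0 hd]] := cexp_sub1 cperiod.
have E1 := eulerE1_neq0 cmod_nome.
pose K : C := (cperiod * eulerE nome 1 ^+ 2)^-1.
exists (fun t => K * h t * eulerE nome (cexp (cperiod * t)) *
   eulerE nome (cexp (- cperiod * t))); split=> [t||z].
- rewrite /thetaS /theta -cexpN -[- (cperiod * t)]mulNr -[1 - _]opprB hE /K.
  move: (eulerE nome (cexp _)) (eulerE nome (cexp _)) (eulerE nome 1) E1 => a b e e0.
  move: (h t) cperiod_neq0 => u c0; rewrite !mulNr; field; exact/andP.
- rewrite !mulr0 cexp0 h0 /K; move: (eulerE nome 1) E1 => e e0.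
  by have := cperiod_neq0 => c0; field; exact/andP.
- have dE (u : C) : derivable (fun t : C => eulerE nome (cexp (u * t))) z 1.
    apply/derivable1_diffP; apply: (@differentiable_comp _ _ _ _ (fun t : C => cexp (u * t)) (eulerE nome)).
      by apply/derivable1_diffP; exact: derivable_cexp.
    by apply/derivable1_diffP; apply: derivable_eulerE; exact: cmod_nome.
  apply: derivableM; last exact: dE.
  apply: derivableM; last exact: dE.
  by apply: derivableM; [exact: derivable_cst|exact: hd].
Qed.

Lemma thetaS_sigma_like : sigma_like thetaS.
Proof.
split; first exact: thetaS_factor.
  pose Q p := exists A B : C, A != 0 /\
    forall t, thetaS (t + p) = A * cexp (B * t) * thetaS t.
  have QD p p' : Q p -> Q p' -> Q (p + p').
    move=> [A [B [A0 h]]] [A' [B' [A'0 h']]].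
    exists (A * A' * cexp (B' * p)), (B + B'); split.
      by apply: mulf_neq0; [exact: mulf_neq0|exact: cexp_neq0].
    by move=> t; rewrite addrA h' h !mulrDl mulrDr !cexpD; ring.
  have QN p : Q p -> Q (- p).
    move=> [A [B [A0 h]]]; exists (A^-1 * cexp (B * p)), (- B); split.
      by apply: mulf_neq0; [rewrite invr_eq0|exact: cexp_neq0].
    move=> t; have := h (t - p); rewrite subrK => ->.
    rewrite mulrBr mulNr cexpB cexpN.
    have := cexp_neq0 (B * p); have := cexp_neq0 (B * t).
    move: (cexp _) (cexp _) (thetaS _) => a b c a0 b0.
    by field; apply/and3P.
  have Q0 : Q 0.
    exists 1, 0; split; first exact: oner_neq0.
    by move=> t; rewrite addr0 mul0r cexp0 !mul1r.
  have Qn p n : Q p -> Q (p *+ n).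
    move=> hp; elim: n => [|n IH]; first by rewrite mulr0n; exact: Q0.
    by rewrite mulrS; exact: (QD _ _ hp IH).
  have Qz p (n : int) : Q p -> Q (p *~ n).
    by move=> hp; case: n => n; [exact: (Qn _ _ hp)|rewrite NegzE mulrNz; exact: (QN _ (Qn _ _ hp))].
  move=> p /lattice_setP[m [n ->]]; apply: QD; apply: Qz.
    exists 1, 0; split; first exact: oner_neq0.
    by move=> t; rewrite thetaS_per1 mul0r cexp0 !mul1r.
  exists (-1), (- cperiod); split; first by rewrite oppr_eq0 oner_eq0.
  by move=> t; rewrite thetaS_per_up mulN1r.
have D0 : - cperiod * eulerE nome 1 ^+ 2 != 0.
  apply: mulf_neq0; first by rewrite oppr_eq0 cperiod_neq0.
  by rewrite expf_neq0 ?eulerE1_neq0 ?cmod_nome.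
move=> t; rewrite /thetaS => /eqP; rewrite mulf_eq0 invr_eq0 (negPf D0) orbF => /eqP h.
have [k] := theta_eq0 nome_neq0 cmod_nome (cexp_neq0 _) h.
rewrite /nome -cexpMz => e.
have : cexp (cperiod * (t - per_up *~ k)) = 1.
  by rewrite mulrBr cexpB e mulrzAr divff ?cexp_neq0.
move=> /cexp_kernel[m hm]; apply/lattice_setP; exists m, k.
apply/eqP; rewrite -subr_eq; apply/eqP; apply: (mulfI cperiod_neq0).
by rewrite hm /cperiod mulrzAr divfK ?per1_neq0.
Qed.

End LatticeBasis.
#[global] Opaque thetaS.

(** * Sigma quotients and elliptic functions of level N *)

Section LevelFunctions.
Variable R : realType.
Local Notation C := (Cplx R).
Variable L : lattice R.

Lemma near_neq0 (g : C -> C) p : derivable g p 1 -> g p != 0 ->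
  \forall z \near p, g z != 0.
Proof.
move=> /derivable1_diffP/differentiable_continuous cg g0.
have : \forall y \near g p, y != 0.
  apply/nearC; exists (cmod (g p)); first by rewrite cmod_gt0.
  move=> z hz; apply/eqP => z0; move: hz.
  by rewrite z0 sub0r cmodN ltxx.
exact: cg.
Qed.

Lemma derivable_reflect (g : C -> C) (s : C) : (forall z, derivable g z 1) ->
  forall z, derivable (fun t : C => g (s - t)) z 1.
Proof.
move=> hg z; apply/derivable1_diffP.
apply: (@differentiable_comp _ _ _ _ (fun t : C => s - t) g).
  apply/derivable1_diffP; apply: derivableB; [exact: derivable_cst|exact: derivable_id].
by apply/derivable1_diffP; exact: hg.
Qed.

Lemma derivable_trans (g : C -> C) (s : C) : (forall z, derivable g z 1) ->
  forall z, derivable (fun t : C => g (t - s)) z 1.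
Proof.
move=> hg z; apply/derivable1_diffP.
apply: (@differentiable_comp _ _ _ _ (fun t : C => t - s) g).
  apply/derivable1_diffP; apply: derivableB; [exact: derivable_id|exact: derivable_cst].
by apply/derivable1_diffP; exact: hg.
Qed.

(** Numerator and denominator are entire in all applications, so a closed formula
    for F gives its order at every point. *)
Lemma leading_term_quot (F num den : C -> C) p (m : int) :
  (forall z, derivable num z 1) -> (forall z, derivable den z 1) -> den p != 0 ->
  (forall z, F z = (z - p) ^ m * (num z / den z)) ->
  leading_term F p m (num p / den p).
Proof.
move=> hn hd d0 hF; exists (fun z => num z / den z); split; [|by []|].
  apply: filterS (near_neq0 (hd p) d0) => z z0.
  by apply: derivableM; [exact: hn|apply: derivableV; [exact: z0|exact: hd]].
by apply/nearC; exists 1; [exact: ltr01|move=> z _; exact: hF].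
Qed.

Lemma derivableXf (h : C -> C) z n : derivable h z 1 ->
  derivable (fun x : C => h x ^+ n) z 1.
Proof.
move=> hz; elim: n => [|n IH].
  by under eq_fun do rewrite expr0; exact: derivable_cst.
by under eq_fun do rewrite exprS; exact: derivableM hz IH.
Qed.

Lemma leading_termX (F : C -> C) p (m : int) c n : leading_term F p m c ->
  leading_term (fun z => F z ^+ n) p (m * n%:Z) (c ^+ n).
Proof.
move=> [h [hd hp hF]]; exists (fun z => h z ^+ n); split.
- by apply: filterS hd => z; exact: derivableXf.
- by rewrite hp.
- by apply: filterS hF => z ->; rewrite exprMn -exprz_exp.
Qed.

Variable S : C -> C.
Hypothesis hS : sigma_like L S.

Lemma sigma_derivable z : derivable S z 1.
Proof.
have [[h [hE _ hd]] _ _] := hS; rewrite (_ : S = (fun t => t * h t)); last exact/funext.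
by apply: derivableM; [exact: derivable_id|exact: hd].
Qed.

(** Quasi-periodicity carries the simple zero at 0 to every lattice point. *)
Lemma sigma_zero p : lattice_set L p -> exists h : C -> C,
  [/\ forall t, S t = (t - p) * h t, h p != 0 & forall z, derivable h z 1].
Proof.
have [[h [hE h0 hd]] hq _] := hS => /hq[A [B [A0 hAB]]].
exists (fun t => A * cexp (B * (t - p)) * h (t - p)); split.
- by move=> t; rewrite -[in LHS](subrK p t) hAB hE mulrCA.
- by rewrite subrr mulr0 cexp0 h0 !mulr1.
- apply: (@derivable_trans (fun t => A * cexp (B * t) * h t)) => z.
  apply: derivableM; last exact: hd.
  by apply: derivableM; [exact: derivable_cst|exact: derivable_cexp].
Qed.

Lemma sigma_neq0 t : ~ lattice_set L t -> S t != 0.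
Proof. by have [_ _ hz] := hS; move=> ht; apply/eqP => /hz. Qed.

Variables (s b : C) (N : nat).
Hypothesis sL : ~ lattice_set L s.

(** The general form of a Krichever function, for S = sigma. The constant S s
    normalizes the derivative at 0 to 1. *)
Definition sigma_quot (t : C) : C := cexp (b * t) * S t * S s / S (s - t).

Lemma sigma_quot_order_zero p : lattice_set L p ->
  has_order sigma_quot p 1.
Proof.
move=> pL; have [h [hE hp hd]] := sigma_zero pL.
have sp : S (s - p) != 0.
  apply: sigma_neq0 => /(lattice_setD pL); rewrite addrC subrK; exact: sL.
exists (cexp (b * p) * h p * S s / S (s - p)).
  apply: mulf_neq0; last by rewrite invr_eq0.
  by apply: mulf_neq0; [apply: mulf_neq0; [exact: cexp_neq0|exact: hp]|exact: sigma_neq0].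
apply: (@leading_term_quot _ (fun z => cexp (b * z) * h z * S s)
    (fun z => S (s - z))).
- move=> z; apply: derivableM; last exact: derivable_cst.
  by apply: derivableM; [exact: derivable_cexp|exact: hd].
- by apply: derivable_reflect; exact: sigma_derivable.
- exact: sp.
- by move=> z; rewrite /sigma_quot hE expr1z; ring.
Qed.

Lemma sigma_quot_leading0 : leading_term sigma_quot 0 1 1.
Proof.
have [[h [hE h0 hd]] _ _] := hS; have s0 := sigma_neq0 sL.
have -> : (1 : C) = cexp (b * 0) * h 0 * S s / S (s - 0).
  by rewrite mulr0 cexp0 h0 subr0 !mul1r divff.
apply: (@leading_term_quot _ (fun z => cexp (b * z) * h z * S s)
    (fun z => S (s - z))).
- move=> z; apply: derivableM; last exact: derivable_cst.
  by apply: derivableM; [exact: derivable_cexp|exact: hd].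
- by apply: derivable_reflect; exact: sigma_derivable.
- by rewrite subr0.
- by move=> z; rewrite /sigma_quot hE expr1z subr0; ring.
Qed.

Lemma sigma_quot_order_pole p : lattice_set L (p - s) ->
  has_order sigma_quot p (-1).
Proof.
move=> pL; have spL : lattice_set L (s - p) by rewrite -opprB; exact: lattice_setN.
have [h [hE hp hd]] := sigma_zero spL.
have pn : S p != 0.
  apply: sigma_neq0 => /(lattice_setD spL); rewrite subrK; exact: sL.
exists (cexp (b * p) * S p * - S s / h (s - p)).
  apply: mulf_neq0; last by rewrite invr_eq0.
  apply: mulf_neq0; first by apply: mulf_neq0; [exact: cexp_neq0|exact: pn].
  by rewrite oppr_eq0; exact: sigma_neq0.
apply: (@leading_term_quot _ (fun z => cexp (b * z) * S z * - S s)
    (fun z => h (s - z))).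
- move=> z; apply: derivableM; last exact: derivable_cst.
  by apply: derivableM; [exact: derivable_cexp|exact: sigma_derivable].
- exact: derivable_reflect.
- exact: hp.
- move=> z; rewrite /sigma_quot (hE (s - z)).
  have -> : s - z - (s - p) = - (z - p) by ring.
  rewrite -[(z - p) ^ (-1)]/((z - p)^-1) invfM invrN.
  by move: ((z - p)^-1) (h (s - z))^-1 => u v; ring.
Qed.

Lemma sigma_quot_order_reg p : ~ lattice_set L p -> ~ lattice_set L (p - s) ->
  has_order sigma_quot p 0.
Proof.
move=> pL psL; have sp : S (s - p) != 0.
  by apply: sigma_neq0; rewrite -opprB => /lattice_setNE.
exists (cexp (b * p) * S p * S s / S (s - p)).
  apply: mulf_neq0; last by rewrite invr_eq0.
  by apply: mulf_neq0; [apply: mulf_neq0; [exact: cexp_neq0|exact: sigma_neq0]|exact: sigma_neq0].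
apply: (@leading_term_quot _ (fun z => cexp (b * z) * S z * S s)
    (fun z => S (s - z))).
- move=> z; apply: derivableM; last exact: derivable_cst.
  by apply: derivableM; [exact: derivable_cexp|exact: sigma_derivable].
- by apply: derivable_reflect; exact: sigma_derivable.
- exact: sp.
- by move=> z; rewrite expr0z mul1r.
Qed.

Lemma sigma_quot_meromorphic : meromorphic sigma_quot.
Proof.
move=> p; have [pL|pL] := pselect (lattice_set L p).
  by exists 1; exact: sigma_quot_order_zero.
have [psL|psL] := pselect (lattice_set L (p - s)).
  by exists (-1); exact: sigma_quot_order_pole.
by exists 0; exact: sigma_quot_order_reg.
Qed.

Lemma has_orderX (F : C -> C) p (m : int) n : has_order F p m ->
  has_order (fun z => F z ^+ n) p (m * n%:Z).
Proof.
by move=> [c c0 h]; exists (c ^+ n); [rewrite expf_neq0|exact: leading_termX].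
Qed.

(** The divisor of a sigma quotient is (0) - (s) modulo the lattice, so that its
    N-th power, once it is periodic, is the function g of level N with pole s. *)
Lemma sigma_quot_level : lattice_set L (s *+ N) ->
  (forall w z, lattice_set L w -> sigma_quot (z + w) ^+ N = sigma_quot z ^+ N) ->
  is_elliptic_level_on L N sigma_quot.
Proof.
move=> NsL hper; exists s, (fun z => sigma_quot z ^+ N); split; [exact: sL|exact: NsL| |by []|].
- split.
  + move=> p; have [m hm] := sigma_quot_meromorphic p.
    by exists (m * N%:Z); exact: has_orderX.
  + by move=> w z wL; exact: hper.
  + by have := leading_termX N sigma_quot_leading0; rewrite mul1r expr1n.
  + have -> : - N%:Z = (-1) * N%:Z by rewrite mulN1r.
    apply: has_orderX; apply: sigma_quot_order_pole; rewrite subrr.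
    exact: lattice_set0.
  + move=> z h1 h2; have -> : (0 : int) = 0 * N%:Z by rewrite mul0r.
    by apply: has_orderX; exact: sigma_quot_order_reg.
- by split; [exact: sigma_quot_meromorphic|exact: sigma_quot_leading0].
Qed.

End LevelFunctions.

(** * Consequences of the Hirzebruch equation *)

Section HirzebruchEquation.
Variable R : realType.
Local Notation C := (Cplx R).

Lemma cvgC_sum (I : Type) (s : seq I) (P : pred I) (u : I -> nat -> C) (l : I -> C) :
  (forall i, P i -> u i @ \oo --> l i) ->
  (fun n => \sum_(i <- s | P i) u i n) @ \oo --> \sum_(i <- s | P i) l i.
Proof.
elim: s => [|i s IH] h.
  by under eq_fun do rewrite big_nil; rewrite big_nil; exact: cvg_cst.
rewrite big_cons; under eq_fun do rewrite big_cons.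
case Pi: (P i); last exact: IH.
by apply: cvgD; [exact: h|exact: IH].
Qed.

Lemma cvgC_prod (I : Type) (s : seq I) (P : pred I) (u : I -> nat -> C) (l : I -> C) :
  (forall i, P i -> u i @ \oo --> l i) ->
  (fun n => \prod_(i <- s | P i) u i n) @ \oo --> \prod_(i <- s | P i) l i.
Proof.
elim: s => [|i s IH] h.
  by under eq_fun do rewrite big_nil; rewrite big_nil; exact: cvg_cst.
rewrite big_cons; under eq_fun do rewrite big_cons.
case Pi: (P i); last exact: IH.
by apply: cvgM; [exact: h|exact: IH].
Qed.

(** The behaviour at the origin shared by all functions f(t) = t + o(t). *)
Definition near_id (f : C -> C) : Prop := exists2 r : R, 0 < r &
  forall t, t != 0 -> cmod t < r -> f t != 0 /\ cmod (f t) <= 2 * cmod t.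

Lemma leading_near_id (f : C -> C) : leading_term f 0 1 1 -> near_id f.
Proof.
move=> [h [hd h0 hf]].
have d0 := nbhs_singleton hd.
have ch : {for (0 : C), continuous h}.
  by apply: differentiable_continuous; apply/derivable1_diffP; exact: d0.
have h12 : \forall z \near (0 : C), h z != 0 /\ cmod (h z) <= 2.
  have : \forall y \near h 0, y != 0 /\ cmod y <= 2.
    rewrite h0; apply/nearC; exists 1 => // y hy; split.
      by apply/eqP => y0; move: hy; rewrite y0 sub0r cmodN cmod1 ltxx.
    have := cmodD (y - 1) 1; rewrite subrK cmod1 => hy2.
    by rewrite (le_trans hy2)//; lra.
  exact: ch.
have /nearC[r r0 H] : \forall z \near (0 : C),
    f z = (z - 0) ^ 1%Z * h z /\ (h z != 0 /\ cmod (h z) <= 2).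
  by apply: filterS2 hf h12 => z.
exists r => // t t0 tr; have [|-> [hn hb]] := H t; first by rewrite subr0.
rewrite subr0 expr1z mulf_neq0 //; split=> //.
by rewrite cmodM mulrC ler_wpM2r ?cmod_ge0.
Qed.

Variables (n : nat) (f : C -> C) (c : C).
Hypothesis n0 : (1 <= n)%N.
Hypothesis fid : near_id f.
Hypothesis hH : hirzebruch_eq n f c.

(** Variables in arithmetic progression: all arguments u_i - u_k of f are then
    multiples of e between -n e and n e, where f is under control. *)
Definition arith (e : R) (i : nat) : C := (e * i%:R)%:C.

Lemma arith_adm : exists2 r : R, 0 < r & forall e, 0 < e -> e < r ->
  forall i k, (i <= n)%N -> (k <= n)%N -> i != k ->
  f (arith e i - arith e k) != 0 /\
  cmod (f (arith e i - arith e k)) <= 2 * e * n%:R.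
Proof.
have [r r0 hr] := fid; have n00 : (0 : R) < n%:R by rewrite ltr0n.
exists (r / n%:R); first by rewrite divr_gt0.
move=> e e0 er i k hi hk ik.
have E : arith e i - arith e k = (e * (i%:R - k%:R))%:C.
  by rewrite /arith -rmorphB /= mulrBr.
have cE : cmod (arith e i - arith e k) = e * `|i%:R - k%:R|.
  by rewrite E cmod_real normrM gtr0_norm.
have le1 : `|i%:R - k%:R : R| <= n%:R.
  rewrite ler_norml lerNl opprB !lerBlDr; apply/andP; split.
    by rewrite -natrD ler_nat (leq_trans hk)// leq_addr.
  by rewrite -natrD ler_nat (leq_trans hi)// leq_addr.
have [||h1 h2] := hr (arith e i - arith e k).
- by rewrite -cmod_gt0 cE mulr_gt0// normr_gt0 subr_eq0 eqr_nat.
- rewrite cE (le_lt_trans (ler_wpM2l (ltW e0) le1))//.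
  by rewrite -ltr_pdivlMr.
split=> //; rewrite (le_trans h2)// cE -mulrA ler_wpM2l//.
by rewrite ler_wpM2l// ltW.
Qed.

(** Shifting one variable by a period multiplies one summand of the equation by
    chi^n and the others by chi^-1; the two equations only agree if
    chi^(n+1) = 1, because that one summand is unbounded near the diagonal. *)
Lemma hirzebruch_period (w chi : C) : chi != 0 ->
  (forall t, f (t + w) = chi * f t) -> chi ^+ n.+1 = 1.
Proof.
move=> chi0 hw.
have hw' t : f (t - w) = chi^-1 * f t.
  by rewrite -{2}(subrK w t) hw mulKf.
have [r r0 hr] := arith_adm.
have key e : 0 < e -> e < r -> chi ^+ n.+1 - 1 =
    (chi - 1) * c * \prod_(i < n.+1 | i != ord0) f (arith e i - arith e 0).
  move=> e0 er.
  have adm (i k : 'I_n.+1) : i != k -> f (arith e i - arith e k) != 0.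
    have hi (j : 'I_n.+1) : (j <= n)%N by rewrite -ltnS.
    by move=> ik; exact: (hr e e0 er i k (hi i) (hi k) ik).1.
  pose u (i : 'I_n.+1) := arith e i.
  pose u' (i : 'I_n.+1) := arith e i + (if i == ord0 then w else 0).
  (* The variable u_0 is shifted by w. *)
  have f0 (k i : 'I_n.+1) : i != k -> f (u' i - u' k) =
     (if k == ord0 then chi^-1 else if i == ord0 then chi else 1) * f (u i - u k).
    rewrite /u' /u => ik; case: (eqVneq k ord0) ik => [-> ik|k0 ik].
      by rewrite (negPf ik) addr0 opprD addrA hw'.
    case: (eqVneq i ord0) => [->|i0]; first by rewrite addr0 addrAC hw.
    by rewrite !addr0 mul1r.
  have h := hH (u := u) adm.
  have h' : \sum_(k < n.+1) \prod_(i < n.+1 | i != k) (f (u' i - u' k))^-1 = c.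
    apply: hH => i k ik; rewrite f0// mulf_neq0 ?adm//.
    by case: ifP => _; [rewrite invr_eq0|case: ifP => _; rewrite ?oner_eq0].
  rewrite big_ord_recl /= in h; rewrite big_ord_recl /= in h'.
  set T := \prod_(i < n.+1 | i != ord0) _ in h.
  set X := \sum_(k < n) _ in h.
  have T' : \prod_(i < n.+1 | i != ord0) (f (u' i - u' ord0))^-1 = chi ^+ n * T.
    transitivity (\prod_(i < n.+1 | i != ord0) (chi * (f (u i - u ord0))^-1)).
      by apply: eq_bigr => i i0; rewrite f0// eqxx invfM invrK.
    rewrite big_split /= prodr_const; congr (_ ^+ _ * _).
    by have := cardC1 (ord0 : 'I_n.+1); rewrite card_ord.
  have X' : \sum_(k < n) \prod_(i < n.+1 | i != lift ord0 k)
      (f (u' i - u' (lift ord0 k)))^-1 = chi^-1 * X.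
    rewrite mulr_sumr; apply: eq_bigr => k _.
    rewrite (bigD1 ord0) //= [in RHS](bigD1 ord0) //= mulrA; congr (_ * _).
      by rewrite f0 ?neq_lift// eqxx /= invfM.
    by apply: eq_bigr => i /andP[ik i0]; rewrite f0// (negPf i0) /= mul1r.
  rewrite T' X' in h'.
  have TP : T * \prod_(i < n.+1 | i != ord0) f (arith e i - arith e 0) = 1.
    by rewrite -big_split /= big1// => i i0; rewrite mulVf// adm.
  set P := \prod_(i < _ | _) f _ in TP *.
  have XE : X = c - T by rewrite -h addrC addKr.
  have : (chi ^+ n.+1 - 1) * T = (chi - 1) * c.
    have -> : (chi ^+ n.+1 - 1) * T = chi * (chi ^+ n * T + chi^-1 * (c - T)) - c.
      by rewrite exprS; field.
    by rewrite -XE h'; ring.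
  by move=> <-; rewrite -mulrA TP mulr1.
(* In [key] the right-hand side tends to 0 with e, since every f(u_i - u_0) does. *)
apply/eqP; rewrite -subr_eq0 -cmod_eq0; apply/eqP/le_anti.
rewrite cmod_ge0 andbT; apply/ler_addgt0Pr => d d0; rewrite add0r.
pose K : R := cmod ((chi - 1) * c) + 1.
have K0 : 0 < K by rewrite ltr_wpDl ?cmod_ge0.
have n00 : (0 : R) < n%:R by rewrite ltr0n.
pose m := Num.min 1 (d / K); have m0 : 0 < m by rewrite lt_min ltr01 divr_gt0.
pose e := Num.min (r / 2) (m / (2 * n%:R)).
have e0 : 0 < e by rewrite lt_min !divr_gt0// mulr_gt0.
have er : e < r.
  by apply: (@le_lt_trans _ _ (r / 2)); [rewrite ge_min lexx|lra].
have em : 2 * e * n%:R <= m.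
  have : e <= m / (2 * n%:R) by rewrite ge_min lexx orbT.
  by rewrite ler_pdivlMr ?mulr_gt0// mulrA [e * 2]mulrC.
rewrite (key e e0 er) cmodM cmod_prod.
have fac (i : 'I_n.+1) : i != ord0 -> cmod (f (arith e i - arith e 0)) <= m.
  move=> i0; apply: le_trans em.
  by apply: (hr e e0 er i 0%N _ (leq0n n) i0).2; rewrite -ltnS.
have Pm : \prod_(i < n.+1 | i != ord0) cmod (f (arith e i - arith e 0)) <= m.
  pose i1 : 'I_n.+1 := lift ord0 (Ordinal n0).
  have i10 : i1 != ord0 by rewrite eq_sym neq_lift.
  rewrite (bigD1 i1 i10) -[leRHS]mulr1; apply: ler_pM; first exact: cmod_ge0.
  - by apply: prodr_ge0 => i _; exact: cmod_ge0.
  - exact: (fac i1 i10).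
  - apply: prodr_ile1 => i /andP[i0 _].
    by rewrite cmod_ge0 /= (le_trans (fac i i0))// ge_min lexx.
apply: (@le_trans _ _ (K * m)); last first.
  by rewrite mulrC -ler_pdivlMr// ge_min lexx orbT.
apply: ler_pM => //; first exact: cmod_ge0.
  by apply: prodr_ge0 => i _; exact: cmod_ge0.
by rewrite lerDl.
Qed.

(** If f decays along -T_j and 1/f along T_j, sending one variable to infinity
    along T_j makes a single summand dominate all others. *)
Lemma hirzebruch_escape (T : nat -> C) :
  (forall v, (fun j => f (v - T j)) @ \oo --> (0 : C)) ->
  (forall v, (fun j => (f (T j - v))^-1) @ \oo --> (0 : C)) ->
  (forall v, \forall j \near \oo, f (v - T j) != 0 /\ f (T j - v) != 0) -> False.
Proof.
move=> hm hp hne; have [r r0 hr] := arith_adm.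
pose e := r / 2; have e0 : 0 < e by rewrite divr_gt0.
have er : e < r by rewrite /e; lra.
have hi (j : 'I_n.+1) : (j <= n)%N by rewrite -ltnS.
have adm (i k : 'I_n.+1) : i != k -> f (arith e i - arith e k) != 0.
  by move=> ik; exact: (hr e e0 er i k (hi i) (hi k) ik).1.
pose u j (i : 'I_n.+1) := if i == ord0 then T j else arith e i.
have u0 j : u j ord0 = T j by rewrite /u eqxx.
have uS j i : i != ord0 -> u j i = arith e i by rewrite /u => /negPf ->.
pose P j := \prod_(i < n.+1 | i != ord0) f (u j i - u j ord0).
pose X j := \sum_(k < n) \prod_(i < n.+1 | i != lift ord0 k)
  (f (u j i - u j (lift ord0 k)))^-1.
have cvP : P @ \oo --> (0 : C).
  pose i1 : 'I_n.+1 := lift ord0 (Ordinal n0).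
  have i10 : i1 != ord0 by rewrite eq_sym neq_lift.
  have -> : (0 : C) = \prod_(i < n.+1 | i != ord0) 0.
    by rewrite (bigD1 i1) //= mul0r.
  apply: cvgC_prod => i i0; under eq_fun do rewrite u0 uS//.
  exact: hm.
have cvX : X @ \oo --> (0 : C).
  have -> : (0 : C) = \sum_(k < n) 0 by rewrite big1.
  apply: cvgC_sum => k _.
  have k0 : lift ord0 k != ord0 by rewrite eq_sym neq_lift.
  rewrite (_ : (fun j => _) = (fun j => (f (T j - arith e (lift ord0 k)))^-1 *
      \prod_(i < n.+1 | (i != lift ord0 k) && (i != ord0))
      (f (arith e i - arith e (lift ord0 k)))^-1)).
    rewrite -(mul0r (\prod_(i < n.+1 | (i != lift ord0 k) && (i != ord0))
      (f (arith e i - arith e (lift ord0 k)))^-1)).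
    by apply: cvgM; [exact: hp|exact: cvg_cst].
  apply/funext => j; rewrite (bigD1 ord0); last exact: neq_lift.
  rewrite u0 (uS _ _ k0); congr (_ * _).
  by apply: eq_bigr => i /andP[_ i0]; rewrite !uS.
(* P_j is the inverse of the summand k = 0, which is c - X_j by the equation; as j
   grows, both P_j and X_j tend to 0. *)
have ev : \forall j \near \oo, 1 = P j * (c - X j).
  have : \forall j \near \oo, forall i : 'I_n.+1,
      f (arith e i - T j) != 0 /\ f (T j - arith e i) != 0.
    by apply: filter_forall => i; exact: hne.
  apply: filterS => j hj.
  have h : \sum_(k < n.+1) \prod_(i < n.+1 | i != k) (f (u j i - u j k))^-1 = c.
    apply: hH => i k; case: (eqVneq k ord0) => [->|k0] ik.
      by rewrite u0 uS//; exact: (hj i).1.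
    case: (eqVneq i ord0) ik => [->|i0] ik; first by rewrite u0 uS//; exact: (hj k).2.
    by rewrite !uS//; exact: adm.
  rewrite big_ord_recl -/(X j) in h; rewrite -h addrK /P -big_split /= big1// => i i0.
  by rewrite u0 uS// divff//; exact: (hj i).1.
have cv0 : (fun j => P j * (c - X j)) @ \oo --> (0 : C).
  rewrite -(mul0r (c - 0)); apply: cvgM; first exact: cvP.
  by apply: cvgB; [exact: cvg_cst|exact: cvX].
have cv1 : (fun j => P j * (c - X j)) @ \oo --> (1 : C).
  apply: squeezeC (cvg_cst 0); apply: filterS ev => j <-.
  by rewrite subrr cmod0.
by have /eqP := cvgC_unique cv1 cv0; rewrite oner_eq0.
Qed.

End HirzebruchEquation.

(** * Theta quotients that solve the Hirzebruch equation *)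

Section NonDegenerate.
Variable R : realType.
Local Notation C := (Cplx R).
Variables (L : lattice R) (s b : C).
Local Notation F := (sigma_quot (thetaS L) s b).
Local Notation om := (per1 L).
Local Notation tau := (per_up L).
Local Notation cp := (cperiod L).

Lemma sigma_quot_per1 t : F (t + om) = cexp (b * om) * F t.
Proof.
have e : thetaS L (s - (t + om)) = thetaS L (s - t).
  by rewrite -(thetaS_per1 L (s - (t + om))); congr thetaS; ring.
have ef : thetaS L (t + om) = thetaS L t by exact: thetaS_per1.
rewrite /sigma_quot e ef mulrDr cexpD.
move: (thetaS L t) (thetaS L s) (thetaS L (s - t)) => u v w; ring.
Qed.

Lemma sigma_quot_per_up t :
  F (t + tau) = cexp ((b + cp) * tau - cp * s) * F t.
Proof.
have [x xE] : exists x, x = s - (t + tau) by eexists.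
have eb : thetaS L (s - t) = - cexp (- cp * x) * thetaS L x.
  by rewrite -thetaS_per_up xE; congr thetaS; ring.
have ef : thetaS L (t + tau) = - cexp (- cp * t) * thetaS L t.
  exact: thetaS_per_up.
have ec : cexp ((b + cp) * tau - cp * s) =
    cexp (b * tau) * cexp (- cp * t) * cexp (- cp * x).
  by rewrite -!cexpD xE; congr cexp; ring.
rewrite /sigma_quot -xE ef eb ec mulrDr cexpD.
have := cexp_neq0 (- cp * x).
move: (thetaS L t) (thetaS L s) (thetaS L x) => u v w.
move: (cexp (- cp * x)) => y y0.
have -> : (- y * w)^-1 = - y^-1 * w^-1 by rewrite !mulNr invrN invfM.
by move: w^-1 => w'; field.
Qed.

Lemma power_periodic (G : C -> C) N :
  (forall z, G (z + om) ^+ N = G z ^+ N) ->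
  (forall z, G (z + tau) ^+ N = G z ^+ N) ->
  forall w z, lattice_set L w -> G (z + w) ^+ N = G z ^+ N.
Proof.
move=> h1 h2.
pose Q p := forall z, G (z + p) ^+ N = G z ^+ N.
have QN p : Q p -> Q (- p) by move=> h z; rewrite -(h (z - p)) subrK.
have Qn p n : Q p -> Q (p *+ n).
  move=> h; elim: n => [|n IH] z; first by rewrite mulr0n addr0.
  by rewrite mulrS addrA IH h.
have Qz p (n : int) : Q p -> Q (p *~ n).
  move=> h; case: n => n; first exact: Qn.
  by rewrite NegzE mulrNz; apply: QN; exact: Qn.
move=> w z /lattice_setP[m [n ->]]; rewrite addrA.
by rewrite (Qz tau n h2) (Qz om m h1).
Qed.

(** Both multipliers of the sigma quotient are (n+1)-th roots of unity. For per1
    this says that b (n+1) lies in cperiod * Z, and then the condition for the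
    second period says that s (n+1) is a lattice point. *)
Lemma nondegenerate_level n c : (1 <= n)%N -> ~ lattice_set L s ->
  hirzebruch_eq n F c -> is_elliptic_level_on L n.+1 F.
Proof.
move=> n0 sL hH.
have fid := leading_near_id (sigma_quot_leading0 (thetaS_sigma_like L) b sL).
have k1 := hirzebruch_period n0 fid hH (cexp_neq0 _) sigma_quot_per1.
have k2 := hirzebruch_period n0 fid hH (cexp_neq0 _) sigma_quot_per_up.
apply: sigma_quot_level; [exact: thetaS_sigma_like|exact: sL| |].
  move: k1 k2; rewrite -!cexpMn => /cexp_kernel[k1 h1] /cexp_kernel[k2 h2].
  apply/lattice_setP; exists (- k2), (k1 + n.+1%:Z).
  have t0 := twopii_neq0 R; have o0 := per1_neq0 L.
  apply: (mulfI (cperiod_neq0 L)).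
  have -> : cp * (s *+ n.+1) = ((b + cp) * tau) *+ n.+1 -
      ((b + cp) * tau - cp * s) *+ n.+1.
    by rewrite -mulrnBl opprB addrCA subrr addr0 mulrnAr.
  have h1' : b * n.+1%:R = cp * k1%:~R.
    rewrite mulr_natr mulrzr; apply: (mulIf o0).
    by rewrite mulrnAl h1 mulrzAl /cperiod divfK.
  have co : twopii R = cp * om by rewrite /cperiod divfK.
  rewrite h2 co -[_ *~ k2]mulrzr -[om *~ _]mulrzr -[tau *~ _]mulrzr -mulr_natr.
  rewrite rmorphN rmorphD /= -pmulrn.
  move: n.+1%:R k1%:~R k2%:~R h1' => x y z h1'.
  have -> : (b + cp) * tau * x = b * x * tau + cp * tau * x by ring.
  by rewrite h1'; ring.
apply: power_periodic => z.
  by rewrite sigma_quot_per1 exprMn k1 mul1r.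
by rewrite sigma_quot_per_up exprMn k2 mul1r.
Qed.

End NonDegenerate.

(** * Degenerate Krichever functions *)

Section Singular.
Variable R : realType.
Local Notation C := (Cplx R).

Lemma csinhE (z : C) : csinh z = (cexp (2 * z) - 1) / (2 * cexp z).
Proof.
rewrite /csinh cexpN mulr_natl cexpMn; have := cexp_neq0 z.
by move: (cexp z) => x x0; field.
Qed.

Lemma ccoshE (z : C) : ccosh z = (cexp (2 * z) + 1) / (2 * cexp z).
Proof.
rewrite /ccosh cexpN mulr_natl cexpMn; have := cexp_neq0 z.
by move: (cexp z) => x x0; field.
Qed.

Lemma csinh_eq0 (z : C) : (csinh z == 0) = (cexp (2 * z) == 1).
Proof.
rewrite csinhE mulf_eq0 invr_eq0 mulf_eq0 (negPf (cexp_neq0 z)) orbF.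
by rewrite pnatr_eq0 orbF subr_eq0.
Qed.

(** The function in terms of X = e^(2 eta t), with numerator and denominator
    entire in t. *)
Lemma sing_funE (lambda q eta t : C) : eta != 0 ->
  sing_fun lambda q eta t = cexp (lambda * t) * (cexp (2 * eta * t) - 1) /
    ((q + eta) * cexp (2 * eta * t) - (q - eta)).
Proof.
move=> eta0; have X2 : cexp (2 * (eta * t)) = cexp (2 * eta * t) by rewrite mulrA.
rewrite /sing_fun (negPf eta0) csinh_eq0 /ccoth csinhE ccoshE X2.
case: eqP => [->|/eqP X1]; first by rewrite subrr mulr0 mul0r.
have := cexp_neq0 (eta * t); move: (cexp (eta * t)) => e e0.
move: (cexp (2 * eta * t)) X1 => X X1.
have X10 : X - 1 != 0 by rewrite subr_eq0.
have -> : q + eta * ((X + 1) / (2 * e) / ((X - 1) / (2 * e))) =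
   ((q + eta) * X - (q - eta)) / (X - 1) by field; exact/andP.
by rewrite invf_div mulrA.
Qed.

Lemma sing_funN (lambda q eta t : C) :
  sing_fun lambda q (- eta) t = sing_fun lambda q eta t.
Proof.
have s2 : csinh (- (eta * t)) = - csinh (eta * t).
  by rewrite /csinh opprK; ring.
have c2 : ccosh (- (eta * t)) = ccosh (eta * t) by rewrite /ccosh opprK addrC.
by rewrite /sing_fun oppr_eq0 mulNr /ccoth s2 c2 oppr_eq0 invrN mulrN mulrNN.
Qed.

Lemma sing_todd (q eta t : C) :
  sing_fun 0 q eta t = todd_fun (eta - q) (- eta - q) t.
Proof.
have [->|eta0] := eqVneq eta 0.
  rewrite /sing_fun /todd_fun eqxx oppr0 eqxx mul0r cexp0 mulr1 sub0r mulNr.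
  by rewrite opprK.
rewrite sing_funE// mul0r cexp0 mul1r /todd_fun.
have -> : (eta - q == - eta - q) = false.
  by rewrite (inj_eq (addIr _)) -subr_eq0 opprK -mulr2n mulrn_eq0 (negPf eta0).
have -> : cexp ((eta - q) * t) = cexp (2 * eta * t) * cexp ((- eta - q) * t).
  by rewrite -cexpD; congr cexp; ring.
have := cexp_neq0 ((- eta - q) * t).
move: (cexp _) (cexp _) => y x x0.
rewrite -[_ * x - x]/(_ * x - x).
have -> : y * x - x = (y - 1) * x by ring.
have -> : (eta - q) * x - (- eta - q) * (y * x) = ((q + eta) * y - (q - eta)) * x by ring.
by rewrite invfM mulrACA divff// mulr1.
Qed.

Lemma sing_near_id (lambda q eta : C) : near_id (sing_fun lambda q eta).
Proof.
apply: leading_near_id; have [->|eta0] := eqVneq eta 0.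
  have -> : (1 : C) = cexp (lambda * 0) / (1 + q * 0).
    by rewrite !mulr0 addr0 cexp0 divr1.
  apply: (@leading_term_quot _ _ (fun t => cexp (lambda * t)) (fun t => 1 + q * t)).
  - by move=> z; exact: derivable_cexp.
  - move=> z; apply: derivableD; first exact: derivable_cst.
    by apply: derivableM; [exact: derivable_cst|exact: derivable_id].
  - by rewrite mulr0 addr0 oner_eq0.
  - by move=> z; rewrite /sing_fun eqxx subr0 expr1z; exact/esym/mulrA.
have [h [hE h0 hd]] := cexp_sub1 (2 * eta).
have e20 : 2 * eta != 0 by rewrite mulf_neq0 ?pnatr_eq0.
have D0 : (q + eta) * cexp (2 * eta * 0) - (q - eta) = 2 * eta.
  by rewrite mulr0 cexp0; ring.
have -> : (1 : C) = cexp (lambda * 0) * h 0 /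
    ((q + eta) * cexp (2 * eta * 0) - (q - eta)).
  by rewrite D0 mulr0 cexp0 h0 mul1r divff.
apply: (@leading_term_quot _ _ (fun t => cexp (lambda * t) * h t)
  (fun t => (q + eta) * cexp (2 * eta * t) - (q - eta))).
- by move=> z; apply: derivableM; [exact: derivable_cexp|exact: hd].
- move=> z; apply: derivableB; last exact: derivable_cst.
  by apply: derivableM; [exact: derivable_cst|exact: derivable_cexp].
- by rewrite D0.
- by move=> z; rewrite sing_funE// hE subr0 expr1z; ring.
Qed.

Lemma sing_period (lambda q eta t : C) : eta != 0 ->
  sing_fun lambda q eta (t + twopii R / (2 * eta)) =
  cexp (lambda * (twopii R / (2 * eta))) * sing_fun lambda q eta t.
Proof.
move=> eta0; have e20 : 2 * eta != 0 by rewrite mulf_neq0 ?pnatr_eq0.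
have X : cexp (2 * eta * (t + twopii R / (2 * eta))) = cexp (2 * eta * t).
  by rewrite mulrDr cexpD mulrC [2 * eta * (_ / _)]mulrC divfK// cexp_twopii mul1r.
by rewrite !sing_funE// X (mulrDr lambda) cexpD; ring.
Qed.

End Singular.

(** * Degenerate Krichever functions that fail the Hirzebruch equation *)

Section SingularEscape.
Variable R : realType.
Local Notation C := (Cplx R).

Lemma cvgC_geo (a : C) : cmod a < 1 -> (fun j => a ^+ j) @ \oo --> (0 : C).
Proof.
move=> a1; apply: (@squeezeC _ _ _ (fun j => cmod a ^+ j)).
  by apply: nearW => j; rewrite subr0 cmodX.
by apply: cvg_expr; rewrite ger0_norm ?cmod_ge0.
Qed.

Lemma cmod_cexpN_lt1 (z : C) : 0 < complex.Re z -> cmod (cexp (- z)) < 1.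
Proof. by move=> z0; rewrite cmod_cexp expR_lt1 [complex.Re _]raddfN oppr_lt0. Qed.

Lemma near_ne (u : nat -> C) (l a : C) : u @ \oo --> l -> l != a ->
  \forall j \near \oo, u j != a.
Proof.
move=> /cvgCP h la; have la0 : 0 < cmod (l - a) by rewrite cmod_gt0 subr_eq0.
apply: filterS (h _ la0) => j hj; apply/eqP => e; move: hj.
by rewrite e cmodBC ltxx.
Qed.

Variables (n : nat) (c : C).
Hypothesis n0 : (1 <= n)%N.

Section Eta.
Variables (lambda q eta : C).
Hypothesis eta0 : eta != 0.
Hypothesis hH : hirzebruch_eq n (sing_fun lambda q eta) c.
Hypothesis kap : 0 < complex.Re (lambda / (2 * eta)).

Local Notation f := (sing_fun lambda q eta).
(** Along T_j = j / (2 eta) the variable e^(2 eta t) grows like e^j. *)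
Definition escT (j : nat) : C := (2 * eta)^-1 *+ j.
(** The values of e^(2 eta t) and e^(lambda t) at v - T_j; both decay
    geometrically. *)
Definition escY v (j : nat) : C := cexp (2 * eta * v) * cexp (- 1) ^+ j.
Definition escG v (j : nat) : C := cexp (lambda * v) * cexp (- (lambda / (2 * eta))) ^+ j.

Local Notation T := escT.
Local Notation Y := escY.
Local Notation G := escG.

Let e20 : 2 * eta != 0. Proof. by rewrite mulf_neq0 ?pnatr_eq0. Qed.

Lemma escapeY v j : cexp (2 * eta * (v - T j)) = Y v j.
Proof.
by rewrite /escT mulrBr cexpD mulrnAr -mulNrn cexpMn divff.
Qed.

Lemma escapeG v j : cexp (lambda * (v - T j)) = G v j.
Proof. by rewrite /escT mulrBr cexpD mulrnAr -mulNrn cexpMn. Qed.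

Lemma escapeYV v j : cexp (2 * eta * (T j - v)) = (Y v j)^-1.
Proof. by rewrite -escapeY -cexpN -mulrN opprB. Qed.

Lemma escapeGV v j : cexp (lambda * (T j - v)) = (G v j)^-1.
Proof. by rewrite -escapeG -cexpN -mulrN opprB. Qed.

Lemma escapeY_neq0 v j : Y v j != 0.
Proof. by rewrite -escapeY cexp_neq0. Qed.

Lemma escapeG_neq0 v j : G v j != 0.
Proof. by rewrite -escapeG cexp_neq0. Qed.

Lemma escapeY_cvg v : Y v @ \oo --> (0 : C).
Proof.
rewrite -(mulr0 (cexp (2 * eta * v))); apply: cvgM; first exact: cvg_cst.
by apply: cvgC_geo; apply: cmod_cexpN_lt1; exact: ltr01.
Qed.

Lemma escapeG_cvg v : G v @ \oo --> (0 : C).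
Proof.
rewrite -(mulr0 (cexp (lambda * v))); apply: cvgM; first exact: cvg_cst.
by apply: cvgC_geo; exact: cmod_cexpN_lt1.
Qed.

Lemma escape_minus v j :
  f (v - T j) = G v j * (Y v j - 1) / ((q + eta) * Y v j - (q - eta)).
Proof. by rewrite sing_funE// escapeY escapeG. Qed.

Lemma escape_plus v j :
  (f (T j - v))^-1 = G v j * ((q + eta) - (q - eta) * Y v j) / (1 - Y v j).
Proof.
rewrite sing_funE// escapeYV escapeGV.
have := escapeY_neq0 v j; have := escapeG_neq0 v j.
move: (Y v j) (G v j) => y g g0 y0.
have -> : y^-1 - 1 = (1 - y) / y by field.
have -> : (q + eta) / y - (q - eta) = ((q + eta) - (q - eta) * y) / y by field.
rewrite !invfM !invrK; move: (1 - y)^-1 => z.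
by field.
Qed.

Lemma escape_plus_cvg v : (fun j => (f (T j - v))^-1) @ \oo --> (0 : C).
Proof.
under eq_fun do rewrite escape_plus.
have h : (fun j => G v j * ((q + eta) - (q - eta) * Y v j) / (1 - Y v j)) @ \oo -->
    0 * ((q + eta) - (q - eta) * 0) / (1 - 0).
  apply: cvgM; last first.
    apply: cvgV; first by rewrite subr0 oner_eq0.
    by apply: cvgB; [exact: cvg_cst|exact: escapeY_cvg].
  apply: cvgM; first exact: escapeG_cvg.
  apply: cvgB; first exact: cvg_cst.
  by apply: cvgM; [exact: cvg_cst|exact: escapeY_cvg].
rewrite !mul0r in h; exact: h.
Qed.

(** If q <> eta, the denominator of f has a nonzero limit along v - T_j. *)
Lemma sing_escape_ne : q != eta -> False.
Proof.
move=> qe; have qe0 : q - eta != 0 by rewrite subr_eq0.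
have cvD v : (fun j => (q + eta) * Y v j - (q - eta)) @ \oo --> - (q - eta).
  rewrite -[X in _ --> X]add0r -(mulr0 (q + eta)); apply: cvgB; last exact: cvg_cst.
  by apply: cvgM; [exact: cvg_cst|exact: escapeY_cvg].
have cvY1 v : (fun j => Y v j - 1) @ \oo --> (0 - 1 : C).
  exact: (cvgB (@escapeY_cvg v) (cvg_cst (1 : C))).
apply: (hirzebruch_escape n0 (sing_near_id lambda q eta) hH (T := T)) => v.
- under eq_fun do rewrite escape_minus.
  have h : (fun j => G v j * (Y v j - 1) / ((q + eta) * Y v j - (q - eta)))
      @ \oo --> 0 * (0 - 1) / - (q - eta).
    apply: cvgM; last by apply: cvgV; [rewrite oppr_eq0|exact: cvD].
    by apply: cvgM; [exact: escapeG_cvg|exact: cvY1].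
  rewrite !mul0r in h; exact: h.
- exact: escape_plus_cvg.
have h1 := near_ne (cvY1 v) (a := 0); have h2 := near_ne (cvD v) (a := 0).
have {}h1 : \forall j \near \oo, Y v j - 1 != 0.
  by apply: h1; rewrite sub0r oppr_eq0 oner_eq0.
have {}h2 : \forall j \near \oo, (q + eta) * Y v j - (q - eta) != 0.
  by apply: h2; rewrite oppr_eq0.
have h3 : \forall j \near \oo, (q + eta) - (q - eta) * Y v j != 0.
  have [qe'|qe'] := eqVneq (q + eta) 0.
    apply: nearW => j; rewrite qe' sub0r oppr_eq0.
    by apply: mulf_neq0; [exact: qe0|exact: escapeY_neq0].
  apply: (@near_ne _ ((q + eta) - (q - eta) * 0)); last by rewrite mulr0 subr0.
  apply: cvgB; first exact: cvg_cst.
  by apply: cvgM; [exact: cvg_cst|exact: escapeY_cvg].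
apply: filterS3 h1 h2 h3 => j h1 h2 h3; split.
  rewrite escape_minus; apply: mulf_neq0; last by rewrite invr_eq0.
  by apply: mulf_neq0; [exact: escapeG_neq0|].
rewrite -invr_eq0 escape_plus; apply: mulf_neq0; last first.
  by rewrite invr_eq0 -opprB oppr_eq0.
by apply: mulf_neq0; [exact: escapeG_neq0|].
Qed.

(** If q = eta, the denominator of f is a multiple of e^(2 eta t); it decays as
    well, but more slowly than the numerator. *)
Lemma sing_escape_eq : q = eta -> 1 < complex.Re (lambda / (2 * eta)) -> False.
Proof.
move=> qe kap1.
have Em v j : f (v - T j) = cexp (lambda * v) / (2 * eta * cexp (2 * eta * v)) *
    cexp (- (lambda / (2 * eta) - 1)) ^+ j * (Y v j - 1).
  rewrite escape_minus qe subrr subr0.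
  have -> : cexp (- (lambda / (2 * eta) - 1)) = cexp (- (lambda / (2 * eta))) / cexp (- 1).
    by rewrite -cexpB; congr cexp; ring.
  rewrite expr_div_n /escG /escY.
  have := cexp_neq0 (2 * eta * v); have := cexp_neq0 (- 1 : C).
  move: (cexp (2 * eta * v)) (cexp (- 1)) (cexp (lambda * v)) => x d g d0 x0.
  have dj : d ^+ j != 0 by rewrite expf_neq0.
  move: (d ^+ j) (_ ^+ j) dj => dj w dj0.
  by field; rewrite dj0 x0 eta0 -mulr2n -mulr_natl.
have cvY1 v : (fun j => Y v j - 1) @ \oo --> (0 - 1 : C).
  exact: (cvgB (@escapeY_cvg v) (cvg_cst (1 : C))).
apply: (hirzebruch_escape n0 (sing_near_id lambda q eta) hH (T := T)) => v.
- under eq_fun do rewrite Em.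
  set g := cexp (- (lambda / (2 * eta) - 1)).
  set k := cexp (lambda * v) / (2 * eta * cexp (2 * eta * v)).
  have h : (fun j => k * g ^+ j * (Y v j - 1)) @ \oo --> k * 0 * (0 - 1).
    apply: cvgM; last exact: cvY1.
    apply: cvgM; first exact: cvg_cst.
    apply: cvgC_geo; apply: cmod_cexpN_lt1.
    by rewrite [complex.Re _]raddfB /= subr_gt0.
  rewrite mulr0 mul0r in h; exact: h.
- exact: escape_plus_cvg.
have h1 := near_ne (cvY1 v) (a := 0).
have {}h1 : \forall j \near \oo, Y v j - 1 != 0.
  by apply: h1; rewrite sub0r oppr_eq0 oner_eq0.
apply: filterS h1 => j h1; split.
  rewrite Em; apply: mulf_neq0; last exact: h1.
  apply: mulf_neq0; last by rewrite expf_neq0 ?cexp_neq0.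
  by rewrite mulf_neq0 ?invr_eq0 ?cexp_neq0// mulf_neq0 ?cexp_neq0.
rewrite -invr_eq0 escape_plus; apply: mulf_neq0; last first.
  by rewrite invr_eq0 -opprB oppr_eq0.
apply: mulf_neq0; first exact: escapeG_neq0.
by rewrite qe subrr mul0r subr0 -mulr2n -mulr_natl.
Qed.

End Eta.

(** For eta = 0, f(t) = t e^(lambda t) / (1 + q t) is driven to 0 and to infinity
    by its exponential factor along T_j = (j+1) / lambda. The case q = 0 is
    apart: f(t) = t e^(lambda t) decays although its factor t is unbounded. *)
Lemma sing_escape_0 (lambda q : C) : lambda != 0 ->
  hirzebruch_eq n (sing_fun lambda q 0) c -> False.
Proof.
move=> l0 hH; pose T (j : nat) : C := lambda^-1 *+ j.+1.
have fE t : sing_fun lambda q 0 t = t * cexp (lambda * t) / (1 + q * t).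
  by rewrite /sing_fun eqxx.
pose d : C := cexp (- 1).
have d1 : cmod d < 1 by apply: cmod_cexpN_lt1; exact: ltr01.
have cvd : (fun j => d ^+ j.+1) @ \oo --> (0 : C).
  by rewrite (cvg_shiftS (fun j => d ^+ j)); exact: cvgC_geo.
have eT v j : cexp (lambda * (v - T j)) = cexp (lambda * v) * d ^+ j.+1.
  by rewrite mulrBr cexpD mulrnAr -mulNrn cexpMn divff.
have eTV v j : cexp (lambda * (T j - v)) = (cexp (lambda * v) * d ^+ j.+1)^-1.
  by rewrite -eT -cexpN -mulrN opprB.
pose h (j : nat) : C := (j.+1%:R)^-1.
have cvh : h @ \oo --> (0 : C).
  have -> : h = (fun j => (harmonic j)%:C).
    by apply/funext => j; rewrite /h /harmonic /= fmorphV rmorph_nat.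
  by apply: cvgC_real; exact: cvg_harmonic.
have h0 j : (j.+1%:R : C) != 0 by rewrite pnatr_eq0.
have vTE v j : v - T j = (v * h j - lambda^-1) * j.+1%:R.
  by rewrite mulrBl /h divfK// mulr_natr.
have cvw v : (fun j => v * h j - lambda^-1) @ \oo --> - lambda^-1.
  rewrite -[X in _ --> X]add0r -(mulr0 v); apply: cvgB; last exact: cvg_cst.
  by apply: cvgM; [exact: cvg_cst|exact: cvh].
have l0' : - lambda^-1 != 0 by rewrite oppr_eq0 invr_eq0.
have cvT v : (fun j => (v - T j)^-1) @ \oo --> (0 : C).
  under eq_fun do rewrite vTE invfM.
  rewrite -(mulr0 (- lambda^-1)^-1); apply: cvgM; last exact: cvh.
  by apply: cvgV; [exact: l0'|exact: cvw].
have Tne v : \forall j \near \oo, v - T j != 0.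
  apply: filterS (near_ne (cvw v) l0') => j hj.
  by rewrite vTE; apply: mulf_neq0; [exact: hj|exact: h0].
have cvZ v : (fun j => (v - T j)^-1 + q) @ \oo --> (0 + q : C).
  by apply: cvgD; [exact: cvT|exact: cvg_cst].
have cvZ' v : (fun j => q - (v - T j)^-1) @ \oo --> (q - 0 : C).
  by apply: cvgB; [exact: cvg_cst|exact: cvT].
have Zne v : \forall j \near \oo, (v - T j)^-1 + q != 0 /\ q - (v - T j)^-1 != 0.
  have [->|q0] := eqVneq q 0.
    by apply: filterS (Tne v) => j hj; rewrite addr0 sub0r oppr_eq0 invr_eq0.
  have h1 : \forall j \near \oo, (v - T j)^-1 + q != 0.
    by apply: near_ne (cvZ v) _; rewrite add0r.
  have h2 : \forall j \near \oo, q - (v - T j)^-1 != 0.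
    by apply: near_ne (cvZ' v) _; rewrite subr0.
  by apply: filterS2 h1 h2 => j; split.
have Em v j : v - T j != 0 -> sing_fun lambda q 0 (v - T j) =
    cexp (lambda * v) * d ^+ j.+1 / ((v - T j)^-1 + q).
  move=> vT; rewrite fE eT; move: (v - T j) vT => z z0.
  have -> : 1 + q * z = z * (z^-1 + q) by rewrite mulrDr divff// [z * q]mulrC.
  by rewrite invfM; move: (z^-1 + q)^-1 => w; field.
have Ep v j : v - T j != 0 -> (sing_fun lambda q 0 (T j - v))^-1 =
    cexp (lambda * v) * d ^+ j.+1 * (q - (v - T j)^-1).
  move=> vT; rewrite fE eTV -[T j - v]opprB; move: (v - T j) vT => z z0.
  have := cexp_neq0 (lambda * v).
  have dj : d ^+ j.+1 != 0 by rewrite expf_neq0 ?cexp_neq0.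
  move: (cexp (lambda * v)) (d ^+ j.+1) dj => g w w0 g0.
  have -> : q - z^-1 = (1 + q * - z) / - z by field; rewrite ?oppr_eq0.
  by rewrite !invf_div; ring.
apply: (hirzebruch_escape n0 (sing_near_id lambda q 0) hH (T := T)) => v.
- have [q0|q0] := eqVneq q 0.
    have cvjd : (fun j => j.+1%:R * d ^+ j.+1) @ \oo --> (0 : C).
      apply: (@squeezeC _ _ _ (fun j => 2 * harmonic j)); last first.
        rewrite -(mulr0 2); apply: cvgM; [exact: cvg_cst|exact: cvg_harmonic].
      apply: nearW => j; rewrite subr0 cmodM cmod_nat cmodX cmod_cexp.
      rewrite [complex.Re _]raddfN /= -expRM_natl mulrN mulr1 expRN.
      have x0 : (0 : R) < j.+1%:R by rewrite ltr0n.
      rewrite ler_pdivrMr ?expR_gt0// /harmonic /=.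
      have := expR_ge1Dxn 1 (ltW x0); move: (j.+1%:R) x0 => x x0 hx.
      rewrite mulrAC ler_pdivlMr//.
      by rewrite (_ : 2`!%:R = 2 :> R)// expr2 in hx; lra.
    have E0 : (fun j => sing_fun lambda q 0 (v - T j)) =
      (fun j => cexp (lambda * v) * ((v * h j - lambda^-1) * (j.+1%:R * d ^+ j.+1))).
      apply/funext => j; rewrite fE q0 mul0r addr0 divr1 eT vTE; ring.
    rewrite E0 -(mulr0 (cexp (lambda * v))); apply: cvgM; first exact: cvg_cst.
    rewrite -(mulr0 (- lambda^-1)); apply: cvgM; [exact: cvw|exact: cvjd].
  have cv0 : (fun j => cexp (lambda * v) * d ^+ j.+1 / ((v - T j)^-1 + q)) @ \oo --> (0 : C).
    have h' : (fun j => cexp (lambda * v) * d ^+ j.+1 / ((v - T j)^-1 + q)) @ \oo -->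
        cexp (lambda * v) * 0 / (0 + q).
      apply: cvgM; first by apply: cvgM; [exact: cvg_cst|exact: cvd].
      by apply: cvgV; [rewrite add0r|exact: cvZ].
    rewrite mulr0 mul0r in h'; exact: h'.
  apply: cvg_trans cv0; apply: near_eq_cvg.
  by apply: filterS (Tne v) => j hj; rewrite Em.
- have cv0 : (fun j => cexp (lambda * v) * d ^+ j.+1 * (q - (v - T j)^-1)) @ \oo --> (0 : C).
    have h' : (fun j => cexp (lambda * v) * d ^+ j.+1 * (q - (v - T j)^-1)) @ \oo -->
        cexp (lambda * v) * 0 * (q - 0).
      apply: cvgM; last exact: cvZ'.
      by apply: cvgM; [exact: cvg_cst|exact: cvd].
    rewrite mulr0 mul0r in h'; exact: h'.
  apply: cvg_trans cv0; apply: near_eq_cvg.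
  by apply: filterS (Tne v) => j hj; rewrite Ep.
apply: filterS2 (Tne v) (Zne v) => j hj [z1 z2].
have gd : cexp (lambda * v) * d ^+ j.+1 != 0.
  by apply: mulf_neq0; [exact: cexp_neq0|rewrite expf_neq0 ?cexp_neq0].
split.
  by rewrite Em//; apply: mulf_neq0; [exact: gd|rewrite invr_eq0].
by rewrite -invr_eq0 Ep//; apply: mulf_neq0.
Qed.

End SingularEscape.

(** * Power series close to 1 *)

Section CloseToOne.
Variable R : realType.
Local Notation C := (Cplx R).

(** Convergence to 1 in the Banach algebra of power series that converge
    absolutely on the closed unit disc. *)
Definition to_one (f : nat -> C -> C) : Prop := exists d : nat -> R,
  d @ \oo --> (0 : R) /\
  \forall j \near \oo, exists a, expands 1 (fun t => f j t - 1) a (d j).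

Lemma to_one_ext f g : (\forall j \near \oo, forall t, cmod t <= 1 -> f j t = g j t) ->
  to_one f -> to_one g.
Proof.
move=> fg [d [d0 h]]; exists d; split; first exact: d0.
apply: filterS2 fg h => j e [a ha]; exists a.
by apply: expands_ext ha => z z1; rewrite e.
Qed.

Lemma to_one_mul f g : to_one f -> to_one g -> to_one (fun j t => f j t * g j t).
Proof.
move=> [d [d0 h]] [e [e0 k]]; exists (fun j => d j + e j + d j * e j); split.
  have : (fun j => d j + e j + d j * e j) @ \oo --> (0 + 0 + 0 * 0 : R).
    by apply: cvgD; [exact: cvgD d0 e0|exact: cvgM d0 e0].
  by rewrite mul0r !addr0.
apply: filterS2 h k => j [a ha] [b hb]; eexists.
have r0 := @ler01 R.
apply: expands_ext (expands_add r0 (expands_add r0 ha hb) (expands_mul r0 ha hb)).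
by move=> z _; ring.
Qed.

Lemma to_one_cst (c : nat -> C) : c @ \oo --> (1 : C) -> to_one (fun j _ => c j).
Proof.
move=> hc; exists (fun j => cmod (c j - 1)); split; first exact: cvgC_cmod0.
apply: nearW => j; eexists; exact: expands_cst.
Qed.

Lemma to_one_at0 f : to_one f -> (fun j => f j 0) @ \oo --> (1 : C).
Proof.
move=> [d [d0 h]]; apply: squeezeC d0; apply: filterS h => j [a ha].
by apply: (expands_bound ha); rewrite cmod0 ler01.
Qed.

Lemma geo_psval (w : C) : cmod w < 1 -> psval (fun n => (-1) ^+ n) w = (1 + w)^-1.
Proof.
move=> w1; have w10 : 1 + w != 0.
  rewrite -cmod_gt0 (lt_le_trans _ (cmod_lerD _ _))// cmod1 subr_gt0.
  exact: w1.
have sE n : \sum_(0 <= k < n) (-1) ^+ k * w ^+ k = (1 - (- w) ^+ n) / (1 + w).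
  elim: n => [|n IH]; first by rewrite big_nil expr0 subrr mul0r.
  rewrite big_nat_recr //= IH -exprMn mulN1r [in RHS]exprS.
  by move: ((- w) ^+ n) => x; field.
apply: limC; rewrite /series; under eq_fun do rewrite sE.
have h : (fun n => (1 - (- w) ^+ n) / (1 + w)) @ \oo --> (1 - 0) / (1 + w).
  apply: cvgM; last exact: cvg_cst.
  by apply: cvgB; [exact: cvg_cst|apply: cvgC_geo; rewrite cmodN].
rewrite subr0 mul1r in h; exact: h.
Qed.

Lemma geo_sum1 (x : R) n : 0 <= x -> x <= 2^-1 ->
  \sum_(0 <= k < n) x ^+ k.+1 <= 2 * x.
Proof.
move=> x0 x2; have x1 : x < 1 by lra.
under eq_bigr do rewrite exprS.
rewrite -mulr_sumr mulrC ler_wpM2r// (le_trans (geo_sum n x0 x1))//.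
by rewrite -[leRHS]invrK lef_pV2 ?posrE ?invr_gt0 ?subr_gt0//; lra.
Qed.

(** The geometric series in f - 1, which has norm less than 1/2 eventually. *)
Lemma to_one_inv f : to_one f -> to_one (fun j t => (f j t)^-1).
Proof.
move=> [d [d0 h]]; exists (fun j => 2 * d j); split.
  have : (fun j => 2 * d j) @ \oo --> (2 * 0 : R).
    by apply: cvgM; [exact: cvg_cst|exact: d0].
  by rewrite mulr0.
have h2 : (0 : R) < 2^-1 by rewrite invr_gt0.
have [J hJ] := cvg0_lt d0 h2.
have hd : \forall j \near \oo, d j < 2^-1 by exists J.
apply: filterS2 h hd => j [a ha] dj.
have dj0 : 0 <= d j by have [/(_ 0%N)] := ha; rewrite big_nil.
have [n|b hb] := @expands_comp _ _ _ _ _ (fun n => (-1) ^+ n) (2 * d j) ltr01 ha.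
  under eq_bigr do rewrite cmodX cmodN cmod1 expr1n mul1r.
  by apply: geo_sum1 => //; exact: ltW.
exists b; apply: expands_ext hb => z z1.
rewrite geo_psval ?expr0; first by rewrite [1 + _]addrC subrK.
by rewrite (le_lt_trans (expands_bound ha z1))//; lra.
Qed.

Lemma ecoef_le (q : C) n : cmod q <= 2^-1 -> cmod (ecoef q n) <= (2 * cmod q) ^+ n.
Proof.
move=> q2; have q1 : cmod q < 1 by lra.
elim: n => [|n IH]; first by rewrite cmod1.
apply: le_trans (ecoef_step q1 n) _; rewrite [leRHS]exprS.
apply: ler_pM; rewrite ?cmod_ge0//.
  by rewrite mulr_ge0 ?exprn_ge0 ?cmod_ge0 ?invr_ge0//; lra.
rewrite ler_pdivrMr ?subr_gt0//.
apply: (@le_trans _ _ (cmod q)).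
  by rewrite exprS ler_piMr ?cmod_ge0// exprn_ile1 ?cmod_ge0// ltW.
have := cmod_ge0 q; move: (cmod q) q2 => x; nra.
Qed.

(** The coefficients e_n(q) are at most (2 |q|)^n, so that E(a X) - 1 has norm of
    the order of |q a|, even if a itself is large. *)
Lemma to_one_euler (q a : nat -> C) (c : C) :
  q @ \oo --> (0 : C) -> (fun j => q j * a j) @ \oo --> (0 : C) ->
  to_one (fun j t => eulerE (q j) (a j * cexp (c * t))).
Proof.
move=> hq hqa; pose M := expR (cmod c * 1).
pose d j := 2 * (2 * (cmod (q j * a j) * M)).
exists d; split.
  have := cvgC_cmod hqa; rewrite cmod0 => h.
  have : d @ \oo --> (2 * (2 * (0 * M)) : R).
    apply: cvgM; first exact: cvg_cst.
    by apply: cvgM; [exact: cvg_cst|apply: cvgM; [exact: h|exact: cvg_cst]].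
  by rewrite mul0r !mulr0.
have h2 : (0 : R) < 2^-1 by rewrite invr_gt0.
have hqe : \forall j \near \oo, cmod (q j) <= 2^-1.
  by apply: filterS ((cvgCP _ _).1 hq _ h2) => j; rewrite subr0 => /ltW.
have M0 : 0 < M by exact: expR_gt0.
have h4 : (0 : R) < (4 * M)^-1 by rewrite invr_gt0 mulr_gt0.
have hqae : \forall j \near \oo, 2 * (cmod (q j * a j) * M) <= 2^-1.
  apply: filterS ((cvgCP _ _).1 hqa _ h4) => j; rewrite subr0 => /ltW.
  rewrite -[(4 * M)^-1]mul1r ler_pdivlMr ?mulr_gt0//; lra.
apply: filterS2 hqe hqae => j qj qaj.
have he := expands_scale (a j) (expands_cexp c (@ler01 R)).
have [n|b hb] := @expands_comp _ _ _ _ _ (ecoef (q j)) (d j) ltr01 he.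
  apply: (@le_trans _ _ (\sum_(0 <= k < n) (2 * (cmod (q j * a j) * M)) ^+ k.+1)).
    apply: ler_sum => k _; rewrite (le_trans (ler_wpM2r _ (ecoef_le k.+1 qj)))//.
      by rewrite exprn_ge0// mulr_ge0 ?cmod_ge0 ?expR_ge0.
    by rewrite -exprMn cmodM -/M !mulrA.
  apply: geo_sum1 => //; rewrite mulr_ge0// mulr_ge0 ?cmod_ge0//; exact: ltW.
exists b; apply: expands_ext hb => z _.
by rewrite eulerEE.
Qed.

Lemma to_one_linear (y : nat -> C) (c : C) : y @ \oo --> (0 : C) ->
  to_one (fun j t => 1 - y j * cexp (c * t)).
Proof.
move=> hy; pose M := expR (cmod c * 1); exists (fun j => cmod (- y j) * M); split.
  have : (fun j => cmod (- y j) * M) @ \oo --> (cmod (- 0 : C) * M).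
    apply: cvgM; last exact: cvg_cst.
    by apply: cvgC_cmod; exact: cvgN hy.
  by rewrite oppr0 cmod0 mul0r.
apply: nearW => j; eexists.
apply: expands_ext (expands_scale (- y j) (expands_cexp c (@ler01 R))) => z _.
by rewrite addrAC subrr add0r mulNr.
Qed.

End CloseToOne.

(** * A degenerating family of elliptic functions of level N *)

Section DegenerateFamily.
Variable R : realType.
Local Notation C := (Cplx R).
Variables (eta : C) (N k : nat).
Hypothesis eta0 : eta != 0.
Hypothesis k0 : (0 < k)%N.
Hypothesis kN : (k < N)%N.

Let e20 : 2 * eta != 0. Proof. by rewrite mulf_neq0 ?pnatr_eq0. Qed.
Local Notation om := (twopii R / (2 * eta)).
Local Notation kap := (k%:R / N%:R : R).

Let kap0 : 0 < kap. Proof. by rewrite divr_gt0 ?ltr0n// (ltn_trans k0). Qed.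
Let kap1 : kap < 1.
Proof. by rewrite ltr_pdivrMr ?mul1r ?ltr_nat// ltr0n (ltn_trans k0). Qed.
Let N0 : (N%:R : R) != 0.
Proof. by rewrite pnatr_eq0 -lt0n (ltn_trans k0). Qed.

Lemma om_neq0 : om != 0.
Proof. by rewrite mulf_neq0 ?invr_eq0 ?twopii_neq0. Qed.

(** The lattices have the periods om and i (j+1) om; as j grows, only the period
    om of the limit function survives. *)
Definition height (j : nat) : C := 'i * (j.+1%:R : R)%:C.

Lemma deg_per_free j (a b : R) :
  (a%:C : C) * om + (b%:C : C) * (om * height j) = 0 -> a = 0 /\ b = 0.
Proof.
have -> : (a%:C : C) * om + (b%:C : C) * (om * height j) =
  om * ((a%:C : C) + (b%:C : C) * height j) by ring.
move=> /eqP; rewrite mulf_eq0 (negPf om_neq0) /= /height; simpc.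
rewrite eq_complex /= => /andP[/eqP a0 /eqP b0]; split; first lra.
by apply/eqP; move/eqP: b0; rewrite ?addr0 ?add0r mulf_eq0 pnatr_eq0 orbF.
Qed.

Definition deg_lattice j : lattice R := Lattice (@deg_per_free j).

Lemma deg_per_up j : per_up (deg_lattice j) = om * height j.
Proof.
rewrite /per_up /= [om * height j]mulrC mulfK ?om_neq0// /height.
by simpc; rewrite /= ltr0n mulrC.
Qed.

Lemma deg_cperiod j : cperiod (deg_lattice j) = 2 * eta.
Proof. by rewrite /cperiod /= invf_div mulrC divfK ?twopii_neq0. Qed.

(** The value decay x ^+ j.+1 is e^(2 pi i x tau) for tau = i (j+1). *)
Definition decay (x : R) : C := cexp (- (x * pi *+ 2)%:C).

Lemma cexp_height (x : R) j : cexp (twopii R * (x%:C * height j)) = decay x ^+ j.+1.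
Proof.
rewrite /decay -cexpMn; congr cexp; rewrite /twopii /height.
have -> : 'i * (pi *+ 2)%:C * (x%:C * ('i * j.+1%:R%:C)) =
  ('i : C) ^+ 2 * ((pi *+ 2)%:C * x%:C * j.+1%:R%:C) by ring.
rewrite sqr_i mulN1r -[RHS]mulr_natr mulNr -real_complex_nat; congr (- _).
by rewrite -!rmorphM; congr (_%:C); ring.
Qed.

Lemma cmod_decay x : 0 < x -> cmod (decay x) < 1.
Proof. by move=> x0; apply: cmod_cexpN_lt1; rewrite /= mulrn_wgt0// mulr_gt0 ?pi_gt0. Qed.

Lemma decay_cvg x : 0 < x -> (fun j => decay x ^+ j.+1) @ \oo --> (0 : C).
Proof.
by move=> x0; rewrite (cvg_shiftS (fun j => decay x ^+ j)); exact/cvgC_geo/cmod_decay.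
Qed.

Lemma decayD x y j : decay (x + y) ^+ j.+1 = decay x ^+ j.+1 * decay y ^+ j.+1.
Proof. by rewrite -exprMn /decay -cexpD mulrDl mulrnDl rmorphD opprD. Qed.

Lemma deg_nome j : nome (deg_lattice j) = decay 1 ^+ j.+1.
Proof.
rewrite /nome deg_cperiod deg_per_up mulrA [2 * eta * om]mulrC divfK//.
by rewrite -cexp_height mul1r.
Qed.

(** The fraction k/N of the long period: a division point of order dividing N,
    which goes to infinity with j. *)
Definition deg_pole j : C := om * (kap%:C * height j).

Lemma deg_pole_exp j : cexp (2 * eta * deg_pole j) = decay kap ^+ j.+1.
Proof. by rewrite -cexp_height mulrA [2 * eta * om]mulrC divfK. Qed.

(** The coefficient of the exponential makes the multipliers of both periods
    N-th roots of unity, and the second one equal to 1. *)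
Definition deg_fun j : C -> C :=
  sigma_quot (thetaS (deg_lattice j)) (deg_pole j) (2 * eta * (kap%:C - 1)).

Lemma deg_pole_notin j : ~ lattice_set (deg_lattice j) (deg_pole j).
Proof.
move=> /lattice_setP[m [n]]; rewrite deg_per_up /deg_pole /=.
have -> : om *~ m + om * height j *~ n = om * (m%:~R + height j * n%:~R).
  by rewrite -[om *~ m]mulrzr -[om * height j *~ n]mulrzr; ring.
move=> /(mulfI om_neq0).
rewrite /height -!(rmorph_int (real_complex R)); simpc.
move=> [_ /eqP]; rewrite ?addr0 ?add0r mulrC => /eqP.
have j0 : (j.+1%:R : R) != 0 by rewrite pnatr_eq0.
move=> /(mulfI j0) kn; have := kap0; have := kap1; rewrite kn.
by rewrite ltr0z ltrz1; lia.
Qed.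

Lemma deg_level j : is_elliptic_level_on (deg_lattice j) N (deg_fun j).
Proof.
have NN : (N%:R : C) != 0 by rewrite pnatr_eq0 -lt0n (ltn_trans k0).
have kC : (kap%:C : C) = k%:R / N%:R.
  by rewrite rmorphM fmorphV !rmorph_nat.
apply: sigma_quot_level; [exact: thetaS_sigma_like|exact: deg_pole_notin| |].
  apply/lattice_setP; exists 0, k%:Z; rewrite deg_per_up mulr0z add0r -pmulrn.
  rewrite /deg_pole kC -[RHS]mulr_natr -[LHS]mulr_natr.
  by move: (height j) om => h o; field.
apply: power_periodic => z.
  rewrite /deg_fun sigma_quot_per1 exprMn -cexpMn /=.
  have -> : (2 * eta * (kap%:C - 1) * om) *+ N = twopii R *~ (k%:Z - N%:Z).
    rewrite kC mulrzBr -!pmulrn -[LHS]mulr_natr.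
    rewrite -(mulr_natr (twopii R) k) -(mulr_natr (twopii R) N).
    by field; rewrite NN eta0.
  by rewrite cexp_kernelE mul1r.
rewrite /deg_fun sigma_quot_per_up deg_cperiod deg_per_up /deg_pole.
have -> : (2 * eta * (kap%:C - 1) + 2 * eta) * (om * height j) -
   2 * eta * (om * (kap%:C * height j)) = 0 by ring.
by rewrite cexp0 mul1r.
Qed.

Definition deg_limit (t : C) : C :=
  cexp (2 * eta * (kap%:C - 1) * t) * (cexp (2 * eta * t) - 1) / (2 * eta).

Local Notation q j := (decay 1 ^+ j.+1).
Local Notation y j := (decay kap ^+ j.+1).
Local Notation y' j := (decay (1 - kap) ^+ j.+1).

Lemma decay_neq0 x j : decay x ^+ j.+1 != 0.
Proof. by rewrite expf_neq0 ?cexp_neq0. Qed.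

(** In the quotient of deg_fun j by its limit, the theta functions contribute
    Euler products in multiples of X = e^(2 eta t) and of 1/X, which become small
    when multiplied by q: even for the large factor 1/y, where
    q/y = decay (1 - kap) ^+ j.+1. *)
Definition deg_factor j (t : C) : C :=
  eulerE (q j) (cexp (2 * eta * t)) * eulerE (q j) (cexp (- (2 * eta) * t)) *
  (eulerE (q j) 1)^-1 * (eulerE (q j) 1)^-1 *
  ((1 - y j) * eulerE (q j) (y j) * eulerE (q j) (y j)^-1) *
  ((1 - y j * cexp (- (2 * eta) * t)) * eulerE (q j) (y j * cexp (- (2 * eta) * t)) *
   eulerE (q j) ((y j)^-1 * cexp (2 * eta * t)))^-1.

Lemma deg_funE j t : deg_fun j t = deg_limit t * deg_factor j t.
Proof.
have q1 : cmod (q j) < 1 by rewrite -deg_nome cmod_nome.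
have E1 := eulerE1_neq0 q1.
rewrite /deg_fun /sigma_quot !thetaSE deg_cperiod deg_nome (mulrBr _ (deg_pole j)) cexpB deg_pole_exp.
rewrite /theta /deg_limit /deg_factor [- (2 * eta) * t]mulNr cexpN.
move: (cexp_neq0 (2 * eta * t)) (decay_neq0 kap j).
move: (cexp (2 * eta * t)) (cexp (2 * eta * (kap%:C - 1) * t)) => X z X0.
move: (decay kap ^+ j.+1) => y y0.
have -> : (y / X)^-1 = y^-1 * X by rewrite invf_div mulrC.
move: (eulerE (q j) 1) E1 (eulerE (q j) X) (eulerE (q j) X^-1) (eulerE (q j) y)
  (eulerE (q j) y^-1) (eulerE (q j) (y / X)) (eulerE (q j) (y^-1 * X)) => e e0 a b u v g h.
have -> : ((1 - y / X) * g * h / (- (2 * eta) * e ^+ 2))^-1 =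
  - (2 * eta) * e ^+ 2 * ((1 - y / X) * g * h)^-1 by rewrite invf_div.
by move: ((1 - y / X) * g * h)^-1 => w; field; rewrite ?e0 ?eta0.
Qed.

Lemma deg_factor_to_one : to_one deg_factor.
Proof.
have hq : (fun j => q j) @ \oo --> (0 : C) by apply: decay_cvg; exact: ltr01.
have hy : (fun j => y j) @ \oo --> (0 : C) by apply: decay_cvg; exact: kap0.
have hy' : (fun j => y' j) @ \oo --> (0 : C) by apply: decay_cvg; rewrite subr_gt0.
have qyE j : q j * (y j)^-1 = y' j.
  have -> : q j = y j * y' j by rewrite -decayD addrC subrK.
  by rewrite mulrC mulKf ?decay_neq0.
have hqy : (fun j => q j * (y j)^-1) @ \oo --> (0 : C).
  by under eq_fun do rewrite qyE.
have hq1 : (fun j => q j * 1) @ \oo --> (0 : C).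
  by under eq_fun do rewrite mulr1.
have hqy2 : (fun j => q j * y j) @ \oo --> (0 : C).
  have : (fun j => q j * y j) @ \oo --> (0 * 0 : C) by exact: cvgM hq hy.
  by rewrite mul0r.
have eX (c : C) : to_one (fun j t => eulerE (q j) (cexp (c * t))).
  apply: to_one_ext (to_one_euler c hq hq1); apply: nearW => j t _.
  by rewrite mul1r.
have c1 : (fun j => eulerE (q j) 1) @ \oo --> (1 : C).
  have <- : (fun j => eulerE (q j) (cexp (0 * 0))) = (fun j => eulerE (q j) 1).
    by apply/funext => j; rewrite mulr0 cexp0.
  exact: to_one_at0 (eX 0).
have cV : (fun j => (eulerE (q j) 1)^-1) @ \oo --> (1 : C).
  rewrite -[X in _ --> X]invr1; apply: cvgV; [exact: oner_neq0|exact: c1].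
have ey := to_one_euler (2 * eta) hq hqy.
have ey2 := to_one_euler (- (2 * eta)) hq hqy2.
have c2 : (fun j => eulerE (q j) (y j)) @ \oo --> (1 : C).
  have <- : (fun j => eulerE (q j) (y j * cexp (- (2 * eta) * 0))) =
      (fun j => eulerE (q j) (y j)).
    by apply/funext => j; rewrite mulr0 cexp0 mulr1.
  exact: to_one_at0 ey2.
have c3 : (fun j => eulerE (q j) (y j)^-1) @ \oo --> (1 : C).
  have <- : (fun j => eulerE (q j) ((y j)^-1 * cexp (2 * eta * 0))) =
      (fun j => eulerE (q j) (y j)^-1).
    by apply/funext => j; rewrite mulr0 cexp0 mulr1.
  exact: to_one_at0 ey.
have c4 : (fun j => 1 - y j) @ \oo --> (1 : C).
  have : (fun j => 1 - y j) @ \oo --> (1 - 0 : C) by exact: cvgB (cvg_cst _) hy.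
  by rewrite subr0.
have c5 : (fun j => (1 - y j) * eulerE (q j) (y j) * eulerE (q j) (y j)^-1) @ \oo --> (1 : C).
  have : (fun j => (1 - y j) * eulerE (q j) (y j) * eulerE (q j) (y j)^-1)
    @ \oo --> (1 * 1 * 1 : C) by exact: cvgM (cvgM c4 c2) c3.
  by rewrite !mul1r.
have den := to_one_inv (to_one_mul (to_one_mul (to_one_linear (- (2 * eta)) hy) ey2) ey).
have cVt := to_one_cst cV.
have num := to_one_mul (to_one_mul (to_one_mul (to_one_mul (eX (2 * eta))
  (eX (- (2 * eta)))) cVt) cVt) (to_one_cst c5).
exact: to_one_mul num den.
Qed.

End DegenerateFamily.

(** * The values zeta(4) and zeta(6) *)

Section ZetaEven.
Variable R : realType.

Lemma sin_lt_id (x : R) : 0 < x -> sin x <= x.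
Proof.
move=> x0.
have [c _] := @MVT R sin cos 0 x x0 (fun c _ => is_derive_sin c)
  (continuous_subspaceT (@continuous_sin R)).
by rewrite sin0 !subr0 => ->; rewrite ler_piMl ?cos_le1// ltW.
Qed.

Lemma tan_gt_id (x : R) : 0 < x -> x < pi / 2 -> x <= tan x.
Proof.
move=> x0 xp.
have c0 c : 0 <= c <= x -> cos c != 0.
  move=> /andP[c0 cx]; rewrite gt_eqF// cos_gt0_pihalf// (le_lt_trans cx xp).
  by rewrite (lt_le_trans _ c0)// oppr_lt0 divr_gt0 ?pi_gt0.
have [||c] := @MVT R tan (fun c => (cos c) ^- 2) 0 x x0.
- by move=> c /andP[/ltW c1 /ltW c2]; apply: is_derive_tan; apply: c0; rewrite c1.
- apply: derivable_within_continuous => c; rewrite in_itv /= => cx.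
  by apply: derivable_tan; exact: c0.
rewrite in_itv /= => /andP[/ltW c1 /ltW c2]; rewrite tan0 !subr0 => ->.
rewrite ler_peMl ?(ltW x0)// cos2_tan2 ?lerDl ?sqr_ge0//.
by apply: c0; rewrite c1.
Qed.

Definition node (p j : nat) : R := pi * (j.*2.+1)%:R / 2 ^+ p.+2.

Lemma expn2E (p : nat) : ((2 ^ p)%N%:R : R) = 2 ^+ p.
Proof. by rewrite natrX. Qed.

Lemma node_range p j : (j < 2 ^ p)%N -> 0 < node p j < pi / 2.
Proof.
move=> jp; rewrite /node; have p0 := @pi_gt0 R.
have h2 : (0 : R) < 2 ^+ p.+2 by rewrite exprn_gt0.
apply/andP; split; first by apply: divr_gt0 => //; apply: mulr_gt0; rewrite ?ltr0n.
rewrite ltr_pdivrMr// -mulrA ltr_pM2l//.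
have -> : (2 : R)^-1 * 2 ^+ p.+2 = (2 ^ p.+1)%N%:R by rewrite expn2E exprS; field.
by rewrite ltr_nat expnS mul2n -doubleS leq_double.
Qed.

Lemma node_half p j : node p.+1 j = node p j / 2.
Proof.
rewrite /node [2 ^+ p.+3]exprS; have : (2 : R) ^+ p.+2 != 0 by rewrite expf_neq0.
by move=> h; field.
Qed.

Lemma node_refl p j : (j < 2 ^ p)%N ->
  node p.+1 (2 ^ p - j.+1 + 2 ^ p) = pi / 2 - node p j / 2.
Proof.
move=> jp; rewrite -node_half /node.
have e : ((2 ^ p - j.+1 + 2 ^ p).*2.+1 + j.*2.+1 = 2 ^ p.+2)%N.
  by rewrite !expnS; lia.
have -> : ((2 ^ p - j.+1 + 2 ^ p).*2.+1%:R : R) = 2 ^+ p.+2 - j.*2.+1%:R.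
  by rewrite -expn2E -e natrD addrK.
rewrite [2 ^+ p.+3]exprS; have : (2 : R) ^+ p.+2 != 0 by rewrite expf_neq0.
by move=> h; field.
Qed.

Definition csc2 (x : R) : R := (sin x ^+ 2)^-1.

(** The power sums of csc^2 over the odd multiples of pi / 2^(p+2) below pi/2. The
    duplication formula csc^2(x/2) + sec^2(x/2) = 4 csc^2 x = csc^2(x/2) sec^2(x/2)
    turns them into recursive sequences in p; comparing csc^2 x with 1/x^2 then
    gives the sums of 1/m^4 and 1/m^6 over odd m. *)
Definition csum (r p : nat) : R := \sum_(0 <= j < 2 ^ p) csc2 (node p j) ^+ r.

Lemma csumS r p : csum r p.+1 =
  \sum_(0 <= j < 2 ^ p) (csc2 (node p j / 2) ^+ r + (cos (node p j / 2) ^+ 2)^-1 ^+ r).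
Proof.
rewrite /csum expnS mul2n -addnn (@big_cat_nat _ _ _ (2 ^ p)) //= ?leq_addr//.
rewrite big_split /=; congr (_ + _).
  by apply: eq_bigr => j _; rewrite node_half.
rewrite -{1}[(2 ^ p)%N]add0n big_addn addnK big_nat_rev /=.
rewrite big_nat [RHS]big_nat; apply: eq_bigr => j /andP[_ jp].
rewrite add0n node_refl// /csc2; congr (_ ^- _ ^+ _).
by rewrite sinB sin_pihalf cos_pihalf mul1r mul0r subr0.
Qed.

Lemma csc2_half (x : R) : 0 < x < pi / 2 ->
  let a := csc2 (x / 2) in let b := (cos (x / 2) ^+ 2)^-1 in let y := csc2 x in
  [/\ a + b = 4 * y, a ^+ 2 + b ^+ 2 = 16 * y ^+ 2 - 8 * y &
      a ^+ 3 + b ^+ 3 = 64 * y ^+ 3 - 48 * y ^+ 2].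
Proof.
move=> /andP[x0 xp] /=; have p0 := @pi_gt0 R.
have s0 : sin (x / 2) != 0.
  by rewrite gt_eqF// sin_gt0_pihalf// divr_gt0//=; lra.
have c0 : cos (x / 2) != 0.
  by rewrite gt_eqF// cos_gt0_pihalf//; apply/andP; split; lra.
have -> : csc2 x = (4 * sin (x / 2) ^+ 2 * cos (x / 2) ^+ 2)^-1.
  rewrite /csc2 {1}(_ : x = (x / 2) *+ 2); last by rewrite -mulr_natr; field.
  by rewrite sin_mulr2n -mulr_natl; congr (_^-1); ring.
rewrite /csc2; have := cos2Dsin2 (x / 2).
move: (sin (x / 2)) (cos (x / 2)) s0 c0 => s c s0 c0 h.
have e : c ^+ 2 = 1 - s ^+ 2 by rewrite -h addrK.
have c20 : 1 - s ^+ 2 != 0 by rewrite -e expf_neq0.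
by rewrite e; split; field; rewrite ?c20 ?s0.
Qed.

Lemma csum_rec p : [/\ csum 1 p.+1 = 4 * csum 1 p,
  csum 2 p.+1 = 16 * csum 2 p - 8 * csum 1 p &
  csum 3 p.+1 = 64 * csum 3 p - 48 * csum 2 p].
Proof.
rewrite !csumS /csum !mulr_sumr -!sumrB; split; rewrite big_nat [RHS]big_nat;
  apply: eq_bigr => j /andP[_ /node_range/csc2_half[h1 h2 h3]];
  by rewrite ?expr1.
Qed.

Lemma csum_closed p : [/\ csum 1 p = 2 * 4 ^+ p,
  csum 2 p = (8 * 16 ^+ p + 4 * 4 ^+ p) / 3 &
  csum 3 p = (64 * 64 ^+ p + 40 * 16 ^+ p + 16 * 4 ^+ p) / 15].
Proof.
elim: p => [|p [h1 h2 h3]].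
  have c : csc2 (node 0 0) = 2.
    have e : node 0 0 *+ 2 = pi / 2 by rewrite /node [2 ^+ _]expr2 -[LHS]mulr_natr double0; field.
    have := cos_mulr2n (node 0 0); rewrite e cos_pihalf => h.
    have {}h : cos (node 0 0) ^+ 2 = 2^-1 by rewrite -mulr_natl in h; lra.
    by rewrite /csc2 sin2cos2 h; field.
  by rewrite /csum expn0 !big_nat1 c !expr0; split; field.
have [-> -> ->] := csum_rec p; rewrite h1 h2 h3 !exprS; split; field => //.
Qed.

Definition oddsum (r M : nat) : R := \sum_(0 <= j < M) (j.*2.+1%:R ^+ r)^-1.

Lemma inv_node_sq p j : (node p j ^+ 2)^-1 =
  (4 / pi) ^+ 2 * 4 ^+ p * (j.*2.+1%:R ^+ 2)^-1.
Proof.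
rewrite /node (_ : (2 : R) ^+ p.+2 = 4 * 2 ^+ p); last by rewrite !exprS; ring.
have -> : (4 : R) ^+ p = (2 ^+ p) ^+ 2 by rewrite -exprM mulnC exprM; congr (_ ^+ _); ring.
have h : (2 : R) ^+ p != 0 by rewrite expf_neq0.
have h1 : (j.*2.+1%:R : R) != 0 by rewrite pnatr_eq0.
have h2 : (pi : R) != 0 by rewrite gt_eqF ?pi_gt0.
by move: (2 ^+ p) (j.*2.+1%:R) (pi) h h1 h2 => x y z x0 y0 z0; field; rewrite x0 y0 z0.
Qed.

Lemma csc2_bounds (x : R) : 0 < x < pi / 2 ->
  (x ^+ 2)^-1 <= csc2 x <= (x ^+ 2)^-1 + 1.
Proof.
move=> /andP[x0 xp]; have s0 : 0 < sin x by rewrite sin_gt0_pihalf ?x0.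
have c0 : 0 < cos x.
  by rewrite cos_gt0_pihalf// xp andbT (lt_trans _ x0)// oppr_lt0 divr_gt0 ?pi_gt0.
apply/andP; split.
  rewrite /csc2 lef_pV2 ?posrE ?exprn_gt0//.
  by rewrite lerXn2r ?nnegrE ?(ltW s0) ?(ltW x0)// sin_lt_id.
have -> : csc2 x = (tan x ^+ 2)^-1 + 1.
  rewrite /csc2 /tan; have := cos2Dsin2 x; move: (sin x) (cos x) s0 c0 => s c s0 c0 h.
  have e : c ^+ 2 = 1 - s ^+ 2 by rewrite -h addrK.
  rewrite expr_div_n invf_div e; field; exact: lt0r_neq0.
have t0 : 0 < tan x by rewrite /tan divr_gt0.
rewrite lerD2r lef_pV2 ?posrE ?exprn_gt0//.
by rewrite lerXn2r ?nnegrE ?(ltW t0) ?(ltW x0)// tan_gt_id.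
Qed.

Lemma pow_bounds (v y : R) : 0 <= v -> v <= y <= v + 1 ->
  [/\ v ^+ 2 <= y ^+ 2 <= v ^+ 2 + 2 * y + 1 &
      v ^+ 3 <= y ^+ 3 <= v ^+ 3 + 3 * y ^+ 2 + 3 * y + 1].
Proof.
move=> v0 /andP[vy yv]; split; apply/andP; split.
- by rewrite lerXn2r// ?nnegrE (le_trans v0).
- nra.
- by rewrite lerXn2r// ?nnegrE (le_trans v0).
- have [d dE] : exists d, d = y - v by eexists.
  have d0 : 0 <= d by rewrite dE subr_ge0.
  have d1 : d <= 1 by rewrite dE; lra.
  have -> : v = y - d by rewrite dE; ring.
  have y0 : 0 <= y by exact: le_trans vy.
  have : 0 <= 3 * y ^+ 2 * (1 - d) + 3 * y * (1 + d ^+ 2) + (1 - d ^+ 3).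
    have a1 : 0 <= 1 - d by rewrite subr_ge0.
    have a2 : 0 <= 1 + d ^+ 2 by rewrite addr_ge0 ?sqr_ge0.
    have a3 : 0 <= 1 - d ^+ 3 by rewrite subr_ge0 exprn_ile1.
    apply: addr_ge0 => //; apply: addr_ge0; apply: mulr_ge0 => //.
      by rewrite mulr_ge0 ?sqr_ge0.
    by rewrite mulr_ge0.
  lra.
Qed.

(** As 1/x^2 <= csc^2 x <= 1/x^2 + 1, the r-th power sums of csc^2 x and 1/x^2
    differ by power sums of lower order, which grow more slowly by a factor 4^p. *)
Lemma oddsum_sandwich p : let K : R := 4 / pi in
  [/\ 0 <= csum 2 p - K ^+ 4 * 16 ^+ p * oddsum 4 (2 ^ p) <= 5 * 4 ^+ p &
      0 <= csum 3 p - K ^+ 6 * 64 ^+ p * oddsum 6 (2 ^ p) <= 19 * 16 ^+ p].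
Proof.
move=> K; pose v j := (node p j ^+ 2)^-1.
have v0 j : 0 <= v j by rewrite invr_ge0 sqr_ge0.
have V2 : \sum_(0 <= j < 2 ^ p) v j ^+ 2 = K ^+ 4 * 16 ^+ p * oddsum 4 (2 ^ p).
  rewrite /oddsum mulr_sumr; apply: eq_bigr => j _.
  rewrite /v inv_node_sq -/K -exprVn -[in RHS]exprVn !exprMn -!exprM.
  have -> : (4 : R) ^+ (p * 2) = 16 ^+ p.
    by rewrite mulnC exprM; congr (_ ^+ _); ring.
  ring.
have V3 : \sum_(0 <= j < 2 ^ p) v j ^+ 3 = K ^+ 6 * 64 ^+ p * oddsum 6 (2 ^ p).
  rewrite /oddsum mulr_sumr; apply: eq_bigr => j _.
  rewrite /v inv_node_sq -/K -exprVn -[in RHS]exprVn !exprMn -!exprM.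
  have -> : (4 : R) ^+ (p * 3) = 64 ^+ p.
    by rewrite mulnC exprM; congr (_ ^+ _); ring.
  ring.
have b j : (j < 2 ^ p)%N -> [/\ v j ^+ 2 <= csc2 (node p j) ^+ 2 <=
     v j ^+ 2 + 2 * csc2 (node p j) + 1 &
     v j ^+ 3 <= csc2 (node p j) ^+ 3 <= v j ^+ 3 + 3 * csc2 (node p j) ^+ 2 +
       3 * csc2 (node p j) + 1].
  by move=> /node_range/csc2_bounds h; exact: (pow_bounds (v0 j) h).
have [c1 c2 c3] := csum_closed p.
have s1 : \sum_(0 <= j < 2 ^ p) csc2 (node p j) = csum 1 p.
  by apply: eq_bigr => j _; rewrite expr1.
have card1 : \sum_(0 <= j < 2 ^ p) (1 : R) = 2 ^+ p.
  by rewrite sumr_const_nat subn0 -expn2E.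
have le24 : (2 : R) ^+ p <= 4 ^+ p by rewrite lerXn2r ?nnegrE//; lra.
have le416 : (4 : R) ^+ p <= 16 ^+ p by rewrite lerXn2r ?nnegrE//; lra.
rewrite -V2 -V3 -!sumrB; split; apply/andP; split.
- rewrite big_nat sumr_ge0// => j /andP[_ /b[/andP[h _] _]].
  by rewrite subr_ge0.
- apply: (@le_trans _ _ (\sum_(0 <= j < 2 ^ p) (2 * csc2 (node p j) + 1))).
    rewrite big_nat [leRHS]big_nat; apply: ler_sum => j /andP[_ /b[/andP[_ h] _]].
    by rewrite lerBlDl addrA.
  rewrite big_split /= -mulr_sumr s1 card1 c1; lra.
- rewrite big_nat sumr_ge0// => j /andP[_ /b[_ /andP[h _]]].
  by rewrite subr_ge0.
- apply: (@le_trans _ _ (\sum_(0 <= j < 2 ^ p) (3 * csc2 (node p j) ^+ 2 + 3 * csc2 (node p j) + 1))).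
    rewrite big_nat [leRHS]big_nat; apply: ler_sum => j /andP[_ /b[_ /andP[_ h]]].
    by rewrite lerBlDl !addrA.
  rewrite !big_split /= -!mulr_sumr s1 card1 -/(csum 2 p) c1 c2; lra.
Qed.

Lemma geo4_cvg (c : R) : (fun p => c * (4^-1) ^+ p) @ \oo --> (0 : R).
Proof.
rewrite -(mulr0 c); apply: cvgM; first exact: cvg_cst.
by apply: cvg_expr; rewrite ger0_norm ?invr_ge0//; lra.
Qed.

Lemma squeezeR (u : nat -> R) (l : R) (e : nat -> R) :
  (forall n, `|u n - l| <= e n) -> e @ \oo --> (0 : R) -> u @ \oo --> l.
Proof.
move=> h he; apply/cvgrPdist_lt => d d0.
have [N hN] := cvg0_lt he d0; exists N => // n /= Nn.
by rewrite distrC (le_lt_trans (h n))// hN.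
Qed.

Lemma oddsum4_cvg : (fun p => oddsum 4 (2 ^ p)%N) @ \oo --> (pi ^+ 4 / 96 : R).
Proof.
have p0 : (0 : R) < pi by exact: pi_gt0.
pose K : R := 4 / pi; have K0 : 0 < K by rewrite divr_gt0.
apply: (@squeezeR _ _ (fun p => 7 / K ^+ 4 * (4^-1) ^+ p)); last exact: geo4_cvg.
move=> p; have [/andP[h1 h2] _] := oddsum_sandwich p; rewrite -/K in h1 h2.
have [_ c2 _] := csum_closed p; rewrite c2 in h1 h2.
have x0 : (0 : R) < 4 ^+ p by rewrite exprn_gt0.
have E16 : (16 : R) ^+ p = (4 ^+ p) ^+ 2.
  by rewrite -exprM mulnC exprM; congr (_ ^+ _); ring.
have -> : (pi : R) ^+ 4 / 96 = 8 / 3 / K ^+ 4.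
  rewrite /K; have : (pi : R) != 0 by rewrite gt_eqF.
  by move: (pi) => a a0; field.
rewrite exprVn; move: (oddsum 4 (2 ^ p)) h1 h2 => o; rewrite E16.
have K40 : 0 < K ^+ 4 by rewrite exprn_gt0.
move: (4 ^+ p) x0 (K ^+ 4) K40 => x x0 k k0 h1 h2.
have D : o - 8 / 3 / k = (o * k * x ^+ 2 - 8 / 3 * x ^+ 2) / (k * x ^+ 2).
  by field; rewrite !gt_eqF.
have -> : 7 / k / x = (7 * x) / (k * x ^+ 2) by field; rewrite !gt_eqF.
have kx : 0 < k * x ^+ 2 by rewrite mulr_gt0 ?exprn_gt0.
rewrite D normrM normfV (gtr0_norm kx) ler_pM2r ?invr_gt0//.
by rewrite ler_norml; apply/andP; split; lra.
Qed.

Lemma oddsum6_cvg : (fun p => oddsum 6 (2 ^ p)%N) @ \oo --> (pi ^+ 6 / 960 : R).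
Proof.
have p0 : (0 : R) < pi by exact: pi_gt0.
pose K : R := 4 / pi; have K0 : 0 < K by rewrite divr_gt0.
apply: (@squeezeR _ _ (fun p => 24 / K ^+ 6 * (4^-1) ^+ p)); last exact: geo4_cvg.
move=> p; have [_ /andP[h1 h2]] := oddsum_sandwich p; rewrite -/K in h1 h2.
have [_ _ c3] := csum_closed p; rewrite c3 in h1 h2.
have x1 : (1 : R) <= 4 ^+ p by rewrite exprn_ege1//; lra.
have E16 : (16 : R) ^+ p = (4 ^+ p) ^+ 2.
  by rewrite -exprM mulnC exprM; congr (_ ^+ _); ring.
have E64 : (64 : R) ^+ p = (4 ^+ p) ^+ 3.
  by rewrite -exprM mulnC exprM; congr (_ ^+ _); ring.
have -> : (pi : R) ^+ 6 / 960 = 64 / 15 / K ^+ 6.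
  rewrite /K; have : (pi : R) != 0 by rewrite gt_eqF.
  by move: (pi) => a a0; field.
rewrite exprVn; move: (oddsum 6 (2 ^ p)) h1 h2 => o; rewrite E16 E64.
have K60 : 0 < K ^+ 6 by rewrite exprn_gt0.
move: (4 ^+ p) x1 (K ^+ 6) K60 => x x1 k k0 h1 h2.
have x0 : 0 < x by exact: lt_le_trans x1.
have D : o - 64 / 15 / k = (o * k * x ^+ 3 - 64 / 15 * x ^+ 3) / (k * x ^+ 3).
  by field; rewrite !gt_eqF.
have -> : 24 / k / x = (24 * x ^+ 2) / (k * x ^+ 3) by field; rewrite !gt_eqF.
have kx : 0 < k * x ^+ 3 by rewrite mulr_gt0 ?exprn_gt0.
have xx : x <= x ^+ 2 by rewrite expr2 ler_peMr// ltW.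
have x20 : 0 <= x ^+ 2 by rewrite sqr_ge0.
rewrite D normrM normfV (gtr0_norm kx) ler_pM2r ?invr_gt0//.
by rewrite ler_norml; apply/andP; split; lra.
Qed.

Definition zsum (r M : nat) : R := \sum_(0 <= m < M) (m.+1%:R ^+ r)^-1.

Lemma zsum_double r M : zsum r M.*2 = oddsum r M + (2 ^+ r)^-1 * zsum r M.
Proof.
elim: M => [|M IH]; first by rewrite /zsum /oddsum !big_nil mulr0 addr0.
rewrite /zsum /oddsum doubleS !big_nat_recr //= -/(zsum r M.*2) IH /oddsum /zsum.
rewrite mulrDr -invfM -exprMn.
have -> : (2 * M.+1%:R : R) = M.*2.+2%:R by rewrite -natrM mul2n doubleS.
ring.
Qed.

Lemma zsum_le2 r n : (2 <= r)%N -> zsum r n <= 2.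
Proof.
move=> r2; apply: (@le_trans _ _ (2 - (n%:R)^-1)); last first.
  by rewrite gerBl invr_ge0.
have h1 m : (m.+1%:R ^+ r : R)^-1 <= (m.+1%:R ^+ 2)^-1.
  have x0 : (0 : R) < m.+1%:R by rewrite ltr0n.
  rewrite lef_pV2 ?posrE ?exprn_gt0//.
  by rewrite -(subnK r2) exprD ler_peMl ?sqr_ge0// exprn_ege1// ler1n.
elim: n => [|[|n] IH]; first by rewrite /zsum big_nil invr0; lra.
  by rewrite /zsum big_nat1 expr1n invr1; lra.
rewrite /zsum big_nat_recr //= -/(zsum r n.+1).
have x0 : (0 : R) < n.+1%:R by rewrite ltr0n.
have y0 : (0 : R) < n.+2%:R by rewrite ltr0n.
apply: le_trans (lerD IH (h1 n.+1)) _.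
rewrite -addrA lerD2l lerNr opprD opprK -(natr1 n.+1) in y0 *.
move: (n.+1%:R) x0 y0 => x x0 y0.
rewrite -subr_ge0.
have -> : x^-1 - (x + 1) ^- 2 - (x + 1)^-1 = (x * (x + 1) ^+ 2)^-1.
  by field; rewrite !gt_eqF.
by rewrite invr_ge0 mulr_ge0 ?sqr_ge0 ?(ltW x0).
Qed.

(** The relation between zeta(4) and zeta(6) that makes the discriminant of a
    degenerating lattice vanish in the limit. *)
Lemma zeta46 : exists z4 z6 : R, [/\ zsum 4 @ \oo --> z4, zsum 6 @ \oo --> z6 &
  (120 * z4) ^+ 3 = 27 * (280 * z6) ^+ 2].
Proof.
have cv r : (2 <= r)%N -> exists z : R, zsum r @ \oo --> z.
  move=> r2.
  have [|n|T [_ _ hT]] := @bounded_series R (fun m => (m.+1%:R ^+ r)^-1) 2.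
  - by move=> k; rewrite invr_ge0 exprn_ge0.
  - exact: zsum_le2.
  exists T; apply: (@squeezeR _ _ (fun n => `|T - zsum r n|)).
    by move=> n; rewrite distrC.
  rewrite -(normr0 R); exact: cvg_norm hT.
have sub (u : nat -> R) (l : R) (phi : nat -> nat) : (forall p, (p <= phi p)%N) ->
    u @ \oo --> l -> (fun p => u (phi p)) @ \oo --> l.
  move=> hphi /cvgrPdist_lt hu; apply/cvgrPdist_lt => e e0.
  have [M _ hM] := hu e e0; exists M => // p /= Mp.
  by apply: hM => /=; exact: leq_trans Mp (hphi p).
have p2 p : (p <= 2 ^ p)%N by rewrite ltnW// ltn_expl.
have p22 p : (p <= (2 ^ p).*2)%N by rewrite (leq_trans (p2 p))// -addnn leq_addr.
have [z4 h4] := cv 4%N isT; have [z6 h6] := cv 6%N isT.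
have lim2 r (z o : R) : zsum r @ \oo --> z -> (fun p => oddsum r (2 ^ p)%N) @ \oo --> o ->
    z = o + (2 ^+ r)^-1 * z.
  move=> hz ho.
  have e1 := sub _ _ _ p22 hz.
  have e2 : (fun p => zsum r (2 ^ p).*2) @ \oo --> o + (2 ^+ r)^-1 * z.
    under eq_fun do rewrite zsum_double.
    by apply: cvgD; [exact: ho|apply: cvgM; [exact: cvg_cst|exact: sub p2 hz]].
  by apply: (cvg_unique _ e1 e2); exact: Rhausdorff.
have e4 := lim2 _ _ _ h4 oddsum4_cvg; have e6 := lim2 _ _ _ h6 oddsum6_cvg.
exists z4, z6; split; [exact: h4|exact: h6|].
(* The even terms of zeta(r) are 2^-r zeta(r), which leaves the sum over odd m. *)
have -> : z4 = pi ^+ 4 / 90.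
  have E : (2 ^+ 4 : R)^-1 = 1 / 16 by field.
  by rewrite E in e4; lra.
have -> : z6 = pi ^+ 6 / 945.
  have E : (2 ^+ 6 : R)^-1 = 1 / 64 by field.
  by rewrite E in e6; lra.
by field.
Qed.

End ZetaEven.

(** * Sums and products over lattice boxes *)

Section SymmetricSums.
Variable R : realType.
Local Notation C := (Cplx R).

Lemma sym_big (T : Type) (idx : T) (op : Monoid.com_law idx) (G : int -> T) N :
  \big[op/idx]_(i <- iota 0 N.*2.+1) G (i%:Z - N%:Z) =
  op (G 0) (\big[op/idx]_(0 <= k < N) op (G k.+1%:Z) (G (- k.+1%:Z))).
Proof.
have -> : iota 0 N.*2.+1 = index_iota 0 N.*2.+1 by rewrite /index_iota subn0.
rewrite (@big_cat_nat _ _ _ N) //=; last by rewrite -addnn leqW// leq_addr.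
rewrite [X in op _ X](@big_cat_nat _ _ _ N.+1) //=; last by rewrite ltnS -addnn leq_addr.
rewrite big_nat1 subrr Monoid.mulmCA; congr (op _ _).
rewrite big_split /= Monoid.mulmC; congr (op _ _).
  rewrite -{1}[N.+1]add0n big_addn.
  have -> : (N.*2.+1 - N.+1 = N)%N by rewrite -addnn subSS addnK.
  by apply: eq_bigr => i _; congr G; lia.
rewrite big_nat_rev /= big_nat [RHS]big_nat; apply: eq_bigr => i /andP[_ iN].
by congr G; lia.
Qed.

Lemma lattice_pt_eq0 (L : lattice R) m n :
  (lattice_pt L m n == 0) = (m == 0) && (n == 0).
Proof.
apply/eqP/andP => [|[/eqP -> /eqP ->]]; last by rewrite /lattice_pt !mulr0z addr0.
rewrite /lattice_pt -[per1 L *~ m]mulrzl -[per2 L *~ n]mulrzl.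
rewrite -!(rmorph_int (real_complex R)) => /per_free[/eqP + /eqP].
by rewrite !intr_eq0.
Qed.

(** A box is the disjoint union of its row through 0 and of pairs of opposite
    rows. The operation is a parameter because sigma is a product over boxes,
    while g2 and g3 are sums. *)
Lemma box_big (L : lattice R) (T : Type) (idx : T) (op : Monoid.com_law idx)
    (F : C -> T) N :
  \big[op/idx]_(w <- lattice_box L N | w != 0) F w =
  op (\big[op/idx]_(0 <= k < N) op (F (lattice_pt L k.+1 0)) (F (lattice_pt L (- k.+1%:Z) 0)))
     (\big[op/idx]_(0 <= l < N)
        op (\big[op/idx]_(i <- iota 0 N.*2.+1) F (lattice_pt L (i%:Z - N%:Z) l.+1))
           (\big[op/idx]_(i <- iota 0 N.*2.+1) F (lattice_pt L (i%:Z - N%:Z) (- l.+1%:Z)))).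
Proof.
pose F' w := if w != 0 then F w else idx.
rewrite big_mkcond /= /lattice_box big_allpairs_dep /= exchange_big /=.
rewrite (sym_big op (fun n => \big[op/idx]_(i <- iota 0 N.*2.+1) F' (lattice_pt L (i%:Z - N%:Z) n))).
rewrite (sym_big op (fun m => F' (lattice_pt L m 0))).
have F0 : F' (lattice_pt L 0 0) = idx.
  by rewrite /F' (_ : lattice_pt L 0 0 == 0) // lattice_pt_eq0.
rewrite F0 Monoid.mul1m; congr (op _ _); apply: eq_bigr => k _; congr (op _ _).
- by rewrite /F' lattice_pt_eq0.
- by rewrite /F' lattice_pt_eq0.
- by apply: eq_bigr => i _; rewrite /F' lattice_pt_eq0 andbF.
- by apply: eq_bigr => i _; rewrite /F' lattice_pt_eq0 andbF.
Qed.

End SymmetricSums.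

(** * The discriminant of the degenerating lattices *)

Section Discriminant.
Variable R : realType.
Local Notation C := (Cplx R).

(** Dominated convergence for series (Tannery). *)
Lemma tannery (u : nat -> nat -> C) (x : nat -> C) (M : nat -> R) (B : R) :
  (forall l, (fun N => u N l) @ \oo --> x l) -> (forall N l, (l < N)%N -> cmod (u N l) <= M l) ->
  (forall n, \sum_(0 <= l < n) M l <= B) ->
  exists X : C, series x @ \oo --> X /\ (fun N => \sum_(0 <= l < N) u N l) @ \oo --> X.
Proof.
move=> hu hM hB.
have M0 l : 0 <= M l by exact: le_trans (cmod_ge0 _) (hM l.+1 l (ltnSn l)).
have xM l : cmod (x l) <= M l by apply: (cvgC_le (hu l)); exists l.+1 => // N /= lN; exact: hM.
have [T [_ hT cvT]] := bounded_series M0 hB.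
pose e n := T - \sum_(0 <= l < n) M l.
have tl (v : nat -> C) n m : (n <= m)%N -> (forall l, (l < m)%N -> cmod (v l) <= M l) ->
    cmod (\sum_(n <= l < m) v l) <= e n.
  move=> nm hv; rewrite (le_trans (cmod_sum _ _ _))//.
  apply: (@le_trans _ _ (\sum_(n <= l < m) M l)).
    by rewrite big_nat [leRHS]big_nat; apply: ler_sum => l /andP[_]; exact: hv.
  by rewrite -(sum_tail M nm) lerD2r.
have [X [hX hXe]] : exists X : C, series x @ \oo --> X /\ forall n, cmod (X - series x n) <= e n.
  apply: cauchyC_cvg cvT => n m nm; rewrite /series /= sum_tail//; by apply: tl => // l _.
exists X; split; first exact: hX.
apply/cvgCP => d d0.
have d40 : 0 < d / 4 by rewrite divr_gt0.
have [K /(_ K (leqnn K)) hK] : exists K, forall n, (K <= n)%N -> e n < d / 4.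
  exact: cvg0_lt cvT d40.
have cvK : (fun N => \sum_(0 <= l < K) u N l) @ \oo --> \sum_(0 <= l < K) x l.
  by apply: cvgC_sum => l _; exact: hu.
have [N0 _ hN0] := (cvgCP _ _).1 cvK _ d40.
exists (maxn N0 K) => // N /=; rewrite geq_max => /andP[N0N KN].
have -> : \sum_(0 <= l < N) u N l - X =
  (\sum_(0 <= l < K) u N l - \sum_(0 <= l < K) x l) + \sum_(K <= l < N) u N l -
  (X - \sum_(0 <= l < K) x l).
  by rewrite -(sum_tail (u N) KN); ring.
apply: le_lt_trans (cmodB _ _) _.
apply: le_lt_trans (_ : d / 4 + d / 4 + d / 4 < d); last by lra.
apply: lerD; last by apply: le_trans (hXe K) _; exact: ltW.
apply: le_trans (cmodD _ _) _; apply: lerD; first by apply: ltW; exact: hN0.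
by apply: le_trans (tl (u N) K N KN (hM N)) _; exact: ltW.
Qed.

Variables (eta : C).
Hypothesis eta0 : eta != 0.
Local Notation om := (twopii R / (2 * eta)).
Local Notation Lj := (deg_lattice eta0).

Lemma deg_pt_cmod j (m n : int) : cmod (lattice_pt (Lj j) m n) ^+ 2 =
  cmod om ^+ 2 * (m%:~R ^+ 2 + (n%:~R * j.+1%:R) ^+ 2).
Proof.
rewrite /lattice_pt /=.
have -> : om *~ m + om * height R j *~ n = om * (m%:~R + height R j * n%:~R).
  by rewrite -[om *~ m]mulrzr -[om * height R j *~ n]mulrzr; ring.
rewrite cmodM exprMn.
congr (_ * _); rewrite /height -!(rmorph_int (real_complex R)) /cmod.
rewrite sqr_sqrtr; last by rewrite addr_ge0 ?sqr_ge0.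
by simpc; rewrite /= [j.+1%:R * _]mulrC.
Qed.

Variable r : nat.
Hypothesis r2 : (2 <= r)%N.
Local Notation F := (fun w : C => (w ^+ (2 * r))^-1).
Local Notation c j := ((cmod om ^+ (2 * r))^-1 / j.+1%:R ^+ 2).

(** A lattice point m om + n i (j+1) om with n <> 0 has modulus at least
    |om| max(|m|, |n| (j+1)); two powers of it go to the decay in j and n, and the
    rest to the summability over m. *)
Lemma deg_term_bound j (m n : int) : n != 0 ->
  cmod (F (lattice_pt (Lj j) m n)) <=
  c j * (m%:~R ^+ 2 + 1)^-1 * (n%:~R ^+ 2)^-1.
Proof.
move=> n0; rewrite cmodV cmodX exprM deg_pt_cmod exprMn -exprM.
have T1 : (1 : R) <= j.+1%:R by rewrite ler1n.
have n1 : (1 : R) <= n%:~R ^+ 2.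
  by rewrite -rmorphXn /= -[1]/(1%:~R) ler_int; move: n0; nia.
set T := j.+1%:R in T1 *; set x := n%:~R ^+ 2 in n1 *.
set y := m%:~R ^+ 2; have y0 : 0 <= y by rewrite sqr_ge0.
have o0 : 0 < cmod om by rewrite cmod_gt0 om_neq0.
have T21 : 1 <= T ^+ 2 by rewrite exprn_ege1.
have T20 : 0 < T ^+ 2 by exact: lt_le_trans T21.
have xT : x <= x * T ^+ 2 by rewrite ler_peMr// (le_trans _ n1).
pose s := y + (n%:~R * T) ^+ 2; have sE : s = y + x * T ^+ 2 by rewrite /s exprMn.
rewrite -/s; clearbody s x y T.
have s1 : 1 <= s by rewrite sE; lra.
have ss : (y + 1) * (x * T ^+ 2) <= s ^+ r.
  apply: (@le_trans _ _ (s ^+ 2)); last by rewrite ler_weXn2l.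
  rewrite expr2 sE; apply: ler_pM; rewrite ?addr_ge0 ?mulr_ge0 ?sqr_ge0//; lra.
have x0 : 0 < x by exact: lt_le_trans n1.
have y10 : 0 < y + 1 by rewrite ltr_wpDl.
have -> : (cmod om ^+ (2 * r))^-1 / T ^+ 2 * (y + 1)^-1 / x =
   (cmod om ^+ (2 * r))^-1 * ((y + 1) * (x * T ^+ 2))^-1.
  move: (_ ^-1) => z; field; rewrite !gt_eqF//; exact: lt_le_trans T1.
rewrite invfM ler_wpM2l ?invr_ge0 ?exprn_ge0 ?(ltW o0)//.
have s0 : 0 < s by exact: lt_le_trans s1.
have p0 : 0 < (y + 1) * (x * T ^+ 2) by apply: mulr_gt0 => //; exact: mulr_gt0.
by rewrite lef_pV2 ?posrE ?exprn_gt0.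
Qed.

Lemma c_ge0 j : 0 <= c j.
Proof. by rewrite mulr_ge0 ?invr_ge0 ?exprn_ge0 ?cmod_ge0. Qed.

Lemma cn_ge0 j (n : int) : 0 <= c j / n%:~R ^+ 2.
Proof. by apply: divr_ge0; [exact: c_ge0|exact: sqr_ge0]. Qed.

Lemma sq_sum_le n : \sum_(0 <= k < n) ((k.+1%:R : R) ^+ 2 + 1)^-1 <= 2.
Proof.
apply: le_trans (@zsum_le2 R 2 n isT); apply: ler_sum => k _.
by rewrite lef_pV2 ?posrE ?exprn_gt0 ?ltr0n ?ltr_wpDl ?sqr_ge0 ?lerDl.
Qed.

Definition deg_row j N (n : int) : C :=
  \sum_(i <- iota 0 N.*2.+1) F (lattice_pt (Lj j) (i%:Z - N%:Z) n).

Lemma deg_rowE j N n : deg_row j N n = F (lattice_pt (Lj j) 0 n) +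
  \sum_(0 <= k < N) (F (lattice_pt (Lj j) k.+1 n) + F (lattice_pt (Lj j) (- k.+1%:Z) n)).
Proof. exact: (sym_big _ (fun m => F (lattice_pt (Lj j) m n))). Qed.

Lemma deg_pair_bound j (n : int) k : n != 0 ->
  cmod (F (lattice_pt (Lj j) k.+1 n) + F (lattice_pt (Lj j) (- k.+1%:Z) n)) <=
  2 * (c j / n%:~R ^+ 2) * (k.+1%:R ^+ 2 + 1)^-1.
Proof.
move=> n0; apply: le_trans (cmodD _ _) _.
apply: le_trans (lerD (deg_term_bound j k.+1 n0) (deg_term_bound j (- k.+1%:Z) n0)) _.
by rewrite rmorphN sqrrN -pmulrn le_eqVlt; apply/orP; left; apply/eqP; ring.
Qed.

Lemma deg_row_bound j N (n : int) : n != 0 ->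
  cmod (deg_row j N n) <= 5 * (c j / n%:~R ^+ 2).
Proof.
move=> n0; rewrite deg_rowE; apply: le_trans (cmodD _ _) _.
have c0 := cn_ge0 j n.
have h1 : cmod (F (lattice_pt (Lj j) 0 n)) <= c j / n%:~R ^+ 2.
  apply: le_trans (deg_term_bound j 0 n0) _.
  by rewrite expr0n /= add0r invr1 mulr1.
have h2 : cmod (\sum_(0 <= k < N) (F (lattice_pt (Lj j) k.+1 n) +
    F (lattice_pt (Lj j) (- k.+1%:Z) n))) <= 2 * (c j / n%:~R ^+ 2) * 2.
  apply: le_trans (cmod_sum _ _ _) _.
  apply: le_trans (ler_sum _ (fun k _ => deg_pair_bound j k n0)) _.
  by rewrite -mulr_sumr ler_wpM2l ?sq_sum_le// mulr_ge0.
by apply: le_trans (lerD h1 h2) _; rewrite le_eqVlt; apply/orP; left; apply/eqP; ring.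
Qed.

Lemma deg_row_cvg j (n : int) : n != 0 -> exists l : C,
  (fun N => deg_row j N n) @ \oo --> l.
Proof.
move=> n0; have [|l hl] := abs_cvg (fun k => deg_pair_bound j k n0)
    (B := 2 * (c j / n%:~R ^+ 2) * 2).
  move=> N; rewrite -mulr_sumr ler_wpM2l ?sq_sum_le//.
  by rewrite mulr_ge0// cn_ge0.
exists (F (lattice_pt (Lj j) 0 n) + l); under eq_fun do rewrite deg_rowE.
exact: (cvgD (cvg_cst _) hl).
Qed.

Lemma deg_boxE j N : \sum_(w <- lattice_box (Lj j) N | w != 0) F w =
  F om * (2 * zsum R (2 * r) N)%:C +
  \sum_(0 <= l < N) (deg_row j N l.+1 + deg_row j N (- l.+1%:Z)).
Proof.
rewrite box_big; congr (_ + _).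
rewrite /zsum rmorphM rmorph_sum /= mulrA mulr_sumr; apply: eq_bigr => k _.
rewrite fmorphV rmorphXn rmorph_nat /lattice_pt !mulr0z !addr0 /=.
have ev (a : C) : (- a) ^+ (2 * r) = a ^+ (2 * r) by rewrite exprM sqrrN -exprM.
rewrite mulrNz -pmulrn -[om *+ _]mulr_natr ev exprMn invfM real_complex_nat.
by move: (om ^+ _)^-1 (k.+1%:R ^+ _)^-1 => a b; ring.
Qed.

Lemma deg_pairrow_bound j N l :
  cmod (deg_row j N l.+1 + deg_row j N (- l.+1%:Z)) <= 10 * c j * (l.+1%:R ^+ 2)^-1.
Proof.
apply: le_trans (cmodD _ _) _.
have n0 : l.+1%:Z != 0 by [].
have n0' : - l.+1%:Z != 0 by [].
apply: le_trans (lerD (deg_row_bound j N n0) (deg_row_bound j N n0')) _.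
by rewrite rmorphN sqrrN -pmulrn le_eqVlt; apply/orP; left; apply/eqP; ring.
Qed.

(** Only the row through 0, a multiple of zeta(2 r), contributes to the limit. *)
Lemma deg_lattice_sum_bound j (z : R) : zsum R (2 * r) @ \oo --> z ->
  cmod (lattice_sum (Lj j) F - F om * (2 * z)%:C) <= 20 * c j.
Proof.
move=> hz; pose D N := \sum_(0 <= l < N) (deg_row j N l.+1 + deg_row j N (- l.+1%:Z)).
have bM n : \sum_(0 <= l < n) 10 * c j * (l.+1%:R ^+ 2)^-1 <= 10 * c j * 2.
  rewrite -mulr_sumr; apply: ler_wpM2l; [by rewrite mulr_ge0// c_ge0|exact: (@zsum_le2 R 2 n isT)].
have hD N : cmod (D N) <= 20 * c j.
  apply: le_trans (cmod_sum _ _ _) _.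
  apply: le_trans (ler_sum _ (fun l _ => deg_pairrow_bound j N l)) _.
  by apply: le_trans (bM N) _; rewrite le_eqVlt; apply/orP; left; apply/eqP; ring.
have [x hx] : exists x : nat -> C, forall l,
    (fun N => deg_row j N l.+1 + deg_row j N (- l.+1%:Z)) @ \oo --> x l.
  suff h l : exists y : C, (fun N => deg_row j N l.+1 + deg_row j N (- l.+1%:Z)) @ \oo --> y.
    by exists (fun l => projT1 (cid (h l))) => l; case: cid.
  have [a ha] := @deg_row_cvg j l.+1%:Z isT.
  have [b hb] := @deg_row_cvg j (- l.+1%:Z) isT.
  by exists (a + b); exact: cvgD ha hb.
have [X [_ hX]] := tannery hx (fun N l _ => deg_pairrow_bound j N l) bM.
have Xb : cmod X <= 20 * c j by apply: (cvgC_le hX); apply: nearW; exact: hD.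
have hS : (fun N => \sum_(w <- lattice_box (Lj j) N | w != 0) F w) @ \oo -->
    F om * (2 * z)%:C + X.
  rewrite (funext (deg_boxE j)); apply: cvgD; last exact: hX.
  apply: cvgM; first exact: cvg_cst.
  by apply: cvgC_real; apply: cvgM; [exact: cvg_cst|exact: hz].
by rewrite /lattice_sum (limC hS) addrAC subrr add0r.
Qed.

Lemma deg_lattice_sum_cvg (z : R) : zsum R (2 * r) @ \oo --> z ->
  (fun j => lattice_sum (Lj j) F) @ \oo --> F om * (2 * z)%:C.
Proof.
move=> hz; apply: (@squeezeC _ _ _ (fun j => 20 * c j)).
  by apply: nearW => j; exact: deg_lattice_sum_bound.
have -> : (fun j => 20 * c j) = (fun j => 20 * (cmod om ^+ (2 * r))^-1 *
    (harmonic j * harmonic j)).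
  by apply/funext => j; rewrite /harmonic /= [j.+1%:R ^+ 2]expr2 [(j.+1%:R * j.+1%:R)^-1]invfM mulrA.
have h : (fun j => 20 * (cmod om ^+ (2 * r))^-1 * (harmonic j * harmonic j)) @ \oo -->
    20 * (cmod om ^+ (2 * r))^-1 * (0 * 0 : R).
  by apply: cvgM; [exact: cvg_cst|exact: cvgM (@cvg_harmonic R) (@cvg_harmonic R)].
rewrite !mulr0 in h; exact: h.
Qed.

End Discriminant.

(** The limits of g2 and g3 are 120 zeta(4) / om^4 and 280 zeta(6) / om^6,
    and [zeta46] says that they annihilate the discriminant. *)
Lemma deg_discriminant (R : realType) (eta : Cplx R) (eta0 : eta != 0) :
  (fun j => discriminant (deg_lattice eta0 j)) @ \oo --> (0 : Cplx R).
Proof.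
have [z4 [z6 [h4 h6 zE]]] := zeta46 R.
have l4 := @deg_lattice_sum_cvg R eta eta0 2 isT z4 h4.
have l6 := @deg_lattice_sum_cvg R eta eta0 3 isT z6 h6.
set om := twopii R / (2 * eta) in l4 l6.
pose a : Cplx R := (om ^+ (2 * 2))^-1 * (2 * z4)%:C.
pose b : Cplx R := (om ^+ (2 * 3))^-1 * (2 * z6)%:C.
have h : (fun j => discriminant (deg_lattice eta0 j)) @ \oo -->
    (60%:R * a) ^+ 3 - 27%:R * (140%:R * b) ^+ 2.
  have c2 : (fun j => g2 (deg_lattice eta0 j)) @ \oo --> 60%:R * a.
    exact: (cvgM (cvg_cst _) l4).
  have c3 : (fun j => g3 (deg_lattice eta0 j)) @ \oo --> 140%:R * b.
    exact: (cvgM (cvg_cst _) l6).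
  have e (x : Cplx R) : x ^+ 3 = x * x * x by rewrite !exprS expr0 mulr1 mulrA.
  rewrite /discriminant e expr2; under eq_fun do rewrite e expr2.
  apply: cvgB; first exact: (cvgM (cvgM c2 c2) c2).
  by apply: cvgM; [exact: cvg_cst|exact: (cvgM c3 c3)].
suff e0 : (60%:R * a) ^+ 3 - 27%:R * (140%:R * b) ^+ 2 = 0 by rewrite e0 in h.
have o0 : om != 0 by exact: om_neq0.
have zC : (120 * (z4%:C : Cplx R)) ^+ 3 = 27 * (280 * z6%:C) ^+ 2.
  have := congr1 (real_complex R) zE; rewrite !(rmorphM, rmorphXn) /= !rmorph_nat.
  by [].
have -> : (60%:R * a) ^+ 3 - 27%:R * (140%:R * b) ^+ 2 =
  (om ^+ 12)^-1 * ((120 * z4%:C) ^+ 3 - 27 * (280 * z6%:C) ^+ 2).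
  by rewrite /a /b !rmorphM !rmorph_nat /=; move: (z4%:C) (z6%:C) => x y; field.
by rewrite zC subrr mulr0.
Qed.

(** * The limit of the degenerating family *)

Section DegenerateLevel.
Variable R : realType.
Local Notation C := (Cplx R).

Lemma expands_has_taylor (f : C -> C) a B : expands 1 f a B -> has_taylor f a.
Proof.
move=> [_ h]; apply/nearC; exists 1 => // t; rewrite subr0 => t1.
by apply: h; exact: ltW.
Qed.

Variables (eta : C) (N k : nat).
Hypothesis eta0 : eta != 0.
Hypothesis k0 : (0 < k)%N.
Hypothesis kN : (k < N)%N.

Lemma deg_limit_expands : exists a B, expands 1 (deg_limit eta N k) a B.
Proof.
set b := 2 * eta * ((k%:R / N%:R : R)%:C - 1).
have r0 := @ler01 R.
have h1 := expands_mul r0 (expands_cexp b r0)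
  (expands_add r0 (expands_cexp (2 * eta) r0) (expands_cst 1 (-1 : C))).
do 2 eexists; apply: expands_ext (expands_scale (2 * eta)^-1 h1) => z _.
by rewrite /deg_limit mulrC.
Qed.

(** The quotient deg_fun j / deg_limit tends to 1 in norm, so that the Taylor
    coefficients of deg_fun j tend to those of deg_limit. *)
Lemma degenerate_level : is_degenerate_elliptic_level N (deg_limit eta N k).
Proof.
have [a [B hf]] := deg_limit_expands.
have [d [d0 [J _ hJ]]] := deg_factor_to_one eta k0 kN.
have [h hh] : exists h : nat -> nat -> C, forall j,
    expands 1 (fun t => deg_factor eta N k (j + J)%N t - 1) (h j) (d (j + J)%N).
  suff H j : exists b, expands 1 (fun t => deg_factor eta N k (j + J)%N t - 1) b (d (j + J)%N).
    by exists (fun j => projT1 (cid (H j))) => j; case: cid.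
  by apply: hJ => /=; exact: leq_addl.
have B0 : 0 <= B by have [/(_ 0%N)] := hf; rewrite big_nil.
have r0 := @ler01 R.
have hA j : expands 1 (deg_fun N k eta0 (j + J)) (fun i => a i + conv a (h j) i) (B + B * d (j + J)%N).
  apply: expands_ext (expands_add r0 hf (expands_mul r0 hf (hh j))) => z _.
  by rewrite deg_funE; ring.
(* The estimates hold from the index J on, so the sequence is shifted by J. *)
exists (fun j => deg_lattice eta0 (j + J)), (fun j => deg_fun N k eta0 (j + J)),
  (fun j i => a i + conv a (h j) i), a; split.
- move=> j; split; last exact: expands_has_taylor (hA j).
  exact: deg_level.
- rewrite (cvg_shiftn J (fun j => discriminant (deg_lattice eta0 j))).
  exact: deg_discriminant.
- exact: expands_has_taylor hf.
move=> i; apply: (@squeezeC _ _ _ (fun j => B * d (j + J)%N)).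
  apply: nearW => j; rewrite addrAC subrr add0r.
  have [hw _] := expands_mul r0 hf (hh j).
  have := term_le_wbound i r0 hw; rewrite expr1n mulr1; exact: id.
rewrite -(mulr0 B); apply: cvgM; first exact: cvg_cst.
by rewrite (cvg_shiftn J d).
Qed.

Lemma sing_fun_deg_limit t :
  sing_fun (2 * eta * (k%:R / N%:R : R)%:C) eta eta t = deg_limit eta N k t.
Proof.
rewrite sing_funE// subrr subr0 /deg_limit.
set kap := (_%:C).
have -> : cexp (2 * eta * kap * t) = cexp (2 * eta * (kap - 1) * t) * cexp (2 * eta * t).
  by rewrite -cexpD; congr cexp; ring.
have := cexp_neq0 (2 * eta * t).
move: (cexp (2 * eta * t)) (cexp _) => X z X0.
have e2 : eta + eta != 0 by rewrite -mulr2n mulrn_eq0.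
by field; rewrite e2 X0 eta0.
Qed.

End DegenerateLevel.

(** * Infinite products *)

Section InfiniteProducts.
Variable R : realType.
Local Notation C := (Cplx R).

Lemma cmod_le_exp (u : C) (m : R) : cmod (u - 1) <= m -> cmod u <= expR m.
Proof.
move=> h; apply: le_trans (expR_ge1Dx m).
have := cmodD (u - 1) 1; rewrite subrK cmod1 => hu.
by apply: le_trans hu _; rewrite addrC lerD2l.
Qed.

Lemma cmod_prod_le (u : nat -> C) (M : nat -> R) n :
  (forall l, (l < n)%N -> cmod (u l - 1) <= M l) ->
  cmod (\prod_(0 <= l < n) u l) <= expR (\sum_(0 <= l < n) M l).
Proof.
elim: n => [|n IH] h; first by rewrite !big_nil cmod1 expR0.
rewrite !big_nat_recr //= cmodM expRD; apply: ler_pM; rewrite ?cmod_ge0//.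
  by apply: IH => l ln; apply: h; exact: ltnW.
by apply: cmod_le_exp; exact: h.
Qed.

Lemma prod_telescope (u : nat -> C) n :
  \prod_(0 <= l < n) u l = 1 + \sum_(0 <= l < n) (u l - 1) * \prod_(0 <= i < l) u i.
Proof.
elim: n => [|n IH]; first by rewrite !big_nil addr0.
by rewrite big_nat_recr //= [in RHS]big_nat_recr //= addrA -IH; ring.
Qed.

(** By induction, from uv - 1 = (u - 1) + u (v - 1). *)
Lemma cmod_prod_sub1_le (u : nat -> C) (M : nat -> R) n :
  (forall l, (l < n)%N -> cmod (u l - 1) <= M l) ->
  cmod (\prod_(0 <= l < n) u l - 1) <= expR (\sum_(0 <= l < n) M l) - 1.
Proof.
elim: n => [|n IH] h; first by rewrite !big_nil subrr cmod0 expR0 subrr.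
have h1 : cmod (\prod_(0 <= l < n) u l - 1) <= expR (\sum_(0 <= l < n) M l) - 1.
  by apply: IH => l ln; apply: h; exact: ltnW.
have h2 : cmod (\prod_(0 <= l < n) u l) <= expR (\sum_(0 <= l < n) M l).
  by apply: cmod_prod_le => l ln; apply: h; exact: ltnW.
have h3 := h n (ltnSn n); have M0 := le_trans (cmod_ge0 _) h3.
rewrite !big_nat_recr //= expRD.
have -> : (\prod_(0 <= l < n) u l) * u n - 1 =
  (\prod_(0 <= l < n) u l - 1) + (\prod_(0 <= l < n) u l) * (u n - 1) by ring.
apply: le_trans (cmodD _ _) _; rewrite cmodM.
have h4 := ler_pM (cmod_ge0 _) (cmod_ge0 _) h2 h3.
apply: le_trans (lerD h1 h4) _.
have h5 := ler_wpM2l (expR_ge0 (\sum_(0 <= l < n) M l)) (expR_ge1Dx (M n)).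
rewrite mulrDr mulr1 in h5; lra.
Qed.

(** Dominated convergence for infinite products, by writing a product as a
    telescoping sum. *)
Lemma tannery_prod (u : nat -> nat -> C) (x : nat -> C) (M : nat -> R) (B : R) :
  (forall l, (fun N => u N l) @ \oo --> x l) ->
  (forall N l, (l < N)%N -> cmod (u N l - 1) <= M l) ->
  (forall n, \sum_(0 <= l < n) M l <= B) ->
  exists X : C, (fun n => \prod_(0 <= l < n) x l) @ \oo --> X /\
    (fun N => \prod_(0 <= l < N) u N l) @ \oo --> X.
Proof.
move=> hu hM hB.
pose U N l := (u N l - 1) * \prod_(0 <= i < l) u N i.
pose Y l := (x l - 1) * \prod_(0 <= i < l) x i.
have M0 l : 0 <= M l by exact: le_trans (cmod_ge0 _) (hM l.+1 l (ltnSn l)).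
have hU l : (fun N => U N l) @ \oo --> Y l.
  apply: cvgM; last by apply: cvgC_prod => i _; exact: hu.
  exact: (cvgB (hu l) (cvg_cst _)).
have hUM N l : (l < N)%N -> cmod (U N l) <= M l * expR B.
  move=> lN; rewrite /U cmodM; apply: ler_pM; rewrite ?cmod_ge0//; first exact: hM.
  apply: (@le_trans _ _ (expR (\sum_(0 <= i < l) M i))); last by rewrite ler_expR.
  by apply: cmod_prod_le => i il; apply: hM; exact: ltn_trans il lN.
have hB' n : \sum_(0 <= l < n) M l * expR B <= B * expR B.
  by rewrite -mulr_suml ler_wpM2r ?expR_ge0.
have [X [h1 h2]] := tannery hU hUM hB'.
exists (1 + X); split.
  rewrite (_ : (fun n => _) = (fun n => 1 + series Y n)).
    exact: (cvgD (cvg_cst _) h1).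
  by apply/funext => n; rewrite prod_telescope.
rewrite (_ : (fun N => _) = (fun N => 1 + \sum_(0 <= l < N) U N l)).
  exact: (cvgD (cvg_cst _) h2).
by apply/funext => N; rewrite prod_telescope.
Qed.

Lemma cexp_sub_bounds (y : C) :
  cmod (cexp y - 1) <= cmod y * expR (cmod y) /\
  cmod (cexp y - 1 - y) <= cmod y ^+ 2 * expR (cmod y).
Proof.
have f1 k : 1 <= (k.+1%:R : R) by rewrite ler1n.
have tb k : cmod (expc y k) = cmod y ^+ k / k`!%:R.
  by rewrite /expc cmodM cmodX cmodV cmod_nat.
have step k : cmod (expc y k.+1) <= cmod y * (cmod y ^+ k / k`!%:R).
  rewrite tb exprS -mulrA ler_wpM2l ?cmod_ge0// ler_wpM2l ?exprn_ge0 ?cmod_ge0//.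
  rewrite lef_pV2 ?posrE ?ltr0n ?fact_gt0// ler_nat factS leq_pmull//.
have step2 k : cmod (expc y k.+2) <= cmod y ^+ 2 * (cmod y ^+ k / k`!%:R).
  apply: le_trans (step k.+1) _; rewrite -tb.
  by rewrite [cmod y ^+ 2]expr2 -mulrA ler_wpM2l ?cmod_ge0 ?step.
have hs := @cexp_series R y.
split.
  have cv : (fun n => series (expc y) n.+1 - 1) @ \oo --> cexp y - 1.
    have h : (fun n => series (expc y) n.+1) @ \oo --> cexp y.
      by rewrite (cvg_shiftS (series (expc y))); exact: hs.
    exact: (cvgB h (cvg_cst (1 : C))).
  apply: (cvgC_le cv); apply: nearW => n; rewrite /series /= big_nat_recl //=.
  rewrite {1}/expc expr0 fact0 divr1 addrAC subrr add0r.
  apply: le_trans (cmod_sum _ _ _) _.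
  apply: le_trans (ler_sum _ (fun k _ => step k)) _.
  by rewrite -mulr_sumr ler_wpM2l ?cmod_ge0 ?expc_bound ?cmod_ge0.
have cv : (fun n => series (expc y) n.+2 - 1 - y) @ \oo --> cexp y - 1 - y.
  have h : (fun n => series (expc y) n.+2) @ \oo --> cexp y.
    by rewrite (cvg_shiftS (fun n => series (expc y) n.+1)) (cvg_shiftS (series (expc y))); exact: hs.
  exact: (cvgB (cvgB h (cvg_cst (1 : C))) (cvg_cst y)).
apply: (cvgC_le cv); apply: nearW => n; rewrite /series /= big_nat_recl //= big_nat_recl //=.
rewrite {1}/expc expr0 fact0 divr1 {1}/expc expr1 divr1.
have -> (s : C) : 1 + (y + s) - 1 - y = s by ring.
apply: le_trans (cmod_sum _ _ _) _.
apply: le_trans (ler_sum _ (fun k _ => step2 k)) _.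
by rewrite -mulr_sumr ler_wpM2l ?sqr_ge0 ?expc_bound ?cmod_ge0.
Qed.

Lemma weier_bound (y : C) :
  cmod ((1 - y) * cexp y - 1) <= 2 * cmod y ^+ 2 * expR (cmod y).
Proof.
have [h1 h2] := cexp_sub_bounds y.
have -> : (1 - y) * cexp y - 1 = (cexp y - 1 - y) - y * (cexp y - 1) by ring.
apply: le_trans (cmodB _ _) _; rewrite cmodM.
apply: le_trans (lerD h2 (ler_wpM2l (cmod_ge0 y) h1)) _.
by rewrite le_eqVlt; apply/orP; left; apply/eqP; ring.
Qed.

Definition csin (y : C) : C := (cexp ('i * y) - cexp (- ('i * y))) / (2 * 'i).

Let i0 : ('i : C) != 0.
Proof. by apply/eqP => -[] /eqP; rewrite oner_eq0. Qed.

Lemma csin_real (t : R) : csin (t%:C : C) = (sin t)%:C.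
Proof.
have e : - ('i * (t%:C : C)) = 'i * ((- t)%:C : C).
  by rewrite rmorphN mulrN.
rewrite /csin e !cexp_imag cosN sinN.
have -> : (cos t +i* sin t) - (cos t +i* - sin t) = 2 * 'i * (sin t)%:C :> C.
  by simpc; congr (_ +i* _); ring.
by rewrite mulrAC divff ?mul1r// mulf_neq0 ?pnatr_eq0.
Qed.

Lemma cmod_i : cmod ('i : C) = 1.
Proof. by rewrite /cmod /= expr0n /= add0r expr1n sqrtr1. Qed.

Lemma csin_bound (y : C) : cmod (csin y - y) <= cmod y ^+ 2 * expR (cmod y).
Proof.
have [_ h1] := cexp_sub_bounds ('i * y); have [_ h2] := cexp_sub_bounds (- ('i * y)).
rewrite cmodN in h2; rewrite cmodM cmod_i mul1r in h1 h2.
have i20 : (2 * 'i : C) != 0 by rewrite mulf_neq0 ?pnatr_eq0.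
have -> : csin y - y = ((cexp ('i * y) - 1 - 'i * y) -
    (cexp (- ('i * y)) - 1 - - ('i * y))) / (2 * 'i).
  by rewrite /csin; move: (cexp _) (cexp _) => u v; field.
rewrite cmodM cmodV cmodM cmod_i mulr1 cmod_nat ler_pdivrMr//.
by apply: le_trans (cmodB _ _) _; apply: le_trans (lerD h1 h2) _; lra.
Qed.

Lemma csin_le (y : C) : cmod (csin y) <= cmod y * (1 + cmod y * expR (cmod y)).
Proof.
have h := csin_bound y; have := cmodD (csin y - y) y; rewrite subrK => h2.
apply: le_trans h2 _; apply: le_trans (lerD h (lexx _)) _.
by rewrite le_eqVlt; apply/orP; left; apply/eqP; ring.
Qed.

End InfiniteProducts.

(** * The sine product *)

Section SineProduct.
Variable R : realType.
Local Notation C := (Cplx R).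

Let i0 : ('i : C) != 0.
Proof. by apply/eqP => -[] /eqP; rewrite oner_eq0. Qed.

(** The kernel of the exponential determines the order of e^(2 pi i / M). *)
Lemma prim_root_cexp (M : nat) : (0 < M)%N ->
  M.-primitive_root (cexp (twopii R / M%:R)).
Proof.
move=> M0; have MC : (M%:R : C) != 0 by rewrite pnatr_eq0 -lt0n.
rewrite /primitive_root_of_unity M0; apply/forallP => i; apply/eqP.
rewrite unity_rootE -cexpMn; apply/eqP/eqP => [/cexp_kernel[k]|->].
  rewrite -[LHS]mulr_natr -[_ *~ k]mulrzr => h.
  have {}h : twopii R * i.+1%:R = twopii R * (k%:~R * M%:R).
    by rewrite [RHS]mulrA -h; move: (twopii R) (i.+1%:R : C) => a b; field.
  have {}h : (i.+1%:R : C) = (k * M%:Z)%:~R.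
    by rewrite rmorphM /= -pmulrn; apply: (mulfI (twopii_neq0 R)).
  have {}h : i.+1%:Z = k * M%:Z.
    by apply: (@intr_inj C); rewrite -h.
  have iM := ltn_ord i.
  have k0 : 0 < k by nia.
  by apply/eqP; rewrite eqn_leq iM /=; nia.
by rewrite -[_ *+ M]mulr_natr divfK// cexp_twopii.
Qed.

Variable K : nat.
Local Notation M := (K.*2.+1).
Local Notation ang k := (pi * k.+1%:R / M%:R : R).

Let MC : (M%:R : C) != 0. Proof. by rewrite pnatr_eq0. Qed.
Let MR : (M%:R : R) != 0. Proof. by rewrite pnatr_eq0. Qed.

Local Notation z := (cexp (twopii R / M%:R)).

(** Two conjugate roots of unity: z^k + z^-k = 2 cos(2 pi k / M), and
    1 - cos(2 a) = 2 sin(a)^2. *)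
Lemma root_pair (k : nat) (X : C) : (k < K)%N ->
  (X - z ^+ k.+1) * (X - z ^+ (K + (K - k.+1)).+1) =
  (X - 1) ^+ 2 + 4 * X * ((sin (ang k)) ^+ 2)%:C.
Proof.
move=> kK.
have z0 : z != 0 by exact: cexp_neq0.
have zM : z ^+ M = 1.
  by apply: prim_expr_order; exact: prim_root_cexp.
have e2 : z ^+ (K + (K - k.+1)).+1 = (z ^+ k.+1)^-1.
  apply: (mulIf (expf_neq0 k.+1 z0)); rewrite mulVf ?expf_neq0// -exprD -[RHS]zM.
  by congr (_ ^+ _); lia.
have zE : z ^+ k.+1 = cexp ('i * (ang k *+ 2)%:C).
  rewrite -cexpMn; congr cexp; rewrite /twopii -[LHS]mulr_natr.
  have -> : (ang k *+ 2)%:C = (pi *+ 2 : R)%:C * (k.+1%:R / M%:R) :> C.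
    have -> : ang k *+ 2 = pi *+ 2 * (k.+1%:R / M%:R) by field.
    by rewrite rmorphM rmorphM fmorphV !rmorph_nat.
  by move: ('i : C) => i; rewrite -!mulrA [M%:R^-1 * _]mulrC.
have zV : (z ^+ k.+1)^-1 = cexp ('i * (- (ang k *+ 2))%:C).
  by rewrite zE -cexpN; congr cexp; rewrite rmorphN mulrN.
have zs : z ^+ k.+1 + (z ^+ k.+1)^-1 = 2 - 4 * ((sin (ang k)) ^+ 2)%:C.
  rewrite zV zE !cexp_imag sinN cosN.
  have -> : (cos (ang k *+ 2) +i* sin (ang k *+ 2)) + (cos (ang k *+ 2) +i* - sin (ang k *+ 2))
     = (2 * cos (ang k *+ 2))%:C :> C.
    by simpc; congr (_ +i* _); ring.
  rewrite cos_mulr2n cos2sin2 -(rmorph_nat (real_complex R)) -(rmorph_nat (real_complex R) 4).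
  rewrite -!rmorphM -rmorphB; congr (_%:C); ring.
rewrite e2.
have -> : (X - z ^+ k.+1) * (X - (z ^+ k.+1)^-1) =
   X ^+ 2 - (z ^+ k.+1 + (z ^+ k.+1)^-1) * X + z ^+ k.+1 * (z ^+ k.+1)^-1 by ring.
by rewrite zs divff ?expf_neq0//; ring.
Qed.

Lemma root_prod_pairs (X : C) :
  \prod_(0 <= j < K.*2) (X - z ^+ j.+1) =
  \prod_(0 <= k < K) ((X - 1) ^+ 2 + 4 * X * ((sin (ang k)) ^+ 2)%:C).
Proof.
set zeta_ := cexp _; rewrite -addnn (@big_cat_nat _ _ _ K) //= ?leq_addr//.
rewrite -{2}[K]add0n big_addn addnK [X in _ * X]big_nat_rev /= -big_split /=.
rewrite big_nat [RHS]big_nat; apply: eq_bigr => k /andP[_ kK].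
by rewrite add0n [(K - k.+1 + K)%N]addnC addnn; apply: root_pair.
Qed.

Lemma root_prod_poly :
  \prod_(0 <= j < K.*2) ('X - (z ^+ j.+1)%:P) = \sum_(i < M) 'X^i.
Proof.
have hz : M.-primitive_root z by exact: prim_root_cexp.
have := factor_Xn_sub_1 hz; rewrite subrX1 big_nat_recl // expr0.
by move=> h; apply: (mulfI _ h); rewrite -size_poly_eq0 size_XsubC.
Qed.

Lemma root_prod_horner (X : C) :
  \prod_(0 <= j < K.*2) (X - z ^+ j.+1) = \sum_(i < M) X ^+ i.
Proof.
have := congr1 (fun p => p.[X]) root_prod_poly.
rewrite horner_prod horner_sum.
under eq_bigr do rewrite hornerXsubC; under [in RHS]eq_bigr do rewrite hornerXn.
exact.
Qed.

(** The value at X = 1 of (X^M - 1) / (X - 1). *)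
Lemma prod_4sin : \prod_(0 <= k < K) (4 * ((sin (ang k)) ^+ 2)%:C : C) = M%:R.
Proof.
have := root_prod_horner 1; rewrite root_prod_pairs.
under eq_bigr do rewrite subrr expr0n /= add0r mulr1.
move=> ->; under eq_bigr do rewrite expr1n.
by rewrite sumr_const card_ord.
Qed.

Lemma csin_i (y : C) : cexp ('i * y) - cexp (- ('i * y)) = 2 * 'i * csin y.
Proof. by rewrite /csin [RHS]mulrC divfK// mulf_neq0 ?pnatr_eq0. Qed.

Lemma sin_ang_neq0 k : (k < K)%N -> ((sin (ang k) ^+ 2)%:C : C) != 0.
Proof.
move=> kK; rewrite -(rmorph0 (real_complex R)) (inj_eq (@complexI R)) expf_neq0//.
have p0 := @pi_gt0 R; have M0 : (0 : R) < M%:R by rewrite ltr0n.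
rewrite gt_eqF// sin_gt0_pi// divr_gt0 ?mulr_gt0 ?ltr0n//=.
by rewrite ltr_pdivrMr// ltr_pM2l// ltr_nat; lia.
Qed.

(** The finite form of the sine product: it is the factorization of
    a^M - b^M over the M-th roots of unity, for a = e^(iy) and b = e^(-iy). *)
Lemma csin_finite (y : C) : csin (M%:R * y) = M%:R * csin y *
  \prod_(0 <= k < K) (1 - csin y ^+ 2 / (sin (ang k) ^+ 2)%:C).
Proof.
pose a := cexp ('i * y); have a0 : a != 0 by exact: cexp_neq0.
have b : cexp (- ('i * y)) = a^-1 by rewrite cexpN.
have S1 : 2 * 'i * csin y = a - a^-1 by rewrite -csin_i b.
have SM : 2 * 'i * csin (M%:R * y) = a ^+ M - a ^- M.
  rewrite -csin_i cexpN -cexpMn; congr (_ - _^-1); congr cexp;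
  by rewrite -[RHS]mulr_natr; ring.
have S2 : (a ^+ 2 - 1) ^+ 2 = - (4 * a ^+ 2 * csin y ^+ 2).
  have -> : a ^+ 2 - 1 = a * (2 * 'i * csin y) by rewrite S1; field.
  have ii : 'i ^+ 2 = -1 :> C := sqr_i R.
  by rewrite !exprMn ii; ring.
have P : \prod_(0 <= k < K) ((a ^+ 2 - 1) ^+ 2 + 4 * a ^+ 2 * ((sin (ang k)) ^+ 2)%:C) =
    a ^+ K.*2 * M%:R * \prod_(0 <= k < K) (1 - csin y ^+ 2 / (sin (ang k) ^+ 2)%:C).
  rewrite -prod_4sin -mul2n exprM.
  have -> : (a ^+ 2) ^+ K = \prod_(0 <= k < K) a ^+ 2.
    by rewrite prodr_const_nat subn0.
  rewrite -!big_split /= big_nat [RHS]big_nat; apply: eq_bigr => k /andP[_ kK].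
  rewrite S2; have := sin_ang_neq0 kK; rewrite -mul2n.
  by move: (_%:C) => s s0; field.
have main : a ^+ M * (a ^+ M - a ^- M) = (a ^+ 2 - 1) *
    (a ^+ K.*2 * M%:R * \prod_(0 <= k < K) (1 - csin y ^+ 2 / (sin (ang k) ^+ 2)%:C)).
  rewrite -P -root_prod_pairs root_prod_horner -subrX1 mulrBr divff ?expf_neq0//.
  by rewrite -expr2 -!exprM mulnC.
have i20 : 2 * 'i != 0 :> C by rewrite mulf_neq0 ?pnatr_eq0.
apply: (mulfI i20); rewrite SM; apply: (mulfI (expf_neq0 M a0)); rewrite main.
have -> : a ^+ 2 - 1 = a * (2 * 'i * csin y) by rewrite S1; field.
rewrite [a ^+ M]exprS.
by move: (\prod_(_ <= _ < _) _) (a ^+ _) (M%:R : C) => p b' m; ring.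
Qed.

End SineProduct.

Section SineLimit.
Variable R : realType.
Local Notation C := (Cplx R).
Local Notation M K := ((K : nat).*2.+1%:R).

Let piC0 : ((pi : R)%:C : C) != 0.
Proof. by rewrite -(rmorph0 (real_complex R)) (inj_eq (@complexI R)) gt_eqF ?pi_gt0. Qed.

Let MR K : (0 : R) < M K. Proof. by rewrite ltr0n. Qed.
Let MC K : (M K : C) != 0. Proof. by rewrite pnatr_eq0. Qed.

Lemma cmod_divM (w : C) K : cmod (w / M K) = cmod w / M K.
Proof. by rewrite cmodM cmodV cmod_nat. Qed.

Lemma cmod_divM_le (w : C) K : cmod (w / M K) <= cmod w.
Proof. by rewrite cmod_divM ler_pdivrMr// ler_peMr ?cmod_ge0// ler1n. Qed.

Lemma csin_scaled (w : C) : (fun K => M K * csin (w / M K)) @ \oo --> w.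
Proof.
apply: (@squeezeC _ _ _ (fun K => cmod w ^+ 2 * expR (cmod w) * harmonic K)).
  apply: nearW => K; have -> : M K * csin (w / M K) - w = M K * (csin (w / M K) - w / M K).
    by have := MC K; move: (csin _) => s h; field.
  rewrite cmodM cmod_nat; have h := csin_bound (w / M K).
  apply: le_trans (ler_wpM2l (ltW (MR K)) h) _.
  apply: (@le_trans _ _ (M K * (cmod (w / M K) ^+ 2 * expR (cmod w)))).
    by rewrite ler_wpM2l ?(ltW (MR K))// ler_wpM2l ?sqr_ge0// ler_expR cmod_divM_le.
  rewrite cmod_divM.
  have -> : M K * ((cmod w / M K) ^+ 2 * expR (cmod w)) = cmod w ^+ 2 * expR (cmod w) * (M K)^-1.
    by have := lt0r_neq0 (MR K); move: (expR _) => s m0; field.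
  apply: ler_wpM2l; first by rewrite mulr_ge0 ?sqr_ge0 ?expR_ge0.
  rewrite /harmonic /=.
  by rewrite lef_pV2 ?posrE ?ltr0n// ler_nat; lia.
rewrite -(mulr0 (cmod w ^+ 2 * expR (cmod w))).
exact: (cvgM (cvg_cst _) (@cvg_harmonic R)).
Qed.

Lemma csin_scaled_sq (w : C) : (fun K => (M K * csin (w / M K)) ^+ 2) @ \oo --> w ^+ 2.
Proof.
rewrite expr2; under eq_fun do rewrite expr2.
exact: (cvgM (@csin_scaled w) (@csin_scaled w)).
Qed.

Local Notation ang K k := (pi * k.+1%:R / M K : R).

Lemma ang_range K k : (k < K)%N -> 0 < ang K k < pi / 2.
Proof.
move=> kK; have p0 := @pi_gt0 R.
rewrite divr_gt0 ?mulr_gt0 ?ltr0n//= ltr_pdivrMr// -mulrA ltr_pM2l//.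
rewrite mulrC ltr_pdivlMr// -natrM ltr_nat; lia.
Qed.

Lemma csin_sq_div (w : C) K k : csin (w / M K) ^+ 2 / (sin (ang K k) ^+ 2)%:C =
  (M K * csin (w / M K)) ^+ 2 / (M K * csin ((pi * k.+1%:R : R)%:C / M K)) ^+ 2.
Proof.
have -> : (pi * k.+1%:R : R)%:C / M K = (ang K k)%:C :> C.
  by rewrite [RHS]rmorphM fmorphV !rmorph_nat.
rewrite csin_real rmorphXn /=; have := MC K.
have [->|s0] := eqVneq ((sin (ang K k))%:C : C) 0.
  by rewrite mulr0 expr0n /= invr0 !mulr0.
by move: s0; move: (_%:C) (csin _) => s t s0 m0; field; apply/andP.
Qed.

(** The limit of the finite product at y = pi x / M as M grows; it is dominated
    since csc^2(pi k / M) is at most 2 M^2 / k^2. *)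
Lemma csin_prod (x : C) : (fun n => x * \prod_(0 <= k < n) (1 - x ^+ 2 / k.+1%:R ^+ 2))
   @ \oo --> csin (pi%:C * x) / pi%:C.
Proof.
pose w : C := pi%:C * x; pose D := cmod w * (1 + cmod w * expR (cmod w)).
have D0 : 0 <= D by rewrite mulr_ge0 ?addr_ge0 ?mulr_ge0 ?cmod_ge0 ?expR_ge0.
pose u K k : C := 1 - csin (w / M K) ^+ 2 / (sin (ang K k) ^+ 2)%:C.
have hu k : (fun K => u K k) @ \oo --> (1 - x ^+ 2 / k.+1%:R ^+ 2 : C).
  have k0 : (k.+1%:R : C) != 0 by rewrite pnatr_eq0.
  have -> : (1 - x ^+ 2 / k.+1%:R ^+ 2 : C) = 1 - w ^+ 2 / ((pi * k.+1%:R : R)%:C) ^+ 2.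
    congr (1 - _); rewrite rmorphM rmorph_nat /w !exprMn.
    by rewrite -[RHS]mulf_div divff ?mul1r// expf_neq0.
  rewrite /u; under eq_fun do rewrite csin_sq_div.
  apply: (cvgB (cvg_cst (1 : C)) _); apply: cvgM.
    exact: csin_scaled_sq.
  apply: cvgV.
    by rewrite expf_neq0// rmorphM rmorph_nat mulf_neq0.
  exact: csin_scaled_sq.
have hM K k : (k < K)%N -> cmod (u K k - 1) <= 2 * D ^+ 2 * (k.+1%:R ^+ 2)^-1.
  move=> kK; rewrite /u addrAC subrr add0r cmodN cmodM cmodX cmodV cmod_real.
  rewrite ger0_norm ?sqr_ge0// -/(csc2 _).
  have /csc2_bounds/andP[_ c2] := ang_range kK.
  have h1 : cmod (csin (w / M K)) <= D / M K.
    apply: le_trans (csin_le _) _; rewrite /D cmod_divM mulrAC ler_wpM2r ?invr_ge0 ?(ltW (MR K))//.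
    rewrite ler_wpM2l ?cmod_ge0// lerD2l -cmod_divM.
    by apply: ler_pM; rewrite ?cmod_ge0 ?expR_ge0 ?ler_expR ?cmod_divM_le.
  have h2 : csc2 (ang K k) <= 2 * (M K) ^+ 2 * (k.+1%:R ^+ 2)^-1.
    apply: le_trans c2 _.
    have k1 : (0 : R) < k.+1%:R by rewrite ltr0n.
    have kM : (k.+1%:R : R) <= M K by rewrite ler_nat; lia.
    have p1 : (1 : R) <= pi by apply: le_trans (@pi_ge2 R); lra.
    have a1 : (ang K k ^+ 2)^-1 <= (M K) ^+ 2 * (k.+1%:R ^+ 2)^-1.
      rewrite exprMn exprVn invfM invrK mulrC ler_wpM2l ?sqr_ge0//.
      rewrite lef_pV2 ?posrE ?exprn_gt0 ?mulr_gt0 ?(lt_le_trans _ p1)//.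
      by rewrite ler_pXn2r ?nnegrE ?mulr_ge0 ?(ltW k1) ?(le_trans _ p1)// ler_peMl ?(ltW k1).
    have a2 : 1 <= (M K) ^+ 2 * (k.+1%:R ^+ 2)^-1 :> R.
      by rewrite ler_pdivlMr ?exprn_gt0// mul1r ler_pXn2r ?nnegrE ?(ltW k1) ?(ltW (MR K)).
    by apply: le_trans (lerD a1 a2) _; rewrite le_eqVlt; apply/orP; left; apply/eqP; ring.
  have h3 : cmod (csin (w / M K)) ^+ 2 <= (D / M K) ^+ 2.
    by rewrite ler_pXn2r ?nnegrE ?cmod_ge0 ?divr_ge0 ?(ltW (MR K)).
  apply: le_trans (ler_pM (sqr_ge0 _) _ h3 h2) _; first by rewrite /csc2 invr_ge0 sqr_ge0.
  have k1 := lt0r_neq0 (MR K); have k2 : (k.+1%:R : R) != 0 by rewrite pnatr_eq0.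
  rewrite le_eqVlt; apply/orP; left; apply/eqP.
  by move: (M K) (k.+1%:R : R) k1 k2 => m p m0 p0; field; rewrite m0 p0.
have hB n : \sum_(0 <= k < n) 2 * D ^+ 2 * (k.+1%:R ^+ 2)^-1 <= 2 * D ^+ 2 * 2 :> R.
  rewrite -mulr_sumr; apply: ler_wpM2l; first by rewrite mulr_ge0 ?sqr_ge0.
  by apply: (@zsum_le2 R 2).
have [X [h1 h2]] := tannery_prod hu hM hB.
have e : csin w = w * X.
  apply: (@cvgC_unique R (fun=> csin w)); first exact: cvg_cst.
  rewrite (_ : (fun=> _) = (fun K => (M K * csin (w / M K)) * \prod_(0 <= k < K) u K k)).
    exact: (cvgM (@csin_scaled w) h2).
  apply/funext => K; rewrite -csin_finite; congr csin.
  by have := MC K => h; field.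
rewrite -/w e (_ : w * X / pi%:C = x * X); first exact: (cvgM (cvg_cst x) h1).
by rewrite /w; move: (pi%:C : C) piC0 => p p0; field.
Qed.

End SineLimit.

(** * Rows of a lattice *)

Section Rows.
Variable R : realType.
Local Notation C := (Cplx R).
Variables (tau : C) (x : C).
Hypothesis tau_Im : 0 < complex.Im tau.

(** The product of the Weierstrass factors of w and -w at z, for y = (z / w)^2. It
    differs from 1 by O(y^2) only. *)
Definition weier (y : C) : C := (1 - y) * cexp y.

Let h := complex.Im tau.
Let K := 2 + 2 * complex.Re tau ^+ 2 / h ^+ 2 + (h ^+ 2)^-1.

(** The points of a lattice Z + Z tau above the real axis, row by row; the real
    argument r also takes half-integral values. *)
Definition row_pt (l : nat) (r : R) : C := l.+1%:R * tau + r%:C.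

Let h0 : 0 < h. Proof. exact: tau_Im. Qed.
Let l0 l : (0 : R) < l.+1%:R. Proof. by rewrite ltr0n. Qed.
Let K0 : 0 < K.
Proof.
rewrite /K; apply: addr_gt0; last by rewrite invr_gt0 exprn_gt0.
apply: ltr_wpDr; last by rewrite ltr0n.
by apply: divr_ge0; [apply: mulr_ge0; rewrite ?sqr_ge0|rewrite sqr_ge0].
Qed.

Lemma row_pt_Im l r : complex.Im (row_pt l r) = l.+1%:R * h.
Proof.
rewrite /row_pt /h -(rmorph_nat (real_complex R)); case: tau => a b /=; ring.
Qed.

Lemma row_pt_Re l r : complex.Re (row_pt l r) = l.+1%:R * complex.Re tau + r.
Proof.
rewrite /row_pt -(rmorph_nat (real_complex R)); case: tau => a b /=; ring.
Qed.

Lemma row_pt_low l r : l.+1%:R * h <= cmod (row_pt l r).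
Proof. by rewrite -(row_pt_Im l r) (le_trans (ler_norm _) (cmod_Im _)). Qed.

Lemma row_pt_gt0 l r : 0 < cmod (row_pt l r).
Proof. by apply: lt_le_trans (row_pt_low l r); rewrite mulr_gt0. Qed.

Lemma row_pt_neq0 l r : row_pt l r != 0.
Proof. by rewrite -cmod_gt0 row_pt_gt0. Qed.

Lemma row_pt_low2 l (m : R) : m ^+ 2 + 1 <= K * cmod (row_pt l m) ^+ 2.
Proof.
rewrite /cmod sqr_sqrtr ?addr_ge0 ?sqr_ge0// row_pt_Im row_pt_Re.
rewrite /K -/h; move: (complex.Re tau) => rho.
have n1 : (1 : R) <= l.+1%:R by rewrite ler1n.
move: (l.+1%:R : R) n1 => n n1.
(* Here m^2 <= 2 (n rho + m)^2 + 2 (n rho)^2, and both n and n rho are bounded by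
   multiples of the imaginary part n h; the term 1/h^2 accounts for the summand 1. *)
pose k := 2 + 2 * rho ^+ 2 / h ^+ 2 + (h ^+ 2)^-1; rewrite -/k.
have e : k * ((n * rho + m) ^+ 2 + (n * h) ^+ 2) - (m ^+ 2 + 1) =
   (m + 2 * n * rho) ^+ 2 + (2 * rho ^+ 2 / h ^+ 2 + (h ^+ 2)^-1) * (n * rho + m) ^+ 2
   + 2 * (n * h) ^+ 2 + (n ^+ 2 - 1).
  by rewrite /k; have := lt0r_neq0 h0; move: h => t t0; field.
rewrite -subr_ge0 e; have h2 : 0 <= (h ^+ 2)^-1 by rewrite invr_ge0 sqr_ge0.
have r2 : 0 <= 2 * rho ^+ 2 / h ^+ 2 by rewrite -mulrA; apply: mulr_ge0; rewrite // mulr_ge0 ?sqr_ge0.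
have n2 : 0 <= n ^+ 2 - 1 by rewrite subr_ge0 -[1](expr1n _ 2) ler_pXn2r ?nnegrE// (le_trans _ n1).
apply: addr_ge0 => //; apply: addr_ge0; last by apply: mulr_ge0; rewrite ?sqr_ge0.
by apply: addr_ge0; rewrite ?sqr_ge0// mulr_ge0 ?sqr_ge0 ?addr_ge0.
Qed.

Lemma row_pt_inv l r : (cmod (row_pt l r))^-1 <= h^-1 * (l.+1%:R)^-1.
Proof.
rewrite -invfM mulrC lef_pV2 ?posrE ?row_pt_gt0 ?mulr_gt0//; exact: row_pt_low.
Qed.

Lemma row_pt_inv2 l m : (cmod (row_pt l m) ^+ 2)^-1 <= K * (m ^+ 2 + 1)^-1.
Proof.
have m0 : 0 < m ^+ 2 + 1 by rewrite ltr_wpDl ?sqr_ge0.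
rewrite ler_pdivlMr// mulrC ler_pdivrMr ?exprn_gt0 ?row_pt_gt0//; exact: row_pt_low2.
Qed.

Let V0 l r : 0 <= (cmod (row_pt l r))^-1. Proof. by rewrite invr_ge0 cmod_ge0. Qed.

(** Half of the decay of 1/|a|^4 makes the rows summable, the other half makes the
    sum along a row finite. *)
Lemma row_inv4 l m : (cmod (row_pt l m) ^+ 2)^-1 * (h^-1 * (l.+1%:R)^-1) ^+ 2 <=
  K / h ^+ 2 * (l.+1%:R ^+ 2)^-1 * (m ^+ 2 + 1)^-1.
Proof.
apply: le_trans (ler_wpM2r (sqr_ge0 _) (row_pt_inv2 l m)) _.
rewrite le_eqVlt; apply/orP; left; apply/eqP; rewrite exprMn !exprVn; ring.
Qed.

Lemma weier_row_bound : exists2 D : R, 0 <= D & forall l m,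
  cmod (weier (x ^+ 2 / row_pt l m ^+ 2) - 1) <= D * (l.+1%:R ^+ 2)^-1 * (m ^+ 2 + 1)^-1.
Proof.
pose c := expR (cmod x ^+ 2 * (h^-1) ^+ 2).
exists (2 * cmod x ^+ 4 * c * (K / h ^+ 2)).
  by rewrite !mulr_ge0 ?exprn_ge0 ?cmod_ge0 ?expR_ge0 ?invr_ge0 ?exprn_ge0 ?(ltW K0) ?(ltW h0).
move=> l m; apply: le_trans (weier_bound _) _; rewrite cmodM cmodV !cmodX.
have i1 : (cmod (row_pt l m) ^+ 2)^-1 <= (h^-1 * (l.+1%:R)^-1) ^+ 2.
  rewrite -exprVn ler_pXn2r ?nnegrE ?V0 ?row_pt_inv//.
  by rewrite mulr_ge0 ?invr_ge0 ?(ltW h0).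
have l1 : (h^-1 * (l.+1%:R)^-1) ^+ 2 <= (h^-1) ^+ 2.
  rewrite exprMn ler_piMr ?sqr_ge0// exprVn invf_le1 ?exprn_gt0//.
  by rewrite exprn_ege1// ler1n.
have hc : expR (cmod x ^+ 2 / cmod (row_pt l m) ^+ 2) <= c.
  by rewrite ler_expR; apply: ler_wpM2l; [exact: sqr_ge0|exact: le_trans i1 l1].
have V2 : 0 <= (cmod (row_pt l m) ^+ 2)^-1 by rewrite invr_ge0 sqr_ge0.
have i2 := le_trans (ler_wpM2l V2 i1) (row_inv4 l m).
have -> : 2 * (cmod x ^+ 2 / cmod (row_pt l m) ^+ 2) ^+ 2 =
  2 * cmod x ^+ 4 * ((cmod (row_pt l m) ^+ 2)^-1 * (cmod (row_pt l m) ^+ 2)^-1).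
  by move: (_ ^-1) => v; ring.
have p0 : 0 <= 2 * cmod x ^+ 4 * ((cmod (row_pt l m) ^+ 2)^-1 * (cmod (row_pt l m) ^+ 2)^-1).
  by rewrite !mulr_ge0 ?exprn_ge0 ?cmod_ge0.
apply: le_trans (ler_pM p0 (expR_ge0 _) (ler_wpM2l _ i2) hc) _.
  by rewrite mulr_ge0 ?exprn_ge0 ?cmod_ge0.
by rewrite le_eqVlt; apply/orP; left; apply/eqP; ring.
Qed.

(** The inverse of a^2 - 1/4: it is close to 1/a^2 and telescopes along a row. *)
Definition half_inv (a : C) : C := ((a + (2^-1 : R)%:C) * (a - (2^-1 : R)%:C))^-1.

Lemma row_ptD l m r : row_pt l m + r%:C = row_pt l (m + r).
Proof. by rewrite /row_pt rmorphD addrA. Qed.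

Lemma half_inv_bound : exists2 D : R, 0 <= D & forall l m,
  cmod ((row_pt l m ^+ 2)^-1 - half_inv (row_pt l m)) <=
    D * (l.+1%:R ^+ 2)^-1 * (m ^+ 2 + 1)^-1.
Proof.
exists (4^-1 * (K / h ^+ 2)).
  by rewrite !mulr_ge0 ?invr_ge0 ?exprn_ge0 ?(ltW K0) ?(ltW h0).
move=> l m; set a := row_pt l m; pose u := a + (2^-1 : R)%:C; pose v := a - (2^-1 : R)%:C.
have uE : u = row_pt l (m + 2^-1) by rewrite /u row_ptD.
have vE : v = row_pt l (m - 2^-1) by rewrite /v -rmorphN row_ptD.
have u0 : u != 0 by rewrite uE row_pt_neq0.
have v0 : v != 0 by rewrite vE row_pt_neq0.
have a0 : a != 0 by exact: row_pt_neq0.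
have uv : u * v = a ^+ 2 - 4^-1.
  by rewrite /u /v fmorphV rmorph_nat; field.
have -> : (a ^+ 2)^-1 - half_inv a = - 4^-1 * ((a ^+ 2)^-1 * (u^-1 * v^-1)).
  rewrite /half_inv -/u -/v; transitivity ((u * v - a ^+ 2) * ((a ^+ 2)^-1 * (u^-1 * v^-1))).
    by move: u v u0 v0 {uE vE uv} => u v u0 v0; field; rewrite u0 v0.
  by rewrite uv; congr (_ * _); ring.
rewrite !cmodM !cmodV cmodN cmodV cmod_nat cmodX.
have -> : 4^-1 * (K / h ^+ 2) * (l.+1%:R ^+ 2)^-1 * (m ^+ 2 + 1)^-1 =
  4^-1 * (K / h ^+ 2 * (l.+1%:R ^+ 2)^-1 * (m ^+ 2 + 1)^-1) by rewrite !mulrA.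
apply: ler_wpM2l; first by rewrite invr_ge0.
apply: le_trans _ (row_inv4 l m).
apply: ler_wpM2l; first by rewrite invr_ge0 sqr_ge0.
by rewrite expr2; apply: ler_pM; rewrite ?invr_ge0 ?cmod_ge0// ?uE ?vE row_pt_inv.
Qed.

Lemma row_weight_le N :
  \sum_(i <- iota 0 N.*2.+1) (((i%:Z - N%:Z)%:~R : R) ^+ 2 + 1)^-1 <= 5.
Proof.
rewrite (sym_big _ (fun m => ((m%:~R : R) ^+ 2 + 1)^-1)) /= expr0n /= add0r invr1.
have -> : \sum_(0 <= k < N) ((k.+1%:~R ^+ 2 + 1)^-1 + ((- k.+1%:Z)%:~R ^+ 2 + 1)^-1) =
  2 * \sum_(0 <= k < N) ((k.+1%:R : R) ^+ 2 + 1)^-1.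
  rewrite mulr_sumr; apply: eq_bigr => k _; rewrite rmorphN sqrrN -!pmulrn.
  by rewrite mulr_natl mulr2n.
have := sq_sum_le R N; lra.
Qed.

Lemma weight_scale (c : R) N :
  \sum_(i <- iota 0 N.*2.+1) c * (((i%:Z - N%:Z)%:~R : R) ^+ 2 + 1)^-1 <= 5 * `|c|.
Proof.
rewrite -mulr_sumr mulrC.
have w0 : 0 <= \sum_(i <- iota 0 N.*2.+1) (((i%:Z - N%:Z)%:~R : R) ^+ 2 + 1)^-1.
  by apply: sumr_ge0 => i _; rewrite invr_ge0 addr_ge0 ?sqr_ge0.
apply: le_trans (ler_wpM2l w0 (ler_norm c)) _.
by apply: ler_wpM2r; [exact: normr_ge0|exact: row_weight_le].
Qed.

Local Notation shift i N := (((i%:Z - N%:Z)%:~R) : R).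

(** The product over two opposite rows of the factors of sigma. *)
Definition weier_row N l : C :=
  \prod_(i <- iota 0 N.*2.+1) weier (x ^+ 2 / row_pt l (shift i N) ^+ 2).

Lemma weier_row_sub1 : exists2 D : R, 0 <= D & forall N l,
  cmod (weier_row N l - 1) <= D * (l.+1%:R ^+ 2)^-1.
Proof.
have [D D0 hD] := weier_row_bound.
exists (5 * D * expR (5 * D)); first by rewrite !mulr_ge0 ?expR_ge0.
move=> N l; have j0 : 0 <= (l.+1%:R ^+ 2 : R)^-1 by rewrite invr_ge0 sqr_ge0.
have c0 : 0 <= D * (l.+1%:R ^+ 2)^-1 by rewrite mulr_ge0.
pose t := 5 * (D * (l.+1%:R ^+ 2)^-1); have t0 : 0 <= t by rewrite mulr_ge0.
have := @cmod_prod_sub1_le R (fun i => weier (x ^+ 2 / row_pt l (shift i N) ^+ 2))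
  (fun i => D * (l.+1%:R ^+ 2)^-1 * (shift i N ^+ 2 + 1)^-1) N.*2.+1 (fun i _ => hD l (shift i N)).
rewrite /index_iota subn0 -/(weier_row N l) => h1; apply: le_trans h1 _.
apply: (@le_trans _ _ (expR t - 1)).
  rewrite lerD2r ler_expR; apply: le_trans (weight_scale _ _) _.
  by rewrite ger0_norm.
have e1 : expR t - 1 <= t * expR t.
  have h2 := ler_wpM2r (expR_ge0 t) (expR_ge1Dx (- t)).
  rewrite -expRD addNr expR0 mulrDl mul1r mulNr in h2; lra.
have e2 : expR t <= expR (5 * D).
  rewrite ler_expR /t; apply: ler_wpM2l => //; apply: ler_piMr => //.
  by rewrite invf_le1 ?exprn_gt0// exprn_ege1// ler1n.
apply: le_trans e1 _; apply: le_trans (ler_wpM2l t0 e2) _.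
by rewrite le_eqVlt /t; apply/orP; left; apply/eqP; ring.
Qed.

Definition inv_row N l : C := \sum_(i <- iota 0 N.*2.+1) (row_pt l (shift i N) ^+ 2)^-1.

Lemma weier_rowE N l : weier_row N l =
  \prod_(i <- iota 0 N.*2.+1) (1 - x ^+ 2 / row_pt l (shift i N) ^+ 2) *
  cexp (x ^+ 2 * inv_row N l).
Proof.
rewrite /weier_row /weier big_split; congr (_ * _).
rewrite /inv_row mulr_sumr; move: (iota 0 N.*2.+1); elim=> [|i s IH]; first by rewrite !big_nil cexp0.
by rewrite !big_cons cexpD IH.
Qed.

Lemma half_invE l m : half_inv (row_pt l m) =
  (row_pt l (m - 2^-1))^-1 - (row_pt l (m - 2^-1 + 1))^-1.
Proof.
have -> : m - 2^-1 + 1 = m + 2^-1 by lra.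
have u0 := row_pt_neq0 l (m + 2^-1); have v0 := row_pt_neq0 l (m - 2^-1).
rewrite /half_inv -rmorphN !row_ptD.
have uv : row_pt l (m + 2^-1) - row_pt l (m - 2^-1) = 1.
  rewrite /row_pt opprD addrACA subrr add0r -rmorphB.
  by have -> : m + 2^-1 - (m - 2^-1) = 1 by lra.
move: uv u0 v0; move: (row_pt l (m + 2^-1)) (row_pt l (m - 2^-1)) => u v uv u0 v0.
have -> : v^-1 - u^-1 = (u - v) / (u * v) by field; rewrite u0 v0.
by rewrite uv mul1r.
Qed.

Lemma half_rowE N l : \sum_(i <- iota 0 N.*2.+1) half_inv (row_pt l (shift i N)) =
  (row_pt l (- (N%:R + 2^-1)))^-1 - (row_pt l (N%:R + 2^-1))^-1.
Proof.
pose f (i : nat) : C := - (row_pt l (i%:R - N%:R - 2^-1))^-1.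
have := @telescope_sumr C 0 N.*2.+1 f isT; rewrite /index_iota subn0 => tel.
transitivity (f N.*2.+1 - f 0%N).
  rewrite -tel; apply: eq_bigr => i _; rewrite half_invE /f opprK addrC rmorphB /= -!pmulrn.
  congr (- _^-1 + _); congr row_pt; rewrite -[i.+1]addn1 natrD; ring.
rewrite /f opprK addrC; congr (_^-1 - _^-1); congr row_pt.
  by rewrite sub0r opprD.
by rewrite -addn1 natrD -addnn natrD; lra.
Qed.

Lemma row_pt_far l (m c : R) : 0 < c -> m ^+ 2 = c ^+ 2 ->
  (cmod (row_pt l m))^-1 <= Num.sqrt K * c^-1.
Proof.
move=> c0 mc.
have s0 := sqrtr_ge0 K.
rewrite -(@ler_pXn2r _ 2) ?nnegrE ?V0 ?mulr_ge0 ?invr_ge0 ?(ltW c0)//.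
rewrite exprMn sqr_sqrtr ?(ltW K0)// !exprVn.
apply: le_trans (row_pt_inv2 l m) _; rewrite mc; apply: ler_wpM2l; first exact: ltW.
by rewrite lef_pV2 ?posrE ?exprn_gt0 ?ltr_wpDl ?sqr_ge0 ?lerDl.
Qed.

Lemma half_row_cvg l :
  (fun N => \sum_(i <- iota 0 N.*2.+1) half_inv (row_pt l (shift i N))) @ \oo --> (0 : C).
Proof.
apply: (@squeezeC _ _ _ (fun N => 4 * Num.sqrt K * harmonic N)).
  apply: nearW => N; rewrite subr0 half_rowE.
  have c0 : 0 < (N%:R + 2^-1 : R) by rewrite ltr_wpDl.
  have h1 := @row_pt_far l (N%:R + 2^-1) _ c0 erefl.
  have h2 := @row_pt_far l (- (N%:R + 2^-1)) _ c0 (sqrrN _).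
  apply: le_trans (cmodB _ _) _; rewrite !cmodV; apply: le_trans (lerD h2 h1) _.
  have h3 : (N%:R + 2^-1 : R)^-1 <= 2 * harmonic N.
    rewrite /harmonic /= ler_pdivlMr ?ltr0n// mulrC ler_pdivrMr//.
    by rewrite -addn1 natrD; have := ler0n R N; lra.
  have h4 := ler_wpM2l (sqrtr_ge0 K) h3; lra.
rewrite -(mulr0 (4 * Num.sqrt K)).
exact: (cvgM (cvg_cst _) (@cvg_harmonic R)).
Qed.

(** The sums of 1/a^2 over the rows: a row sum is compared with the telescoping sum
    of 1/(a^2 - 1/4), which tends to 0. *)
Lemma inv_row_cvg : exists (r : nat -> C) (D : R), 0 <= D /\ forall l,
  (fun N => inv_row N l) @ \oo --> r l /\ cmod (r l) <= D * (l.+1%:R ^+ 2)^-1.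
Proof.
have [D D0 hD] := half_inv_bound.
pose d l m : C := (row_pt l m ^+ 2)^-1 - half_inv (row_pt l m).
pose S N l : C := \sum_(i <- iota 0 N.*2.+1) d l (shift i N).
suff hS l : exists y : C, (fun N => S N l) @ \oo --> y.
  have [r hr] := choice hS.
  exists r, (5 * D); split; first by rewrite mulr_ge0.
  move=> l; have hy := hr l; move: (r l) hy => y hy.
  have c0 : 0 <= D * (l.+1%:R ^+ 2)^-1 by rewrite mulr_ge0 ?invr_ge0 ?sqr_ge0.
  split.
    have -> : (fun N => inv_row N l) = (fun N => S N l +
        \sum_(i <- iota 0 N.*2.+1) half_inv (row_pt l (shift i N))).
      by apply/funext => N; rewrite /S /d sumrB subrK.
    have := cvgD hy (@half_row_cvg l); rewrite addr0; exact.
  apply: (cvgC_le hy); apply: nearW => N.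
  apply: le_trans (cmod_sum _ _ _) _.
  apply: le_trans (ler_sum _ (fun i _ => hD l (shift i N))) _.
  by apply: le_trans (weight_scale _ _) _; rewrite ger0_norm// mulrA.
have hd k : cmod (d l k.+1%:~R + d l (- k.+1%:Z)%:~R) <=
    2 * (D * (l.+1%:R ^+ 2)^-1) * (k.+1%:R ^+ 2 + 1)^-1.
  apply: le_trans (cmodD _ _) _; apply: le_trans (lerD (hD _ _) (hD _ _)) _.
  by rewrite rmorphN sqrrN -pmulrn le_eqVlt; apply/orP; left; apply/eqP; ring.
have [|y hy] := abs_cvg hd (B := 2 * (D * (l.+1%:R ^+ 2)^-1) * 2).
  move=> N; rewrite -mulr_sumr ler_wpM2l ?sq_sum_le//.
  by rewrite !mulr_ge0 ?invr_ge0 ?sqr_ge0.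
exists (d l 0 + y).
have -> : (fun N => S N l) = (fun N => d l 0 + \sum_(0 <= k < N)
    (d l k.+1%:~R + d l (- k.+1%:Z)%:~R)).
  by apply/funext => N; rewrite /S (sym_big _ (fun m => d l m%:~R)).
exact: (cvgD (cvg_cst _) hy).
Qed.

End Rows.

(** * Products over the rows of a lattice *)

Section RowProducts.
Variable R : realType.
Local Notation C := (Cplx R).

Lemma cvg_cexp (c : C) (u : nat -> C) (l : C) : u @ \oo --> l ->
  (fun n => cexp (c * u n)) @ \oo --> cexp (c * l).
Proof.
move=> hu.
have cont : {for l, continuous (fun t : C => cexp (c * t))}.
  by apply: differentiable_continuous; apply/derivable1_diffP; exact: derivable_cexp.
exact: (cvg_comp _ _ hu cont).
Qed.

Lemma cexp_sum (I : Type) (s : seq I) (f : I -> C) :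
  cexp (\sum_(i <- s) f i) = \prod_(i <- s) cexp (f i).
Proof.
by elim: s => [|i s IH]; rewrite ?big_nil ?cexp0// !big_cons cexpD IH.
Qed.

(** The partial products of sin(pi b) / pi. *)
Definition sine_partial N (b : C) : C := b * \prod_(0 <= k < N) (1 - b ^+ 2 / k.+1%:R ^+ 2).

Let pi0 : ((pi : R)%:C : C) != 0.
Proof. by rewrite -(rmorph0 (real_complex R)) (inj_eq (@complexI R)) gt_eqF ?pi_gt0. Qed.

Let i20 : 2 * 'i != 0 :> C.
Proof. by rewrite mulf_neq0 ?pnatr_eq0//; apply/eqP => -[] /eqP; rewrite oner_eq0. Qed.

Lemma csinE (b : C) : csin (pi%:C * b) =
  cexp (- ('i * (pi%:C * b))) * (cexp (twopii R * b) - 1) / (2 * 'i).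
Proof.
rewrite /csin mulrBr mulr1 -cexpD; congr ((cexp _ - _) / _).
by rewrite /twopii -mulr_natr rmorphM rmorph_nat; ring.
Qed.

Variable tau : C.
Hypothesis tau_Im : 0 < complex.Im tau.
Local Notation Q := (cexp (twopii R * tau)).

Lemma cmod_Q : cmod Q < 1.
Proof.
rewrite cmod_cexp expR_lt1 /twopii -mulrA.
have := tau_Im; case: tau => [a b] /= b0.
by simpc; rewrite /= oppr_lt0 mulr_gt0// mulrn_wgt0 ?pi_gt0.
Qed.

Lemma cexp_row (l : nat) : cexp (twopii R * (l.+1%:R * tau)) = Q ^+ l.+1.
Proof. by rewrite mulrCA mulr_natl cexpMn. Qed.

Section OneRow.
Variable x : C.
Local Notation X := (cexp (twopii R * x)).

(** Up to normalization, sine_partial N b is the product of b + m over |m| <= N, so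
    that both sides are the product of (a - x)(a + x) / a^2 over the row. *)
Lemma row_prod_sine N l :
  \prod_(i <- iota 0 N.*2.+1) (1 - x ^+ 2 / row_pt tau l (i%:Z - N%:Z)%:~R ^+ 2) =
  sine_partial N (l.+1%:R * tau - x) * sine_partial N (l.+1%:R * tau + x) /
  sine_partial N (l.+1%:R * tau) ^+ 2.
Proof.
rewrite (sym_big _ (fun m : int => 1 - x ^+ 2 / row_pt tau l m%:~R ^+ 2)) /=.
set b := l.+1%:R * tau.
have p0 : row_pt tau l 0 = b by rewrite /row_pt rmorph0 addr0.
have b0 : b != 0 by rewrite -p0 row_pt_neq0.
have pD k : row_pt tau l k.+1%:~R = b + k.+1%:R by rewrite /row_pt -pmulrn rmorph_nat.
have pB k : row_pt tau l (- k.+1%:Z)%:~R = b - k.+1%:R.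
  by rewrite /row_pt mulrNz -pmulrn rmorphN rmorph_nat.
have fac k : (1 - x ^+ 2 / row_pt tau l k.+1%:~R ^+ 2) *
      (1 - x ^+ 2 / row_pt tau l (- k.+1%:Z)%:~R ^+ 2) =
    (1 - (b - x) ^+ 2 / k.+1%:R ^+ 2) * (1 - (b + x) ^+ 2 / k.+1%:R ^+ 2) /
    (1 - b ^+ 2 / k.+1%:R ^+ 2) ^+ 2.
  have := row_pt_neq0 tau_Im l k.+1%:~R; have := row_pt_neq0 tau_Im l (- k.+1%:Z)%:~R.
  rewrite pD pB; have : (k.+1%:R : C) != 0 by rewrite pnatr_eq0.
  move: (k.+1%:R : C) => c c0 u0 v0; clear p0 pD pB; move: b b0 u0 v0 => b' b0 u0 v0.
  have e : 1 - b' ^+ 2 / c ^+ 2 = - ((b' - c) * (b' + c)) / c ^+ 2 by field.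
  by rewrite e; field; rewrite c0 u0 v0.
under eq_bigr do rewrite fac.
rewrite big_split /= big_split /= prodfV prodrXl p0 /sine_partial.
move: (\prod_(_ <= _ < _) _) (\prod_(_ <= _ < _) _) (\prod_(_ <= _ < _) _) => P1 P2 P3.
have -> : 1 - x ^+ 2 / b ^+ 2 = (b - x) * (b + x) / b ^+ 2 by field.
rewrite [(b * P3) ^+ 2]exprMn [(b ^+ 2 * _)^-1]invfM; ring.
Qed.

(** Each factor sin(pi b) is 1 - e^(2 pi i b) up to an exponential, and these
    exponentials cancel in the quotient. *)
Lemma row_sine_limit l :
  (fun N => sine_partial N (l.+1%:R * tau - x) * sine_partial N (l.+1%:R * tau + x) /
    sine_partial N (l.+1%:R * tau) ^+ 2) @ \oo -->
  (1 - Q ^+ l.+1 * X) * (1 - Q ^+ l.+1 * X^-1) / (1 - Q ^+ l.+1) ^+ 2.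
Proof.
set b := l.+1%:R * tau.
have q1 : 1 - Q ^+ l.+1 != 0 by apply: one_sub_qX_neq0; exact: cmod_Q.
have sb : csin (pi%:C * b) / pi%:C != 0.
  rewrite mulf_neq0 ?invr_eq0// csinE cexp_row mulf_neq0 ?invr_eq0//.
  by rewrite mulf_neq0 ?cexp_neq0// -opprB oppr_eq0.
have c1 := @csin_prod R (b - x); have c2 := @csin_prod R (b + x); have c3 := @csin_prod R b.
have -> : (1 - Q ^+ l.+1 * X) * (1 - Q ^+ l.+1 * X^-1) / (1 - Q ^+ l.+1) ^+ 2 =
   csin (pi%:C * (b - x)) / pi%:C * (csin (pi%:C * (b + x)) / pi%:C) *
   ((csin (pi%:C * b) / pi%:C) * (csin (pi%:C * b) / pi%:C))^-1.
  rewrite !csinE (mulrBr (twopii R)) (mulrDr (twopii R)) cexpB (cexpD (twopii R * b)) cexp_row.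
  have -> : - ('i * (pi%:C * (b - x))) = - ('i * (pi%:C * b)) + 'i * (pi%:C * x) :> C by ring.
  have -> : - ('i * (pi%:C * (b + x))) = - ('i * (pi%:C * b)) - 'i * (pi%:C * x) :> C by ring.
  rewrite cexpD cexpB.
  have := cexp_neq0 (- ('i * (pi%:C * b)) : C); have := cexp_neq0 ('i * (pi%:C * x) : C).
  have := cexp_neq0 (twopii R * x).
  move: (cexp (twopii R * x)) (cexp ('i * (pi%:C * x))) (cexp (- ('i * (pi%:C * b)))).
  move=> X' u v X0 u0 v0.
  clear c1 c2 c3 sb; move: (pi%:C : C) (2 * 'i : C) (Q ^+ _) pi0 i20 q1 => p j q p0 j0 q1.
  have q1' : q - 1 != 0 by rewrite -opprB oppr_eq0.
  by field; rewrite p0 j0 q1' v0 u0 X0 q1.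
have -> : (fun N => sine_partial N (b - x) * sine_partial N (b + x) / sine_partial N b ^+ 2) =
   (fun N => sine_partial N (b - x) * sine_partial N (b + x) *
      (sine_partial N b * sine_partial N b)^-1).
  by apply/funext => N; rewrite expr2.
apply: cvgM; first exact: (cvgM c1 c2).
apply: cvgV; first by apply: mulf_neq0.
exact: (cvgM c3 c3).
Qed.

End OneRow.

Local Notation theta_prod X := (eulerE Q X * eulerE Q X^-1 / eulerE Q 1 ^+ 2).

(** The sine quotients of all rows multiply to the two Euler products in theta. The
    exponential factors contribute the sum A of 1/a^2, row by row, which does not
    depend on x. *)
Lemma rows_limit : exists A : C, forall x : C,
  (fun N => \prod_(0 <= l < N) weier_row tau x N l) @ \oo -->
  theta_prod (cexp (twopii R * x)) * cexp (x ^+ 2 * A).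
Proof.
have [r [D [D0 hr]]] := inv_row_cvg tau_Im.
have [|A hA] := abs_cvg (fun l => (hr l).2) (B := D * 2).
  move=> n; rewrite -mulr_sumr; apply: ler_wpM2l => //; exact: (@zsum_le2 R 2).
exists A => x; set X := cexp (twopii R * x); have q1 := cmod_Q.
pose s l : C := (1 - Q ^+ l.+1 * X) * (1 - Q ^+ l.+1 * X^-1) / (1 - Q ^+ l.+1) ^+ 2.
have [D' D'0 hD'] := weier_row_sub1 x tau_Im.
have hu l : (fun N => weier_row tau x N l) @ \oo --> s l * cexp (x ^+ 2 * r l).
  have -> : (fun N => weier_row tau x N l) = (fun N =>
      sine_partial N (l.+1%:R * tau - x) * sine_partial N (l.+1%:R * tau + x) /
      sine_partial N (l.+1%:R * tau) ^+ 2 * cexp (x ^+ 2 * inv_row tau N l)).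
    by apply/funext => N; rewrite weier_rowE row_prod_sine.
  have g1 := @row_sine_limit x l.
  have g2 := @cvg_cexp (x ^+ 2) (fun N => inv_row tau N l) (r l) (hr l).1.
  have g := cvgM g1 g2.
  rewrite /s /X.
  exact: g.
have hB n : \sum_(0 <= l < n) D' * (l.+1%:R ^+ 2)^-1 <= D' * 2.
  rewrite -mulr_sumr; apply: ler_wpM2l => //; exact: (@zsum_le2 R 2).
have [Y [h1 h2]] := tannery_prod hu (fun N l _ => hD' N l) hB.
suff -> : theta_prod X * cexp (x ^+ 2 * A) = Y by exact: h2.
apply: (cvgC_unique _ h1).
have -> : (fun n => \prod_(0 <= l < n) (s l * cexp (x ^+ 2 * r l))) =
  (fun n => (\prod_(0 <= l < n) (1 - Q ^+ l.+1 * X)) * (\prod_(0 <= l < n) (1 - Q ^+ l.+1 * X^-1)) *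
   ((\prod_(0 <= l < n) (1 - Q ^+ l.+1 * 1)) * (\prod_(0 <= l < n) (1 - Q ^+ l.+1 * 1)))^-1 *
   cexp (x ^+ 2 * series r n)).
  apply/funext => n; rewrite big_split; congr (_ * _).
    have e1 : \prod_(0 <= l < n) (1 - Q ^+ l.+1 * 1) = \prod_(0 <= l < n) (1 - Q ^+ l.+1).
      by apply: eq_bigr => l _; rewrite mulr1.
    by rewrite e1 -expr2 -prodrXl -prodfV -!big_split.
  by rewrite /series /= mulr_sumr cexp_sum.
have cE := @eulerE_cvg R Q q1.
apply: cvgM; last exact: (@cvg_cexp (x ^+ 2) _ _ hA).
apply: cvgM; first exact: (cvgM (cE X) (cE X^-1)).
rewrite expr2; apply: cvgV; last exact: (cvgM (cE 1) (cE 1)).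
by apply: mulf_neq0; exact: eulerE1_neq0.
Qed.

(** The row through 0 gives the sine product, and an exponential of x^2 zeta(2). *)
Lemma axis_limit : exists Z : C, forall x : C,
  (fun N => x * \prod_(0 <= k < N) weier (x ^+ 2 / k.+1%:R ^+ 2)) @ \oo -->
  csin (pi%:C * x) / pi%:C * cexp (x ^+ 2 * Z).
Proof.
have [|n|Z hZ] := @abs_cvg R (fun k => (k.+1%:R ^+ 2)^-1) (fun k => (k.+1%:R ^+ 2)^-1) 2.
- by move=> k; rewrite cmodV cmodX cmod_nat.
- exact: (@zsum_le2 R 2).
exists Z => x.
have -> : (fun N => x * \prod_(0 <= k < N) weier (x ^+ 2 / k.+1%:R ^+ 2)) =
  (fun N => sine_partial N x * cexp (x ^+ 2 * series (fun k => (k.+1%:R ^+ 2)^-1) N)).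
  apply/funext => N; rewrite /weier big_split /sine_partial mulrA; congr (_ * _).
  by rewrite /series /= mulr_sumr cexp_sum.
exact: (cvgM (@csin_prod R x) (@cvg_cexp (x ^+ 2) _ _ hZ)).
Qed.

End RowProducts.

(** * The sigma function as a theta function *)

Section Sigma.
Variable R : realType.
Local Notation C := (Cplx R).
Variable L : lattice R.
Local Notation om := (per1 L).
Local Notation tau := (per_up L / per1 L).

Let om0 : om != 0. Proof. exact: per1_neq0. Qed.

Definition weier_factor (z w : C) : C := (1 - z / w) * cexp (z / w + (z / w) ^+ 2 / 2%:R).

Lemma weier_factor_pair z w :
  weier_factor z w * weier_factor z (- w) = weier ((z / w) ^+ 2).
Proof.
rewrite /weier_factor /weier invrN mulrN sqrrN opprK mulrACA -cexpD.
move: (z / w) => y; congr (_ * cexp _); first by ring.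
by field.
Qed.

Lemma prod_sym_rev (G : int -> C) N :
  \prod_(i <- iota 0 N.*2.+1) G (- (i%:Z - N%:Z)) = \prod_(i <- iota 0 N.*2.+1) G (i%:Z - N%:Z).
Proof.
rewrite (sym_big _ (fun m => G (- m))) (sym_big _ G) oppr0; congr (_ * _).
by apply: eq_bigr => k _; rewrite /= opprK mulrC.
Qed.

Lemma lattice_ptN m n : lattice_pt L (- m) (- n) = - lattice_pt L m n.
Proof. by rewrite /lattice_pt !mulrNz opprD. Qed.

Lemma row_pt_lattice (m : int) l : row_pt tau l m%:~R =
  lattice_pt L m (if 0 < complex.Im (per2 L / per1 L) then l.+1%:Z else - l.+1%:Z) / om.
Proof.
rewrite /lattice_pt mulrDl -[per1 L *~ m]mulrzl mulfK// addrC /row_pt.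
rewrite rmorph_int; congr (_ + _); rewrite /per_up.
case: ifP => _; first by rewrite -pmulrn -[per2 L *+ _]mulr_natl mulrA.
by rewrite mulrNz -pmulrn -[per2 L *+ _]mulr_natl; ring.
Qed.

(** The points of the row below the axis are the negatives of those above, and
    which of the two has positive imaginary part is the choice in per_up. *)
Lemma weier_row_lattice z N l :
  (\prod_(i <- iota 0 N.*2.+1) weier_factor z (lattice_pt L (i%:Z - N%:Z) l.+1)) *
  (\prod_(i <- iota 0 N.*2.+1) weier_factor z (lattice_pt L (i%:Z - N%:Z) (- l.+1%:Z))) =
  weier_row tau (z / om) N l.
Proof.
have e (n : int) : (\prod_(i <- iota 0 N.*2.+1) weier_factor z (lattice_pt L (i%:Z - N%:Z) n)) *
  (\prod_(i <- iota 0 N.*2.+1) weier_factor z (lattice_pt L (i%:Z - N%:Z) (- n))) =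
  \prod_(i <- iota 0 N.*2.+1) weier ((z / lattice_pt L (i%:Z - N%:Z) n) ^+ 2).
  rewrite -[X in _ * X](prod_sym_rev (fun m => weier_factor z (lattice_pt L m (- n)))).
  by rewrite -big_split; apply: eq_bigr => i _; rewrite /= lattice_ptN weier_factor_pair.
have w m : weier ((z / om) ^+ 2 / row_pt tau l m%:~R ^+ 2) = weier ((z / lattice_pt L m
   (if 0 < complex.Im (per2 L / per1 L) then l.+1%:Z else - l.+1%:Z)) ^+ 2).
  rewrite row_pt_lattice -expr_div_n; congr (weier (_ ^+ 2)).
  by rewrite invfM invrK mulrACA mulVf// mulr1.
rewrite /weier_row.
under [RHS]eq_bigr do rewrite w.
case: ifP => _; first exact: e.
by rewrite mulrC -(e (- l.+1%:Z)) opprK.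
Qed.

Lemma sigma_box z N : z * \prod_(w <- lattice_box L N | w != 0) weier_factor z w =
  om * (z / om * \prod_(0 <= k < N) weier ((z / om) ^+ 2 / k.+1%:R ^+ 2)) *
  \prod_(0 <= l < N) weier_row tau (z / om) N l.
Proof.
rewrite box_big [LHS]mulrA; congr (_ * _); last first.
  by apply: eq_bigr => l _; exact: weier_row_lattice.
rewrite [RHS]mulrA [om * _]mulrC divfK//; congr (_ * _); apply: eq_bigr => k _.
have -> : lattice_pt L (- k.+1%:Z) 0 = - lattice_pt L k.+1 0 by rewrite -lattice_ptN oppr0.
rewrite /= weier_factor_pair /lattice_pt mulr0z addr0.
rewrite -expr_div_n -pmulrn -[om *+ _]mulr_natr; congr (weier (_ ^+ 2)).
by rewrite invfM mulrA.
Qed.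

(** Row by row, the product for sigma is the triple product of theta times
    exponentials of multiples of z^2; sin(pi x) itself contributes the linear term. *)
Lemma sigma_thetaS : exists A B : C, forall z : C,
  sigma L z = cexp (A * z ^+ 2 + B * z) * thetaS L z.
Proof.
have [A hA] := rows_limit (per_up_Im L); have [Z hZ] := axis_limit R.
exists ((A + Z) / om ^+ 2), (- ('i * pi%:C / om)) => z.
have [->|z0] := eqVneq z 0.
  have [[h [-> _ _]] _ _] := thetaS_sigma_like L.
  by rewrite /sigma !mul0r mulr0.
pose x := z / om; pose X := cexp (twopii R * x).
pose l := om * (csin (pi%:C * x) / pi%:C * cexp (x ^+ 2 * Z)) *
  (eulerE (nome L) X * eulerE (nome L) X^-1 / eulerE (nome L) 1 ^+ 2 * cexp (x ^+ 2 * A)).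
have nE : cexp (twopii R * tau) = nome L by rewrite /nome /cperiod mulrA mulrAC.
have lim1 : (fun N => z * \prod_(w <- lattice_box L N | w != 0) weier_factor z w) @ \oo --> l.
  rewrite (funext (sigma_box z)) /l -nE.
  exact: (cvgM (cvgM (cvg_cst om) (hZ x)) (hA x)).
have lim2 : (fun N => \prod_(w <- lattice_box L N | w != 0) weier_factor z w) @ \oo --> z^-1 * l.
  rewrite (_ : (fun N => _) = (fun N => z^-1 *
      (z * \prod_(w <- lattice_box L N | w != 0) weier_factor z w))).
    exact: (cvgM (cvg_cst z^-1) lim1).
  by apply/funext => N; rewrite mulKf.
rewrite /sigma /lattice_prod (limC lim2) mulVKf// /l thetaSE /theta.
have -> : cperiod L * z = twopii R * x by rewrite /cperiod /x mulrAC mulrA.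
rewrite -/X csinE -/X.
have -> : cexp ((A + Z) / om ^+ 2 * z ^+ 2 + - ('i * pi%:C / om) * z) =
    cexp (- ('i * (pi%:C * x))) * cexp (x ^+ 2 * Z) * cexp (x ^+ 2 * A).
  rewrite -!cexpD; congr cexp; rewrite /x.
  by move: ('i : C) (pi%:C : C) => i p; field.
have cE : - cperiod L = - (2 * 'i) * pi%:C / om.
  by rewrite /cperiod /twopii -[pi *+ 2]mulr_natl rmorphM rmorph_nat; ring.
have i20 : 2 * 'i != 0 :> C.
  by rewrite mulf_neq0 ?pnatr_eq0//; apply/eqP => -[] /eqP; rewrite oner_eq0.
have p0 : (pi%:C : C) != 0.
  by rewrite -(rmorph0 (real_complex R)) (inj_eq (@complexI R)) gt_eqF ?pi_gt0.
have e0 : eulerE (nome L) 1 != 0 by apply: eulerE1_neq0; exact: cmod_nome.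
rewrite cE; clear lim1 lim2 nE l; clearbody X.
move: (cexp _) (cexp _) (cexp _) (eulerE _ 1) e0 (eulerE _ X) (eulerE _ X^-1).
move=> u v w e e0 E1 E2; move: (2 * 'i : C) (pi%:C : C) i20 p0 => j p j0 p0.
by field; rewrite e0 om0 j0 p0.
Qed.

End Sigma.

(** * Krichever functions that solve the Hirzebruch equation *)

Section Main.
Variable R : realType.
Local Notation C := (Cplx R).

(** In sigma(s) sigma(t) / sigma(s - t) the quadratic exponentials of sigma leave
    a factor that is exponential in t. *)
Lemma krichever_sigma_quot (L : lattice R) (s alpha : C) : exists b : C, forall t,
  krichever_fun L s alpha t = sigma_quot (thetaS L) s b t.
Proof.
have [A [B hS]] := sigma_thetaS L.
exists (alpha - zeta L s + 2 * A * s + 2 * B) => t.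
rewrite /krichever_fun /baker_akhiezer /sigma_quot !hS.
pose g z := A * z ^+ 2 + B * z; rewrite -!/(g _).
have -> : cexp ((alpha - zeta L s + 2 * A * s + 2 * B) * t) =
  cexp (alpha * t) * (cexp (zeta L s * t))^-1 * cexp (g s) * cexp (g t) * (cexp (g (s - t)))^-1.
  by rewrite -!cexpN -!cexpD; congr cexp; rewrite /g; ring.
move: (cexp _) (cexp _) (cexp (g s)) (cexp _) (cexp _) => a b c d e.
move: (thetaS L s) (thetaS L t) (thetaS L (s - t)) => u v w.
rewrite [(_ * a)^-1]invfM [(_ / _)^-1]invfM [_^-1^-1]invrK [(d * w)^-1]invfM; ring.
Qed.

(** The multiplier of the period 2 pi i / (2 eta) is an (n+1)-th root of unity. *)
Lemma sing_exponent_rational (lambda q eta c : C) n : (1 <= n)%N -> eta != 0 ->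
  hirzebruch_eq n (sing_fun lambda q eta) c ->
  exists k : int, lambda = 2 * eta * (k%:~R / n.+1%:R).
Proof.
move=> n0 eta0 hH.
have h := hirzebruch_period n0 (@sing_near_id R lambda q eta) hH (cexp_neq0 _)
  (fun t => sing_period lambda q t eta0).
rewrite -cexpMn in h; have [k hk] := cexp_kernel h; exists k.
have e20 : 2 * eta != 0 by rewrite mulf_neq0 ?pnatr_eq0.
rewrite -[LHS]mulr_natr -[RHS]mulrzr in hk.
have N0 : (n.+1%:R : C) != 0 by rewrite pnatr_eq0.
apply: (mulfI (twopii_neq0 R)); apply: (mulIf N0); apply: (mulIf (invr_neq0 e20)).
transitivity (twopii R * k%:~R); last first.
  move: (twopii R) (k%:~R : C) N0 => w m N0; move: (n.+1%:R : C) N0 => N N0.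
  by field; rewrite N0 eta0.
by rewrite -hk; ring.
Qed.

(** For kappa = lambda / (2 eta) = k / (n+1) > 0, escape to infinity excludes
    q <> eta and kappa > 1. For q = eta the function is
    X^(kappa - 1) (X - 1) / (2 eta) with X = e^(2 eta t): a Todd function if
    kappa = 1, and a limit of elliptic functions of level n+1 otherwise. *)
Lemma sing_todd_or_degenerate (lambda q eta c : C) n : (1 <= n)%N -> eta != 0 ->
  hirzebruch_eq n (sing_fun lambda q eta) c ->
  (exists k : nat, (0 < k)%N /\ lambda = 2 * eta * (k%:R / n.+1%:R)) ->
  let f := sing_fun lambda q eta in
  (exists alpha beta : C, forall t, f t = todd_fun alpha beta t) \/
  is_degenerate_elliptic_level n.+1 f.
Proof.
move=> n0 eta0 hH [k [k0 lE]] /=.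
have e20 : 2 * eta != 0 by rewrite mulf_neq0 ?pnatr_eq0.
have kapE : lambda / (2 * eta) = (k%:R / n.+1%:R : R)%:C.
  by rewrite lE mulrAC divff// mul1r rmorphM fmorphV !rmorph_nat.
have kap0 : 0 < complex.Re (lambda / (2 * eta)).
  by rewrite kapE /= divr_gt0 ?ltr0n.
have [qe|qe] := eqVneq q eta; last by case: (sing_escape_ne n0 eta0 hH kap0 qe).
have [kN|kN|kN] := ltngtP k n.+1.
- right; have -> : sing_fun lambda q eta = deg_limit eta n.+1 k.
    apply/funext => t; rewrite -(@sing_fun_deg_limit _ eta n.+1 k eta0) qe; congr sing_fun.
    by rewrite -kapE mulrC divfK.
  exact: degenerate_level.
- case: (sing_escape_eq n0 eta0 hH kap0 qe).
  by rewrite kapE /= ltr_pdivlMr ?ltr0n// mul1r ltr_nat.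
- left; exists (2 * eta), 0 => t.
  have l2 : lambda = 2 * eta by rewrite lE kN divff ?mulr1// pnatr_eq0.
  rewrite sing_funE// qe l2 /todd_fun (negPf e20) !mul0r cexp0 mulr1 subrr !subr0.
  have := cexp_neq0 (2 * eta * t); move: (cexp _) => X X0.
  by rewrite -[eta + eta]mulr2n -mulr_natl; field; rewrite X0 eta0.
Qed.

End Main.

Theorem theorem1p1 (R : realType) (n : nat) (hn : (1 <= n)%N)
    (f : Cplx R -> Cplx R) (hf : is_krichever f)
    (hH : exists c : Cplx R, hirzebruch_eq n f c) :
  (exists alpha beta : Cplx R, forall t, f t = todd_fun alpha beta t) \/
  (exists d : nat,
     [/\ (1 < d)%N, (d %| n.+1)%N &
         is_elliptic_level d f \/ is_degenerate_elliptic_level d f]).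
Proof.
have [c {}hH] := hH; case: hf => [[L [s [alpha [sL hf]]]]|[lambda [q [eta hf]]]].
  right; exists n.+1; split; [by rewrite ltnS|exact: dvdnn|left; exists L].
  have [b hb] := krichever_sigma_quot L s alpha.
  have fE : f = sigma_quot (thetaS L) s b by apply/funext => t; rewrite hf hb.
  by rewrite fE in hH *; exact: (nondegenerate_level hn sL hH).
have fE : f = sing_fun lambda q eta by apply/funext.
rewrite {}fE {hf} in hH *.
have [l0|l0] := eqVneq lambda 0.
  by left; exists (eta - q), (- eta - q) => t; rewrite l0 sing_todd.
have [eta0|eta0] := eqVneq eta 0.
  by rewrite eta0 in hH; case: (sing_escape_0 hn l0 hH).
have [k lE] := sing_exponent_rational hn eta0 hH.
suff [|h] : (exists alpha beta : Cplx R, forall t, sing_fun lambda q eta t = todd_fun alpha beta t) \/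
    is_degenerate_elliptic_level n.+1 (sing_fun lambda q eta).
- by left.
- by right; exists n.+1; split; [rewrite ltnS|exact: dvdnn|right].
case: k lE => [[|k]|k] lE.
- by move: l0; rewrite lE mul0r mulr0 eqxx.
- by apply: (sing_todd_or_degenerate hn eta0 hH); exists k.+1.
have eN : sing_fun lambda q eta = sing_fun lambda q (- eta).
  by apply/funext => t; rewrite sing_funN.
rewrite eN in hH *; apply: (sing_todd_or_degenerate hn _ hH); first by rewrite oppr_eq0.
exists k.+1; split => //; rewrite lE NegzE mulrNz -pmulrn.
by move: (k.+1%:R : Cplx R) => m; ring.
Qed.
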